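(* Let $\mathcal H$ be a regular unitarily invariant space on $\mathbb B_d$ and suppose that there exist non-empty $\operatorname{Mult}(\mathcal H)$-totally null sets. Let $E\subset\partial\mathbb B_d$ be a compact set. If the restriction map $A(\mathcal H)\to C(E)$, $f\mapsto f|_E$, is surjective, then $E$ is $\operatorname{Mult}(\mathcal H)$-totally null.
   Context: Let $d\in\mathbb N$, let $\mathbb B_d\subset\mathbb C^d$ be the Euclidean open unit ball and $\partial\mathbb B_d$ the unit sphere. A regular unitarily invariant space on $\mathbb B_d$ is a reproducing kernel Hilbert space $\mathcal H$ on $\mathbb B_d$ with kernel $K(z,w)=\sum_{n=0}^\infty a_n\langle z,w\rangle^n$, where $a_0=1$, $a_n>0$ for all $n$, and $\lim_{n\to\infty} a_n/a_{n+1}=1$. $\operatorname{Mult}(\mathcal H)$ is the multiplier algebra, normed by $\|f\|_{\operatorname{Mult}(\mathcal H)}=\|M_f\|_{B(\mathcal H)}$, where $M_f$ is multiplication by $f$. Via $f\mapsto M_f$ it is a WOT-closed subalgebra of $B(\mathcal H)$, and its weak-$*$ topology is that of the dual of $\mathcal T(\mathcal H)/\operatorname{Mult}(\mathcal H)_\perp$, where $\mathcal T(\mathcal H)$ is the trace class. $A(\mathcal H)$ is the norm closure of $\mathbb C[z_1,\dots,z_d]$ in $\operatorname{Mult}(\mathcal H)$; its elements extend uniquely to continuous functions on $\overline{\mathbb B_d}$. A (complex) regular Borel measure $\mu$ on $\partial\mathbb B_d$ is $\operatorname{Mult}(\mathcal H)$-Henkin if $p\mapsto\int_{\partial\mathbb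 B_d} p\,d\mu$ on polynomials extends to a weak-$*$ continuous functional on $\operatorname{Mult}(\mathcal H)$. A Borel set $E\subset\partial\mathbb B_d$ is $\operatorname{Mult}(\mathcal H)$-totally null if $|\mu|(E)=0$ for every $\operatorname{Mult}(\mathcal H)$-Henkin measure $\mu$. *)

(* Defs.v *)
From HB Require Import structures.
From mathcomp Require Import all_boot all_order all_algebra.
From mathcomp Require Import complex.
From mathcomp Require Import all_classical all_reals all_analysis.
From mathcomp Require summability mpoly.

Set Implicit Arguments.
Unset Strict Implicit.
Unset Printing Implicit Defensive.

Import Order.TTheory GRing.Theory Num.Theory.
Import numFieldNormedType.Exports.

Local Open Scope classical_set_scope.
Local Open Scope ring_scope.

HB.instance Definition _ (R : realType) := NormedModule.copy R[i] R[i]^o.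

Section Hilbert.
Context (R : realType) (V : lmodType R[i]).
Implicit Types (ip : {dot V for Num.conj}) (B : set V).

Definition inorm ip (u : V) : R := Num.sqrt (complex.Re (ip u u)).

Definition cauchy_complete ip : Prop :=
  forall u : nat -> V,
    (forall e : R, 0 < e -> exists N : nat, forall m n : nat,
      (N <= m)%N -> (N <= n)%N -> inorm ip (u m - u n) < e) ->
    exists l : V, inorm ip (u n - l) @[n --> \oo] --> (0 : R).

Definition bounded_op ip (T : V -> V) : Prop :=
  exists M : R, forall u, inorm ip (T u) <= M * inorm ip u.

Definition positive_op ip (T : V -> V) : Prop := forall u, 0 <= ip (T u) u.

Definition op_norm ip (T : V -> V) : \bar R :=
  ereal_sup [set (inorm ip (T u))%:E | u in [set u | inorm ip u <= 1]].

Definition orthonormal_basis ip B : Prop :=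
  [/\ forall u v, B u -> B v -> ip u v = (u == v)%:R
    & forall u, (forall v, B v -> ip u v = 0) -> u = 0].

(* [P] is the absolute value |T|: the positive square root of T^* T. *)
Definition is_absolute_value ip (T P : {linear V -> V}) : Prop :=
  [/\ bounded_op ip P, positive_op ip P
    & forall u v, ip (P (P u)) v = ip (T u) (T v)].

Definition trace_class ip (T : {linear V -> V}) : Prop :=
  bounded_op ip T /\
  exists P : {linear V -> V}, is_absolute_value ip T P /\
    exists B, orthonormal_basis ip B /\
      (\esum_(e in B) (complex.Re (ip (P e) e))%:E < +oo)%E.

(* For a trace class operator the unordered sum of the <T e, e> converges, to
   a value that does not depend on the basis. *)
Definition is_trace ip (T : V -> V) (t : R[i]) : Prop :=
  forall B, orthonormal_basis ip B ->
    summability.partial_sum (fun e : B => ip (T (val e)) (val e))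
      @ summability.totally --> t.

Definition trace ip (T : V -> V) : R[i] := xget 0 (is_trace ip T).

End Hilbert.

(* A Hilbert space of functions on [X]: the elements of the abstract space
   [rkhs_space] are identified with functions by the injective map [rkhs_fun].
   The inner product is linear in its first argument. *)
Record rkhs (R : realType) (X : Type) := Rkhs {
  rkhs_space : lmodType R[i];
  rkhs_dot : {dot rkhs_space for Num.conj};
  rkhs_fun : {linear rkhs_space -> (X -> R[i])};
  rkhs_kernel : X -> X -> R[i];
  rkhs_fun_inj : injective rkhs_fun;
  rkhs_complete : cauchy_complete rkhs_dot;
  rkhs_reproducing : forall w, exists k : rkhs_space,
    rkhs_fun k = (fun z => rkhs_kernel z w) /\
    forall f, rkhs_fun f w = rkhs_dot f k }.

Section Multipliers.
Context (R : realType) (X : Type) (H : rkhs R X).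

Definition multiplier : {pred X -> R[i]} := fun phi =>
  `[< forall f, exists g, rkhs_fun H g = (fun x => phi x * rkhs_fun H f x) >].

Lemma multiplier_submod_closed : submod_closed multiplier.
Proof.
split.
  apply/asboolP => f; exists 0; rewrite linear0.
  by apply/funext => x; rewrite /= mul0r.
move=> c phi psi /asboolP hphi /asboolP hpsi; apply/asboolP => f.
have [g hg] := hphi f; have [h hh] := hpsi f.
exists (c *: g + h); rewrite linearP hg hh.
by apply/funext => x; rewrite !fctE mulrDl -scalerAl.
Qed.

HB.instance Definition _ :=
  GRing.isSubmodClosed.Build _ _ multiplier multiplier_submod_closed.

Definition Mult : Type := {phi : X -> R[i] | multiplier phi}.

HB.instance Definition _ := SubChoice.on Mult.
HB.instance Definition _ := [SubChoice_isSubLmodule of Mult by <:].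

(* The operator M_phi; the value is unique since [rkhs_fun] is injective. *)
Definition mult_op (phi : Mult) (f : rkhs_space H) : rkhs_space H :=
  xget 0 [set g | rkhs_fun H g = (fun x => val phi x * rkhs_fun H f x)].

Definition mult_norm (phi : Mult) : \bar R := op_norm (rkhs_dot H) (mult_op phi).

Definition traceClass : Type :=
  {T : {linear rkhs_space H -> rkhs_space H} | trace_class (rkhs_dot H) T}.

HB.instance Definition _ := gen_eqMixin traceClass.
HB.instance Definition _ := gen_choiceMixin traceClass.

Definition trace_pairing (phi : Mult) : {ptws traceClass -> R[i]} :=
  fun T => trace (rkhs_dot H) (mult_op phi \o sval T).

(* The weak-* topology of the dual of T(H) / Mult(H)_perp: the coarsest one
   for which every phi |-> tr(M_phi T), T of trace class, is continuous. *)
Definition weakstar : Type := initial_topology trace_pairing.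

HB.instance Definition _ := Topological.on weakstar.

End Multipliers.

Section ComplexMeasure.
Context (R : realType) (d : measure_display) (T : measurableType d).

(* Charges are finite, so these are exactly the complex measures. *)
Record complex_measure := ComplexMeasure {
  re_part : {charge set T -> \bar R};
  im_part : {charge set T -> \bar R} }.

Definition cmeas (mu : complex_measure) (A : set T) : R[i] :=
  (fine (re_part mu A) +i* fine (im_part mu A))%C.

Definition total_variation (mu : complex_measure) (A : set T) : \bar R :=
  ereal_sup [set (\sum_(0 <= k <oo) (complex.Re `|cmeas mu (F k)|)%:E)%E
            | F in [set F : (set T)^nat | [/\ forall k, measurable (F k),
                trivIset setT F & \bigcup_k F k = A]]].

Definition charge_integral (nu : {charge set T -> \bar R}) (g : T -> R) : R :=
  let hP := cid (Hahn_decomposition nu) in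
  let hN := cid (svalP hP) in
  Rintegral (jordan_pos (svalP hN)) setT g -
  Rintegral (jordan_neg (svalP hN)) setT g.

Definition cintegral (mu : complex_measure) (g : T -> R[i]) : R[i] :=
  let re x := complex.Re (g x) in
  let im x := complex.Im (g x) in
  ((charge_integral (re_part mu) re - charge_integral (im_part mu) im)
   +i* (charge_integral (im_part mu) re + charge_integral (re_part mu) im))%C.

End ComplexMeasure.

Section UnitBall.
Context (R : realType) (d : nat).
Local Notation Cd := 'rV[R[i]]_d.

Definition cdot (z w : Cd) : R[i] := \sum_(i < d) z 0 i * (w 0 i)^*.

Definition unit_ball : set Cd := [set z | cdot z z < 1].
Definition closed_unit_ball : set Cd := [set z | cdot z z <= 1].
Definition unit_sphere : set Cd := [set z | cdot z z = 1].

Definition poly_fun (p : mpoly.mpoly d R[i]) (z : Cd) : R[i] :=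
  mpoly.meval (fun i => z 0 i) p.

Definition Borel : Type := g_sigma_algebraType (@open Cd).

(* Complex regular Borel measures on the sphere, viewed as measures on C^d
   that are carried by the sphere. *)
Definition regular_on_sphere (mu : complex_measure R Borel) : Prop :=
  [/\ total_variation mu (~` unit_sphere) = 0%E,
    forall A : set Borel, measurable A -> total_variation mu A =
      ereal_inf [set total_variation mu U
                | U in [set U : set Cd | open U /\ A `<=` U]]
    & forall A : set Borel, measurable A -> total_variation mu A =
      ereal_sup [set total_variation mu K
                | K in [set K : set Cd | compact K /\ K `<=` A]]].

Variable H : rkhs R unit_ball.

Definition regular_unitarily_invariant : Prop :=
  exists a : nat -> R,
    [/\ a 0%N = 1, forall n, 0 < a n, a n / a n.+1 @[n --> \oo] --> (1 : R)
      & forall z w : unit_ball,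
          series (fun n => (a n)%:C%C * cdot (val z) (val w) ^+ n) @ \oo
            --> rkhs_kernel H z w].

Definition is_poly (p : mpoly.mpoly d R[i]) (phi : Mult H) : Prop :=
  forall z : unit_ball, val phi z = poly_fun p (val z).

Definition henkin (mu : complex_measure R Borel) : Prop :=
  regular_on_sphere mu /\
  exists L : {scalar Mult H}, continuous (L : weakstar H -> R[i]) /\
    forall p phi, is_poly p phi -> L phi = cintegral mu (poly_fun p).

Definition totally_null (E : set Cd) : Prop :=
  [/\ measurable (E : set Borel), E `<=` unit_sphere
    & forall mu, henkin mu -> total_variation mu E = 0%E].

(* A(H): the norm closure of the polynomials in Mult(H). *)
Definition A_algebra : set (Mult H) :=
  [set phi | forall e : R, 0 < e -> exists p psi,
     is_poly p psi /\ (mult_norm (phi - psi)%R < e%:E)%E].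

Definition continuous_extension (phi : Mult H) (F : Cd -> R[i]) : Prop :=
  {within closed_unit_ball, continuous F} /\
  forall z : unit_ball, F (val z) = val phi z.

(* Surjectivity of A(H) -> C(E); f|_E refers to the continuous extension of f
   to the closed ball, which is unique by density. *)
Definition restriction_surjective (E : set Cd) : Prop :=
  forall g : Cd -> R[i], {within E, continuous g} ->
  exists phi F, [/\ A_algebra phi, continuous_extension phi F
    & forall z, E z -> F z = g z].

End UnitBall.

Arguments unit_ball : clear implicits.
Arguments unit_sphere : clear implicits.

(* Main.v *)
Require Import Defs.
From HB Require Import structures.
From mathcomp Require Import all_boot all_order all_algebra.
From mathcomp Require Import complex.
From mathcomp Require Import all_classical all_reals all_analysis.
From mathcomp Require Import measurable_realfun ring lra.
From mathcomp Require finmap summability mpoly polyrcf.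
Import (canonicals, coercions) mpoly.
Import Order.TTheory GRing.Theory Num.Theory.
Import numFieldNormedType.Exports.
Import Normc.
Set Implicit Arguments.
Unset Strict Implicit.
Unset Printing Implicit Defensive.
Local Open Scope classical_set_scope.
Local Open Scope ring_scope.

(** Suppose that a Henkin measure mu does not vanish on E. Its real and imaginary
    parts have Jordan decompositions, so one of four positive measures, lambda, has
    lambda(E) > 0. A contradiction comes from a sequence of nonnegative functions
    h_j on E of mean at least 1 for lambda, which is asymptotically orthogonal in
    L2(lambda): averages of many of them would have a variance smaller than 0
    ([not_asymptotically_orthogonal]).

    Orthogonality is a property of Henkin measures. Let f_j be polynomials that are
    bounded in multiplier norm and tend to 0 at the points of the ball. Then f_j
    tends to 0 in the weak operator topology, and bounded sequences of this kind are
    null for every trace class functional: the trace is concentrated, up to a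
    uniformly small error, on finitely many basis vectors ([trace_null]). So
    int g f_j dmu tends to 0 for every polynomial g ([henkin_null]). In order to
    reach lambda, one also has to multiply by the indicator of E intersected with a
    Hahn set. On the sphere, multiplication by conj z_i sends null sequences to null
    sequences, asymptotically: for f null, the solution
    g(z) = int_0^1 (d_i f)(t z) dt of the Gleason problem is null, and g - conj z_i f
    tends to 0 uniformly on the sphere, by Cauchy's estimate along complex tangent
    directions ([gleason_sphere]). The functions with this property form an algebra
    with enough functions to approximate every indicator function in L1
    ([approximable_measurable]), and so
    lim_m limsup_n |int_A f_n f_m dmu| = 0 for every Borel set A
    ([henkin_null_pair]).

    It remains to find such f_j that are asymptotic on E to nonnegative functions of
    large mean. By hypothesis some point of the sphere is totally null. Unitary maps
    preserve the kernel, hence Henkin measures, and act transitively on the sphere;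
    so lambda has no atoms ([henkin_no_point_mass]). Then there are continuous u_n
    with values in [-1, 1] and with |u_n - u_m|^2 at least lambda(E) in L2(E, lambda)
    for n and m distinct, constructed by choosing signs on small pieces of E
    ([spread_sequence]). Since A(H) -> C(E) is onto, a Baire category argument
    approximates the u_n on E by polynomials p_n whose multiplier norms are bounded
    by one constant ([uniform_lifting]). By normality, two of the p_n are close on
    any given smaller ball ([poly_montel]), and the squares of such differences
    p_n - p_m, on larger and larger balls, are the f_j; on E they are asymptotic to
    the h_j = (u_n - u_m)^2 ([null_squares]). *)

(** * Complex numbers and inner products *)

Section Complex.
Context (R : realType).
Implicit Types (x y : R[i]) (a : R).

Lemma conj_conjc x : Num.conj x = conjc x. Proof. by []. Qed.
Lemma normc_norm x : `|x| = (normc x)%:C%C. Proof. by []. Qed.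
Lemma normc_ge0 x : 0 <= normc x.
Proof. by case: x => a b; exact: sqrtr_ge0. Qed.
Lemma normc_real a : normc a%:C%C = `|a|.
Proof. by rewrite /normc /= expr0n /= addr0 sqrtr_sqr. Qed.
Lemma normc_conj x : normc (Num.conj x) = normc x.
Proof. by case: x => a b; rewrite /normc /= sqrrN. Qed.
Lemma normc_Re x : `|complex.Re x| <= normc x.
Proof.
by case: x => a b /=; rewrite -sqrtr_sqr ler_sqrt ?addr_ge0 ?sqr_ge0// lerDl sqr_ge0.
Qed.
Lemma normc_Im x : `|complex.Im x| <= normc x.
Proof.
by case: x => a b /=; rewrite -sqrtr_sqr ler_sqrt ?addr_ge0 ?sqr_ge0// lerDr sqr_ge0.
Qed.
Lemma sqr_normc_ReIm x : normc x ^+ 2 = complex.Re x ^+ 2 + complex.Im x ^+ 2.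
Proof. by case: x => a b /=; rewrite sqr_sqrtr// addr_ge0 ?sqr_ge0. Qed.
Lemma normc_ReIm x : normc x <= `|complex.Re x| + `|complex.Im x|.
Proof.
rewrite -(ler_pXn2r (n:=2))// ?nnegrE ?normc_ge0 ?addr_ge0//.
rewrite sqr_normc_ReIm sqrrD !real_normK ?num_real//.
by rewrite -addrA lerD2l lerDr mulrn_wge0 ?mulr_ge0.
Qed.
Lemma normc_sub x y : normc (x - y) = normc (y - x).
Proof. by rewrite -normcN opprB. Qed.
Lemma mul_conjc x : x * Num.conj x = (normc x ^+ 2)%:C%C.
Proof. by rewrite -normCK normc_norm -rmorphXn. Qed.
Lemma ReD x y : complex.Re (x + y) = complex.Re x + complex.Re y.
Proof. by case: x y => ? ? []. Qed.
Lemma ImD x y : complex.Im (x + y) = complex.Im x + complex.Im y.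
Proof. by case: x y => ? ? []. Qed.
Lemma ReN x : complex.Re (- x) = - complex.Re x. Proof. by case: x. Qed.
Lemma ImN x : complex.Im (- x) = - complex.Im x. Proof. by case: x. Qed.
Lemma Re_cnj x : complex.Re (Num.conj x) = complex.Re x. Proof. by case: x. Qed.
Lemma Im_cnj x : complex.Im (Num.conj x) = - complex.Im x. Proof. by case: x. Qed.
Lemma ReZ a x : complex.Re (a%:C%C * x) = a * complex.Re x.
Proof. by case: x => ? ?; rewrite /= mul0r subr0. Qed.
Lemma Re_sum (I : Type) (r : seq I) (P : pred I) (F : I -> R[i]) :
  complex.Re (\sum_(i <- r | P i) F i) = \sum_(i <- r | P i) complex.Re (F i).
Proof. by apply: (big_morph _ ReD). Qed.
Lemma normc_sum (I : Type) (r : seq I) (P : pred I) (F : I -> R[i]) :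
  normc (\sum_(i <- r | P i) F i) <= \sum_(i <- r | P i) normc (F i).
Proof.
elim/big_rec2 : _ => [|i u v _ h]; first by rewrite normc0.
by apply: (le_trans (le_normcD _ _)); rewrite lerD2l.
Qed.
Lemma normcX x n : normc (x ^+ n) = normc x ^+ n.
Proof. by elim: n => [|n IH]; rewrite ?expr0 ?normc1// !exprS normcM IH. Qed.

(** Real moduli are easier to estimate than the norm of the complex field, which takes
    its values in that field. *)
Lemma cvgc_normc T (F : set_system T) (FF : Filter F) (f : T -> R[i]) (l : R[i]) :
  f x @[x --> F] --> l <-> normc (f x - l) @[x --> F] --> (0 : R).
Proof.
split.
- move=> /cvgrPdist_lt h; apply/cvgrPdist_lt => e e0.
  have := h (e%:C%C); rewrite ltcR => /(_ e0); apply: filterS => x.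
  by rewrite normc_norm ltcR sub0r normrN ger0_norm ?normc_ge0// normc_sub.
- move=> /cvgrPdist_lt h; apply/cvgrPdist_lt => e e0.
  have er : e = (complex.Re e)%:C%C by rewrite RRe_real// gtr0_real.
  have := h (complex.Re e); move: (e0); rewrite er ltcR => e1 /(_ e1).
  apply: filterS => x.
  by rewrite normc_norm ltcR sub0r normrN ger0_norm ?normc_ge0// normc_sub.
Qed.

End Complex.

Section HilbertBasics.
Context (R : realType) (V : lmodType R[i]) (ip : {dot V for Num.conj}).
Implicit Types (u v w : V) (a : R[i]).
Local Notation N := (inorm ip).

Lemma ipDl u v w : ip (u + v) w = ip u w + ip v w.
Proof. exact: linearDl. Qed.
Lemma ipDr u v w : ip u (v + w) = ip u v + ip u w.
Proof. exact: linearDr. Qed.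
Lemma ipZl a u v : ip (a *: u) v = a * ip u v.
Proof. exact: linearZl_LR. Qed.
Lemma ipZr a u v : ip u (a *: v) = Num.conj a * ip u v.
Proof. exact: linearZr_LR. Qed.
Lemma ipNl u v : ip (- u) v = - ip u v.
Proof. exact: linearNl. Qed.
Lemma ipNr u v : ip u (- v) = - ip u v.
Proof. exact: linearNr. Qed.
Lemma ipBl u v w : ip (u - v) w = ip u w - ip v w.
Proof. by rewrite ipDl ipNl. Qed.
Lemma ipBr u v w : ip u (v - w) = ip u v - ip u w.
Proof. by rewrite ipDr ipNr. Qed.
Lemma ip0l u : ip 0 u = 0. Proof. by have := ipZl 0 u u; rewrite scale0r mul0r. Qed.
Lemma ip0r u : ip u 0 = 0.
Proof. by have := ipZr 0 u u; rewrite scale0r conjC0 mul0r. Qed.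
Lemma ipC u v : ip u v = Num.conj (ip v u).
Proof. by rewrite (hermC ip) /= expr0 mul1r. Qed.
Lemma ip_suml (I : Type) (r : seq I) (P : pred I) (F : I -> V) v :
  ip (\sum_(i <- r | P i) F i) v = \sum_(i <- r | P i) ip (F i) v.
Proof. by apply: (big_morph (fun u => ip u v)) => [x y|]; rewrite ?ipDl ?ip0l. Qed.
Lemma ip_sumr (I : Type) (r : seq I) (P : pred I) (F : I -> V) v :
  ip v (\sum_(i <- r | P i) F i) = \sum_(i <- r | P i) ip v (F i).
Proof. by apply: (big_morph (fun u => ip v u)) => [x y|]; rewrite ?ipDr ?ip0r. Qed.

Lemma inorm_ge0 u : 0 <= N u. Proof. exact: sqrtr_ge0. Qed.
Lemma ipuu u : ip u u = (N u ^+ 2)%:C%C.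
Proof.
have h := dnorm_ge0 ip u; rewrite sqr_sqrtr.
  by rewrite RRe_real// ger0_real.
by move: h; rewrite lecE => /andP[_].
Qed.
Lemma inorm_sqr u : N u ^+ 2 = complex.Re (ip u u).
Proof. by rewrite ipuu. Qed.
Lemma inorm0 : N 0 = 0. Proof. by rewrite /inorm ip0l sqrtr0. Qed.
Lemma inorm_eq0 u : N u = 0 -> u = 0.
Proof.
by move=> h; have := ipuu u; rewrite h expr0n /= => /eqP; rewrite dnorm_eq0 => /eqP.
Qed.
Lemma inormZ a u : N (a *: u) = normc a * N u.
Proof.
apply/eqP; rewrite -(eqrXn2 (n := 2)) ?mulr_ge0 ?inorm_ge0 ?normc_ge0//.
rewrite exprMn inorm_sqr ipZl ipZr mulrA mul_conjc ipuu -rmorphM /=.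
by [].
Qed.
Lemma inormN u : N (- u) = N u.
Proof. by rewrite /inorm ipNl ipNr opprK. Qed.
Lemma inormB u v : N (u - v) = N (v - u).
Proof. by rewrite -inormN opprB. Qed.

Lemma inormD_sqr u v : N (u + v) ^+ 2 = N u ^+ 2 + N v ^+ 2 + 2 * complex.Re (ip u v).
Proof.
rewrite !inorm_sqr ipDl !ipDr !ReD (ipC v u) Re_cnj; ring.
Qed.

Lemma cauchy_schwarz u v : normc (ip u v) <= N u * N v.
Proof.
have [/eqP v0|v0] := eqVneq (N v) 0.
  by rewrite (inorm_eq0 (eqP v0)) ip0r normc0 mulr_ge0 ?inorm_ge0.
have vp : 0 < N v by rewrite lt_neqAle eq_sym v0 inorm_ge0.
rewrite -(ler_pXn2r (n:=2))// ?nnegrE ?mulr_ge0 ?inorm_ge0 ?normc_ge0//.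
set c := ip u v.
have := sqr_ge0 (N (((N v ^+ 2)%:C%C) *: u + (- c) *: v)).
rewrite inormD_sqr !inormZ ipZl ipZr normc_real normcN rmorphN /=.
rewrite mulNr ReZ ReN -/c mulrC.
have -> : Num.conj c * c = (normc c ^+ 2)%:C%C by rewrite mulrC mul_conjc.
rewrite /= ger0_norm ?sqr_ge0//.
move: (inorm_ge0 u) (normc_ge0 c); move: (N u) (normc c) => a b a0 b0.
have : 0 < N v ^+ 2 by rewrite exprn_gt0.
rewrite exprMn; move: (N v) vp => n np; nra.
Qed.

Lemma inormD u v : N (u + v) <= N u + N v.
Proof.
rewrite -(ler_pXn2r (n:=2))// ?nnegrE ?addr_ge0 ?inorm_ge0//.
rewrite inormD_sqr.
have := le_trans (ler_norm _) (le_trans (normc_Re _) (cauchy_schwarz u v)).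
rewrite sqrrD; lra.
Qed.

Lemma parallelogram u v :
  N (u + v) ^+ 2 + N (u - v) ^+ 2 = 2 * N u ^+ 2 + 2 * N v ^+ 2.
Proof. rewrite !inormD_sqr inormN ipNr ReN; ring. Qed.

End HilbertBasics.

Lemma invS_gt0 (R : realType) n : 0 < (n.+1%:R : R)^-1.
Proof. by rewrite invr_gt0 ltr0n. Qed.
Lemma invS_lt (R : realType) (e : R) : 0 < e -> exists K, forall n, (K <= n)%N -> n.+1%:R^-1 < e.
Proof. by move=> e0; have [K _ hK] := near_infty_natSinv_lt (PosNum e0); exists K. Qed.

Section Conj.
Context (R : realType).
Implicit Types (x y : R[i]).
Lemma cnjM x y : Num.conj (x * y) = Num.conj x * Num.conj y.
Proof. exact: (rmorphM (Num.conj : R[i] -> R[i])). Qed.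
Lemma cnjD x y : Num.conj (x + y) = Num.conj x + Num.conj y.
Proof. exact: (rmorphD (Num.conj : R[i] -> R[i])). Qed.
Lemma cnjK x : Num.conj (Num.conj x) = x.
Proof. exact: conjCK. Qed.
Lemma cnjN x : Num.conj (- x) = - Num.conj x.
Proof. exact: (rmorphN (Num.conj : R[i] -> R[i])). Qed.
Lemma cnjR (a : R) : Num.conj (a%:C%C : R[i]) = a%:C%C.
Proof. exact: conjc_real. Qed.
Lemma cnj_sum (I : Type) (r : seq I) (P : pred I) (F : I -> R[i]) :
  Num.conj (\sum_(i <- r | P i) F i) = \sum_(i <- r | P i) Num.conj (F i).
Proof. exact: (rmorph_sum (Num.conj : R[i] -> R[i])). Qed.
End Conj.
Lemma Re_rc (R : realType) (a : R) : complex.Re a%:C%C = a. Proof. by []. Qed.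

(** * Riesz representation and reproducing kernels *)

Section Riesz.
Context (R : realType) (V : lmodType R[i]) (ip : {dot V for Num.conj}).
Hypothesis complete : cauchy_complete ip.
Context (P : Type) (p0 : P) (lin : R[i] -> P -> P -> P).
Context (kap : P -> V) (ell : P -> R[i]) (M : R).
Hypothesis M0 : 0 <= M.
Hypothesis kapP : forall a s t, kap (lin a s t) = a *: kap s + kap t.
Hypothesis ellP : forall a s t, ell (lin a s t) = a * ell s + ell t.
Hypothesis bnd : forall s, normc (ell s) <= M * inorm ip (kap s).
Local Notation N := (inorm ip).
Let J s := N (kap s) ^+ 2 - 2 * complex.Re (ell s).

Let J_lb s : - M ^+ 2 <= J s.
Proof.
have h := le_trans (ler_norm _) (le_trans (normc_Re _) (bnd s)).
have := sqr_ge0 (N (kap s) - M); rewrite sqrrB /J; lra.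
Qed.

Let S := [set J s | s in setT].
Let m := inf S.

Let S_inf : has_inf S.
Proof.
split; first by exists (J p0), p0.
by exists (- M ^+ 2) => _ [s _ <-]; exact: J_lb.
Qed.

Let J_ge s : m <= J s.
Proof. by apply: ge_inf; [exact: S_inf.2|exists s]. Qed.

Let J_close e : 0 < e -> exists s, J s < m + e.
Proof. by move=> e0; have [_ [s _ <-] h] := inf_adherent e0 S_inf; exists s. Qed.

Let mid s t : exists r, kap r = 2^-1 *: (kap s + kap t) /\
   ell r = 2^-1 * (ell s + ell t).
Proof.
exists (lin (2^-1) s (lin (2^-1) t (lin (-1) s s))); rewrite !kapP !ellP.
rewrite scaleN1r addNr addr0 mulN1r addNr addr0; split; last by rewrite mulrDr.
by rewrite scalerDr.
Qed.

Let J_cauchy s t : N (kap s - kap t) ^+ 2 <= 2 * J s + 2 * J t - 4 * m.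
Proof.
have [r [kr er]] := mid s t.
have hr := J_ge r; move: hr; rewrite /J kr er inormZ.
have -> : (2^-1 : R[i]) = (2^-1 : R)%:C%C by rewrite fmorphV rmorphMn.
rewrite ReZ normc_real ger0_norm ?invr_ge0// exprMn ReD.
have := parallelogram ip (kap s) (kap t).
move: (N _ ^+ 2) (N _ ^+ 2) (N _ ^+ 2) (N _ ^+ 2) (complex.Re _) (complex.Re _).
move=> a b c d e f h; have -> : (2^-1 : R) ^+ 2 = 4^-1 by field.
lra.
Qed.

(** Riesz representation on a possibly non closed subspace, the range of [kap]:
    minimising |k|^2 - 2 Re l(k) over the subspace produces a Cauchy sequence, by
    the parallelogram law, and its limit represents l. *)
Lemma riesz_param : exists g : V, [/\ forall s, ip (kap s) g = ell s,
  N g <= M & forall e, 0 < e -> exists s, N (kap s - g) < e].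
Proof.
have [s hs] := choice (fun n : nat => J_close (invS_gt0 R n)).
have [g hg] : exists l : V, inorm ip (kap (s n) - l) @[n --> \oo] --> (0 : R).
  apply: complete => e e0.
  have e2 : 0 < e ^+ 2 / 4 by rewrite divr_gt0// exprn_gt0.
  have [K hK] := invS_lt e2.
  exists K => p q Kp Kq.
  rewrite -(ltr_pXn2r (n:=2))// ?nnegrE ?inorm_ge0 ?(ltW e0)//.
  apply: (le_lt_trans (J_cauchy _ _)).
  have := hs p; have := hs q; have := hK p Kp; have := hK q Kq; rewrite /=.
  move: (q.+1%:R^-1) (p.+1%:R^-1) (J _) (J _) (e ^+ 2) (m : R) => x y Jx Jy E m'.
  lra.
have close e : 0 < e -> exists n, N (kap (s n) - g) < e /\ n.+1%:R^-1 < e.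
  move=> e0; have /cvgrPdist_lt /(_ e e0) [K1 _ h1] := hg.
  have [K2 h2] := invS_lt e0.
  exists (maxn K1 K2); split; last by apply: h2; rewrite /= leq_maxr.
  by have := h1 (maxn K1 K2) (leq_maxl _ _); rewrite sub0r normrN ger0_norm ?inorm_ge0.
have rep t : ip (kap t) g = ell t.
  set T := N (kap t); set dl := ip (kap t) g - ell t.
  (* first variation of J along kap t at the minimising sequence *)
  have key a : 0 <= normc a ^+ 2 * T ^+ 2 + 2 * complex.Re (a * dl).
    apply/ler_addgt0Pr => e e0.
    set B := 1 + 2 * normc a * T.
    have B0 : 0 < B by rewrite ltr_pwDl// mulr_ge0 ?mulr_ge0 ?normc_ge0 ?inorm_ge0.
    have [n [hn1 hn2]] := close (e / B) (divr_gt0 e0 B0).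
    have := J_ge (lin a t (s n)); have := hs n.
    rewrite /J kapP ellP inormD_sqr inormZ -/T ReD ipZl exprMn.
    set u := kap (s n) in hn1 *; move=> h1 h2.
    have h3 : complex.Re (a * (ip (kap t) u - ip (kap t) g)) <= normc a * T * (e / B).
      apply: le_trans (ler_norm _) _; apply: le_trans (normc_Re _) _.
      rewrite normcM -ipBr -mulrA ler_wpM2l ?normc_ge0//.
      by apply: le_trans (cauchy_schwarz _ _ _) _; rewrite ler_wpM2l ?inorm_ge0// ltW.
    have h4 : e = e / B + 2 * (normc a * T * (e / B)).
      have -> : e / B + 2 * (normc a * T * (e / B)) = B * (e / B) by rewrite /B; ring.
      by rewrite mulrC divfK// gt_eqF.
    move: h1 h2 h3 h4 hn2; rewrite /dl !mulrBr !ReD !ReN.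
    move: (m : R) (n.+1%:R^-1) (e / B) (normc a * T) => m' y E w; lra.
  suff d0 : normc dl = 0 by apply/eqP; rewrite -subr_eq0 -/dl (eq0_normc d0).
  apply/eqP; apply: contraT => d0.
  have dp : 0 < normc dl ^+ 2 by rewrite exprn_gt0// lt_neqAle eq_sym d0 normc_ge0.
  set x := (T ^+ 2 + 1)^-1.
  have Tp : 0 < T ^+ 2 + 1 by rewrite ltr_wpDl ?sqr_ge0.
  have xp : 0 < x by rewrite invr_gt0.
  have := key (- (x%:C%C * Num.conj dl)).
  have -> : - (x%:C%C * Num.conj dl) * dl = - (x%:C%C * (dl * Num.conj dl)) by ring.
  rewrite normcN normcM normc_conj normc_real (ger0_norm (ltW xp)).
  rewrite mul_conjc ReN ReZ /=.
  have h : x * T ^+ 2 <= 1.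
    by rewrite mulrC ler_pdivrMr// mul1r lerDl.
  have : x * normc dl ^+ 2 * (x * T ^+ 2) <= x * normc dl ^+ 2.
    by rewrite ger_pMr// mulr_gt0.
  have : 0 < x * normc dl ^+ 2 by rewrite mulr_gt0.
  rewrite exprMn.
  have -> : x ^+ 2 * normc dl ^+ 2 * T ^+ 2 = x * normc dl ^+ 2 * (x * T ^+ 2) by ring.
  move: (x * _) (_ * _) => u v; lra.
have app e : 0 < e -> exists s, N (kap s - g) < e.
  by move=> /close[n [hn _]]; exists (s n).
exists g; split => //.
have [//|Mg] := leP (N g) M.
have Np : 0 < N g by apply: le_lt_trans Mg.
have := app ((N g - M) * N g / (2 * (N g + M))).
case; first by rewrite divr_gt0 ?mulr_gt0 ?subr_gt0// ltr_pwDl.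
move=> r; set e := _ / _ => hr.
have he : e * (2 * (N g + M)) = (N g - M) * N g.
  by rewrite divfK// mulf_neq0 ?gt_eqF// ltr_pwDl.
have := inorm_sqr ip g.
have -> : ip g g = ip (g - kap r) g + ip (kap r) g by rewrite -ipDl subrK.
have h1 := le_trans (ler_norm _) (le_trans (normc_Re _) (cauchy_schwarz ip (g - kap r) g)).
have h2 := le_trans (ler_norm _) (le_trans (normc_Re _) (bnd r)).
have h3 : N (kap r) <= N g + e.
  rewrite -(subrK g (kap r)) addrC.
  by apply: le_trans (inormD _ _ _) _; rewrite lerD2l ltW.
rewrite ReD rep; rewrite inormB in h1.
have h4 : N (kap r - g) * N g <= e * N g by rewrite ler_wpM2r ?ltW.
have h5 : M * N (kap r) <= M * (N g + e) by rewrite ler_wpM2l.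
move: he h1 h2 h4 h5 Mg Np; rewrite -/e.
move: (N (kap r - g) * N g) (M * N (kap r)) (N g) (e : R) => c d x e'.
move: (complex.Re _) (complex.Re _) => a b he h1 h2 h4 h5 Mg Np h6.
have : 0 < (x - M) * x by rewrite mulr_gt0// subr_gt0.
move: (M : R) he h2 h5 => M' he h2 h5; lra.
Qed.
End Riesz.

Section Combinations.
Context (R : realType) (V : lmodType R[i]) (I : Type) (v : I -> V).

(** Lists of weighted indices parametrise the span of a family, in the way that
    [riesz_param] asks for. *)
Definition comb (s : seq (R[i] * I)) : V := \sum_(p <- s) p.1 *: v p.2.
Definition comb_lin a (s t : seq (R[i] * I)) := [seq (a * p.1, p.2) | p <- s] ++ t.

Lemma combP a s t : comb (comb_lin a s t) = a *: comb s + comb t.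
Proof.
rewrite /comb big_cat big_map scaler_sumr; congr (_ + _).
by apply: eq_bigr => p _; rewrite scalerA.
Qed.

Lemma comb1 i : comb [:: (1, i)] = v i.
Proof. by rewrite /comb big_seq1 scale1r. Qed.

(** The representative of <., x> on the span is a limit of elements of the span, and
    it differs from x by a vector orthogonal to the whole family. *)
Lemma comb_dense (ip : {dot V for Num.conj}) : cauchy_complete ip ->
  (forall g, (forall i, ip g (v i) = 0) -> g = 0) ->
  forall x e, 0 < e -> exists s, inorm ip (comb s - x) < e.
Proof.
move=> cpl v0 x e e0.
have [g [gP _ gc]] : exists g, [/\ forall s, ip (comb s) g = ip (comb s) x,
  inorm ip g <= inorm ip x & forall e, 0 < e -> exists s, inorm ip (comb s - g) < e].
  apply: (riesz_param cpl [::] (lin := comb_lin)) => //.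
  - exact: inorm_ge0.
  - exact: combP.
  - by move=> a s t; rewrite combP ipDl ipZl.
  - by move=> s; rewrite mulrC; exact: cauchy_schwarz.
suff <- : g = x by exact: gc.
apply/eqP; rewrite -subr_eq0; apply/eqP/v0 => i.
by rewrite ipC ipBr -(comb1 i) gP subrr conjC0.
Qed.

End Combinations.

Section Kernel.
Context (R : realType) (X : Type) (H : rkhs R X).
Local Notation ip := (rkhs_dot H).
Local Notation N := (inorm ip).

Definition kvec w : rkhs_space H := projT1 (cid (rkhs_reproducing H w)).

Lemma kvecE w : rkhs_fun H (kvec w) = (fun z => rkhs_kernel H z w).
Proof. by rewrite /kvec; case: cid => k []. Qed.

Lemma reproducing f w : rkhs_fun H f w = ip f (kvec w).
Proof. by rewrite /kvec; case: cid => k []. Qed.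

Lemma kvec_ip z w : ip (kvec z) (kvec w) = rkhs_kernel H w z.
Proof. by rewrite -reproducing kvecE. Qed.

Lemma kvec_total g : (forall w, ip g (kvec w) = 0) -> g = 0.
Proof.
move=> h; apply: (@rkhs_fun_inj _ _ H); rewrite linear0.
by apply/funext => w; rewrite reproducing h.
Qed.

(** Only the real part of the quadratic form is tested, which is all that norm
    comparisons use. *)
Definition psd (F : X -> X -> R[i]) := forall s : seq (R[i] * X),
  0 <= complex.Re (\sum_(p <- s) \sum_(q <- s) p.1 * Num.conj q.1 * F q.2 p.2).

Lemma comb_norm (m : X -> R[i]) (T : X -> X) s :
  N (comb (fun w => Num.conj (m w) *: kvec (T w)) s) ^+ 2 =
  complex.Re (\sum_(p <- s) \sum_(q <- s) p.1 * Num.conj q.1 *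
    (m q.2 * Num.conj (m p.2) * rkhs_kernel H (T q.2) (T p.2))).
Proof.
rewrite inorm_sqr /comb ip_suml; congr complex.Re; apply: eq_bigr => p _.
rewrite ip_sumr; apply: eq_bigr => q _.
rewrite !(ipZl, ipZr) kvec_ip conjCK; ring.
Qed.

(** The operator f |-> m (f o T) has the formal adjoint k_w |-> conj (m w) k_(T w); the
    hypothesis bounds the latter on the span of the kernel vectors. *)
Lemma weighted_composition (m : X -> R[i]) (T : X -> X) c : 0 <= c ->
  psd (fun z w => (c ^+ 2)%:C%C * rkhs_kernel H z w
     - m z * Num.conj (m w) * rkhs_kernel H (T z) (T w)) ->
  forall f, exists g, rkhs_fun H g = (fun x => m x * rkhs_fun H f (T x)) /\
    N g <= c * N f.
Proof.
move=> c0 hpsd f.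
have bd s : N (comb (fun w => Num.conj (m w) *: kvec (T w)) s) <= c * N (comb kvec s).
  rewrite -(ler_pXn2r (n:=2))// ?nnegrE ?mulr_ge0 ?inorm_ge0//.
  rewrite exprMn comb_norm.
  have -> : comb kvec s = comb (fun w => Num.conj 1 *: kvec (id w)) s.
    by congr (comb _ s); apply/funext => w; rewrite conjC1 scale1r.
  rewrite (comb_norm (fun=> 1) id) -subr_ge0 -ReZ -ReN -ReD.
  have := hpsd s; rewrite mulr_sumr -sumrN -big_split /=.
  congr (_ <= complex.Re _); apply: eq_bigr => p _.
  rewrite mulr_sumr -sumrN -big_split /=; apply: eq_bigr => q _.
  rewrite conjC1; ring.
have [g [gP gN _]] : exists g : rkhs_space H, [/\ forall s, ip (comb kvec s) g =
    ip (comb (fun w => Num.conj (m w) *: kvec (T w)) s) f,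
    N g <= c * N f & forall e, 0 < e -> exists s, N (comb kvec s - g) < e].
  apply: (riesz_param (@rkhs_complete _ _ H) [::] (lin := @comb_lin R X)) => //.
  - by rewrite mulr_ge0 ?inorm_ge0.
  - exact: combP.
  - by move=> a s t; rewrite combP ipDl ipZl.
  - move=> s; apply: le_trans (cauchy_schwarz _ _ _) _.
    by rewrite mulrAC ler_wpM2r ?inorm_ge0.
exists g; split=> //; apply/funext => w.
rewrite reproducing ipC -(comb1 kvec w) gP comb1 ipZl cnjM cnjK.
by rewrite reproducing [in RHS]ipC.
Qed.

End Kernel.

(** * Polynomials as multipliers *)

Section ComplexLimits.
Context (R : realType).

Lemma cvgRe T (F : set_system T) (FF : Filter F) (f : T -> R[i]) (l : R[i]) :
  f x @[x --> F] --> l -> complex.Re (f x) @[x --> F] --> complex.Re l.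
Proof.
move=> /cvgc_normc /cvgrPdist_lt h; apply/cvgrPdist_lt => e /h; apply: filterS => x.
rewrite sub0r normrN ger0_norm ?normc_ge0// normc_sub => /(le_lt_trans _); apply.
by rewrite -ReN -ReD normc_Re.
Qed.

Lemma cvgIm T (F : set_system T) (FF : Filter F) (f : T -> R[i]) (l : R[i]) :
  f x @[x --> F] --> l -> complex.Im (f x) @[x --> F] --> complex.Im l.
Proof.
move=> /cvgc_normc /cvgrPdist_lt h; apply/cvgrPdist_lt => e /h; apply: filterS => x.
rewrite sub0r normrN ger0_norm ?normc_ge0// normc_sub => /(le_lt_trans _); apply.
by rewrite -ImN -ImD normc_Im.
Qed.

Lemma cvg_finite_sum (K : numFieldType) (W : normedModType K) T (F : set_system T)
    (FF : Filter F) (I : Type) (r : seq I) (f : I -> T -> W) (l : I -> W) :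
  (forall i, f i x @[x --> F] --> l i) ->
  \sum_(i <- r) f i x @[x --> F] --> \sum_(i <- r) l i.
Proof.
move=> h; elim: r => [|i r IH].
  by rewrite big_nil; under eq_fun do rewrite big_nil; exact: cvg_cst.
by rewrite big_cons; under eq_fun do rewrite big_cons; exact: cvgD.
Qed.

Lemma cvg_ge0 T (F : set_system T) (FF : ProperFilter F) (f : T -> R) (l : R) :
  (forall x, 0 <= f x) -> f x @[x --> F] --> l -> 0 <= l.
Proof.
move=> f0 fl; rewrite -(cvg_lim _ fl)//; apply: limr_ge.
  by apply/cvg_ex; exists l.
by apply: nearW => x; exact: f0.
Qed.

End ComplexLimits.

Section Psd.
Context (R : realType) (X : Type).
Implicit Types F G : X -> X -> R[i].

Lemma psdD F G : psd F -> psd G -> psd (fun z w => F z w + G z w).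
Proof.
move=> hF hG s; have := addr_ge0 (hF s) (hG s); rewrite -ReD -big_split /=.
congr (_ <= complex.Re _); apply: eq_bigr => p _.
by rewrite -big_split /=; apply: eq_bigr => q _; rewrite mulrDr.
Qed.

Lemma psdZ (c : R) F : 0 <= c -> psd F -> psd (fun z w => c%:C%C * F z w).
Proof.
move=> c0 hF s; have := mulr_ge0 c0 (hF s); rewrite -ReZ mulr_sumr.
congr (_ <= complex.Re _); apply: eq_bigr => p _.
by rewrite mulr_sumr; apply: eq_bigr => q _; rewrite mulrCA.
Qed.

(** Conjugating a positive form by a diagonal operator keeps it positive. *)
Lemma psd_mul (m : X -> R[i]) F : psd F -> psd (fun z w => m z * Num.conj (m w) * F z w).
Proof.
move=> hF s; have := hF [seq (p.1 * Num.conj (m p.2), p.2) | p <- s].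
rewrite big_map; congr (_ <= complex.Re _); apply: eq_bigr => p _.
rewrite big_map; apply: eq_bigr => q _ /=.
by rewrite cnjM cnjK; ring.
Qed.

Lemma psd1 : psd (fun _ _ : X => 1 : R[i]).
Proof.
move=> s; have -> : \sum_(p <- s) \sum_(q <- s) p.1 * Num.conj q.1 * 1 =
   (\sum_(p <- s) p.1) * Num.conj (\sum_(p <- s) p.1).
  rewrite mulr_suml; apply: eq_bigr => p _.
  by rewrite cnj_sum mulr_sumr; apply: eq_bigr => q _; rewrite mulr1.
by rewrite mul_conjc sqr_ge0.
Qed.

Lemma psd_sum (I : Type) (r : seq I) (F : I -> X -> X -> R[i]) :
  (forall i, psd (F i)) -> psd (fun z w => \sum_(i <- r) F i z w).
Proof.
move=> h; elim: r => [|i r IH].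
  rewrite (_ : (fun _ => _) = (fun _ _ : X => 0%:C%C * 1)).
    by apply: psdZ => //; exact: psd1.
  by apply/funext => z; apply/funext => w; rewrite big_nil rmorph0 mul0r.
rewrite (_ : (fun _ => _) = (fun z w => F i z w + \sum_(i <- r) F i z w)).
  exact: psdD.
by apply/funext => z; apply/funext => w; rewrite big_cons.
Qed.

Lemma psd_lim (F : nat -> X -> X -> R[i]) G : (forall n, psd (F n)) ->
  (forall z w, F n z w @[n --> \oo] --> G z w) -> psd G.
Proof.
move=> hF hG s.
apply: (@cvg_ge0 _ _ \oo _ (fun n => complex.Re (\sum_(p <- s) \sum_(q <- s) p.1 * Num.conj q.1 * F n q.2 p.2))) => [n|].
  exact: hF.
apply: cvgRe; apply: cvg_finite_sum => p; apply: cvg_finite_sum => q.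
by apply: cvgM; [exact: cvg_cst|exact: hG].
Qed.

End Psd.

Section Ball.
Context (R : realType) (d : nat).
Local Notation Cd := 'rV[R[i]]_d.
Local Notation C := (R[i]).
Implicit Types (z w : Cd) (p q : mpoly.mpoly d C).

(** Polynomials are generated as a ring by constants and coordinates. *)
Lemma mpoly_gen_ind (P : mpoly.mpoly d C -> Prop) :
  (forall c, P (mpoly.mpolyC d c)) -> (forall i, P (mpoly.mpolyX C (mpoly.mnm1 i))) ->
  (forall p q, P p -> P q -> P (p + q)) -> (forall p q, P p -> P q -> P (p * q)) ->
  forall p, P p.
Proof.
move=> hC hX hD hM; elim/mpoly.mpolyind => [|c m p _ _ hp].
  by rewrite -(mpoly.mpolyC0 d C).
apply: hD => //; rewrite -mpoly.mul_mpolyC; apply: (hM) => //.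
rewrite mpoly.mpolyXE_id; apply: (big_ind P) => [||i _].
- by rewrite -(mpoly.mpolyC1 d C).
- exact: hM.
elim: (mpoly.fun_of_multinom m i) => [|k IH]; first by rewrite expr0 -(mpoly.mpolyC1 d C).
by rewrite exprS; exact: hM.
Qed.

Lemma poly_funC c z : poly_fun (mpoly.mpolyC d c) z = c.
Proof. exact: mpoly.mevalC. Qed.
Lemma poly_funX i z : poly_fun (mpoly.mpolyX C (mpoly.mnm1 i)) z = z 0 i.
Proof. exact: mpoly.mevalXU. Qed.
Lemma poly_funD p q z : poly_fun (p + q) z = poly_fun p z + poly_fun q z.
Proof. exact: mpoly.mevalD. Qed.
Lemma poly_funM p q z : poly_fun (p * q) z = poly_fun p z * poly_fun q z.
Proof. exact: mpoly.mevalM. Qed.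
Lemma poly_funZ c p z : poly_fun (c *: p) z = c * poly_fun p z.
Proof. exact: mpoly.mevalZ. Qed.
Lemma poly_funN p z : poly_fun (- p) z = - poly_fun p z.
Proof. by rewrite -scaleN1r poly_funZ mulN1r. Qed.
Lemma poly_funB p q z : poly_fun (p - q) z = poly_fun p z - poly_fun q z.
Proof. by rewrite poly_funD poly_funN. Qed.

End Ball.

Section PolyMultipliers.
Context (R : realType) (d : nat) (H : rkhs R (unit_ball R d)).
Local Notation Cd := 'rV[R[i]]_d.
Local Notation C := (R[i]).
Local Notation N := (inorm (rkhs_dot H)).
Implicit Types (p q : mpoly.mpoly d C) (c : R).

(** Multiplier norms only have to be bounded from above, so a bound [c] takes the
    place of the norm. *)
Definition pmult p c := 0 <= c /\ forall f : rkhs_space H, exists g,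
  rkhs_fun H g = (fun x : unit_ball R d => poly_fun p (val x) * rkhs_fun H f x) /\
  N g <= c * N f.

Lemma pmultC a : pmult (mpoly.mpolyC d a) (normc a).
Proof.
split; first exact: normc_ge0.
move=> f; exists (a *: f); rewrite inormZ; split=> //.
by rewrite linearZ; apply/funext => x; rewrite poly_funC.
Qed.

Lemma pmultD p q c c' : pmult p c -> pmult q c' -> pmult (p + q) (c + c').
Proof.
move=> [c0 hp] [c0' hq]; split; first exact: addr_ge0.
move=> f; have [g [g1 g2]] := hp f; have [h [h1 h2]] := hq f.
exists (g + h); split.
  by rewrite linearD g1 h1; apply/funext => x; rewrite poly_funD mulrDl.
by rewrite mulrDl; apply: le_trans (inormD _ _ _) _; exact: lerD.
Qed.

Lemma pmultM p q c c' : pmult p c -> pmult q c' -> pmult (p * q) (c * c').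
Proof.
move=> [c0 hp] [c0' hq]; split; first exact: mulr_ge0.
move=> f; have [g [g1 g2]] := hq f; have [h [h1 h2]] := hp g.
exists h; split.
  by rewrite h1 g1; apply/funext => x; rewrite poly_funM mulrA.
by apply: le_trans h2 _; rewrite -mulrA ler_wpM2l.
Qed.

Lemma pmultN p c : pmult p c -> pmult (- p) c.
Proof.
move=> [c0 hp]; split=> // f; have [g [g1 g2]] := hp f; exists (- g); rewrite inormN.
by split=> //; rewrite linearN g1; apply/funext => x; rewrite poly_funN mulNr.
Qed.

Lemma pmultB p q c c' : pmult p c -> pmult q c' -> pmult (p - q) (c + c').
Proof. by move=> hp hq; apply: pmultD => //; exact: pmultN. Qed.

Lemma pmult_mono p c c' : c <= c' -> pmult p c -> pmult p c'.
Proof.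
move=> cc [c0 hp]; split; first exact: le_trans cc.
move=> f; have [g [g1 g2]] := hp f; exists g; split=> //.
by apply: le_trans g2 _; rewrite ler_wpM2r ?inorm_ge0.
Qed.

Lemma pmultZ p c a : pmult p c -> pmult (a *: p) (normc a * c).
Proof. by move=> hp; rewrite -mpoly.mul_mpolyC; apply: pmultM => //; exact: pmultC. Qed.

Hypothesis regH : regular_unitarily_invariant H.

(** All that the ratio condition has to give is the bound of [a n] by a multiple of
    [a n.+1]. *)
Lemma kernel_series : exists a : nat -> R, [/\ a 0%N = 1, forall n, 0 < a n,
  (exists2 K, 0 <= K & forall n, a n <= K * a n.+1) &
  forall z w : unit_ball R d, \sum_(0 <= n < m) (a n)%:C%C * cdot (val z) (val w) ^+ n
    @[m --> \oo] --> rkhs_kernel H z w].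
Proof.
have [a [a0 ap ar ak]] := regH; exists a; split=> //.
have /cvgrPdist_lt /(_ 1 ltr01) [m _ hm] := ar.
exists (2 + \sum_(n < m) a n / a n.+1).
  by rewrite addr_ge0// sumr_ge0// => n _; rewrite divr_ge0// ltW.
move=> n; rewrite -ler_pdivrMr//; have [mn|nm] := leqP m n.
  have := hm n mn; rewrite distrC => /(le_lt_trans (ler_norm _)).
  have : 0 <= \sum_(n0 < m) a n0 / a n0.+1.
    by rewrite sumr_ge0// => k _; rewrite divr_ge0// ltW.
  by lra.
rewrite (bigD1 (Ordinal nm))//= addrCA lerDl addr_ge0//.
by rewrite sumr_ge0// => k _; rewrite divr_ge0// ltW.
Qed.

Lemma psd_cdot_pow n (F : unit_ball R d -> unit_ball R d -> C) : psd F ->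
  psd (fun z w : unit_ball R d => cdot (val z) (val w) ^+ n * F z w).
Proof.
elim: n F => [|n IH] F hF.
  rewrite (_ : (fun _ => _) = F)//.
  by apply/funext => z; apply/funext => w; rewrite expr0 mul1r.
rewrite (_ : (fun _ => _) = fun z w : unit_ball R d => cdot (val z) (val w) ^+ n *
    \sum_(i < d) (val z 0 i * Num.conj (val w 0 i) * F z w)); last first.
  by apply/funext => z; apply/funext => w; rewrite -mulr_suml exprSr mulrA.
by apply: IH; apply: psd_sum => i; exact: (psd_mul (fun z : unit_ball R d => val z 0 i)).
Qed.

Lemma psd_coord_le i (F : unit_ball R d -> unit_ball R d -> C) : psd F ->
  psd (fun z w : unit_ball R d => (cdot (val z) (val w) - val z 0 i * Num.conj (val w 0 i)) * F z w).
Proof.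
move=> hF.
rewrite (_ : (fun _ => _) = fun z w : unit_ball R d => \sum_(j <- [seq j <- enum 'I_d | j != i])
    (val z 0 j * Num.conj (val w 0 j) * F z w)).
  by apply: psd_sum => j; exact: (psd_mul (fun z : unit_ball R d => val z 0 j)).
apply/funext => z; apply/funext => w; rewrite -mulr_suml big_filter big_enum_cond.
congr (_ * _); rewrite {1}/cdot (bigD1 (P := predT) i)// addrAC subrr add0r.
by apply: eq_bigl.
Qed.

(** With a n <= K a (n+1), the kernel K k(z, w) - z_i w_i^* k(z, w) is a
    combination with nonnegative coefficients of powers of <z, w> and of products of
    these with <z, w> - z_i w_i^*, which are all positive. *)
Lemma pmultX i : exists c, pmult (mpoly.mpolyX C (mpoly.mnm1 i)) c.
Proof.
have [a [a0 ap [K K0 aK] ak]] := kernel_series.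
exists (Num.sqrt K); split; first exact: sqrtr_ge0.
have h := @weighted_composition _ _ H (fun z => val z 0 i) id (Num.sqrt K) (sqrtr_ge0 _).
move=> f; have [|g [g1 g2]] := h _ f; last first.
  by exists g; split=> //; rewrite g1; apply/funext => x; rewrite poly_funX.
rewrite sqr_sqrtr//.
(* comparing S m.+1 with S m pairs z_i w_i^* with one more power of <z, w> *)
pose S m (z w : unit_ball R d) := \sum_(0 <= n < m) (a n)%:C%C * cdot (val z) (val w) ^+ n.
apply: (@psd_lim _ _ (fun m (z w : unit_ball R d) => K%:C%C * S m.+1 z w -
    val z 0 i * Num.conj (val w 0 i) * S m z w)); last first.
  move=> z w; apply: cvgB; apply: cvgM; try exact: cvg_cst; last exact: ak.
  by have := ak z w; rewrite -(cvg_shiftS (fun m => S m z w)).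
move=> m.
rewrite (_ : (fun _ => _) = fun z w : unit_ball R d => K%:C%C * 1 + \sum_(0 <= n < m)
   ((a n)%:C%C * (cdot (val z) (val w) ^+ n *
      ((cdot (val z) (val w) - val z 0 i * Num.conj (val w 0 i)) * 1))
   + (K * a n.+1 - a n)%:C%C * (cdot (val z) (val w) ^+ n.+1 * 1))); last first.
  apply/funext => z; apply/funext => w.
  rewrite /S big_nat_recl// a0 expr0 !mulr1 mulrDr mulr1 !mulr_sumr -addrA -sumrB.
  congr (_ + _); apply: eq_bigr => n _.
  rewrite rmorphB rmorphM exprS /=; ring.
apply: psdD; first by apply: psdZ => //; exact: psd1.
apply: psd_sum => n; apply: psdD; apply: psdZ.
- exact: ltW.
- by apply: psd_cdot_pow; apply: psd_coord_le; exact: psd1.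
- by rewrite subr_ge0.
- by apply: psd_cdot_pow; exact: psd1.
Qed.

Lemma pmult_ex p : exists c, pmult p c.
Proof.
elim/mpoly_gen_ind : p => [c|i|p q [c hp] [c' hq]|p q [c hp] [c' hq]].
- by exists (normc c); exact: pmultC.
- exact: pmultX.
- by exists (c + c'); exact: pmultD.
- by exists (c * c'); exact: pmultM.
Qed.

(** The constant term of the kernel is 1 and the other terms are nonnegative on the
    diagonal; in particular kernel vectors do not vanish. *)
Lemma kernel_diag (z : unit_ball R d) : 1 <= complex.Re (rkhs_kernel H z z).
Proof.
have [a [a0 ap _ ak]] := kernel_series.
rewrite -subr_ge0 -[1]/(complex.Re 1) -ReN -ReD.
apply: (@cvg_ge0 _ _ \oo _ (fun m => complex.Re (
   \sum_(0 <= n < m.+1) (a n)%:C%C * cdot (val z) (val z) ^+ n - 1))).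
  move=> m; rewrite big_nat_recl// a0 expr0 mulr1 addrC addKr Re_sum.
  apply: sumr_ge0 => n _; rewrite ReZ; apply: mulr_ge0; first exact: ltW.
  have -> : cdot (val z) (val z) = (\sum_(i < d) normc (val z 0 i) ^+ 2)%:C%C.
    by rewrite rmorph_sum; apply: eq_bigr => i _; rewrite mul_conjc.
  rewrite -(rmorphXn (real_complex R)) Re_rc; rewrite exprn_ge0// sumr_ge0// => i _; exact: sqr_ge0.
have hk : \sum_(0 <= n < m.+1) (a n)%:C%C * cdot (val z) (val z) ^+ n @[m --> \oo] -->
    rkhs_kernel H z z.
  have := ak z z.
  by rewrite -(cvg_shiftS (fun m => \sum_(0 <= n < m) (a n)%:C%C * cdot (val z) (val z) ^+ n)).
by apply: cvgRe; exact: (cvgB hk (cvg_cst (1 : C))).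
Qed.

(** Kernel vectors are eigenvectors of the adjoint of a multiplication operator, so
    that its norm bounds the symbol. *)
Lemma mult_sup (phi : unit_ball R d -> C) c :
  (forall f : rkhs_space H, exists g, rkhs_fun H g = (fun x => phi x * rkhs_fun H f x) /\
    N g <= c * N f) -> forall z, normc (phi z) <= c.
Proof.
move=> h z; have [g [g1 g2]] := h (kvec H z).
have kz : N (kvec H z) ^+ 2 = complex.Re (rkhs_kernel H z z).
  by rewrite inorm_sqr kvec_ip.
have kp : 0 < N (kvec H z) ^+ 2 by rewrite kz (lt_le_trans ltr01)// kernel_diag.
have : rkhs_fun H g z = phi z * rkhs_kernel H z z by rewrite g1 kvecE.
rewrite reproducing -(kvec_ip H z z) ipuu => hz.
have := cauchy_schwarz (rkhs_dot H) g (kvec H z).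
rewrite hz normcM normc_real ger0_norm ?sqr_ge0// => h1.
rewrite -(ler_pM2r kp); apply: le_trans h1 _.
by rewrite expr2 mulrA ler_wpM2r// inorm_ge0.
Qed.

Lemma pmult_sup p c : pmult p c -> forall z, unit_ball R d z -> normc (poly_fun p z) <= c.
Proof.
move=> [_ hp] z zB.
by have := mult_sup hp (SigSub (mem_set zB) : unit_ball R d).
Qed.

End PolyMultipliers.

(** * Finite orthonormal families and positive forms *)

Section Orthonormal.
Context (R : realType) (V : lmodType R[i]) (ip : {dot V for Num.conj}).
Local Notation N := (inorm ip).
Implicit Types (x y : V) (F G : seq V).

Definition onseq G := uniq G /\ forall u v, u \in G -> v \in G -> ip u v = (u == v)%:R.
Definition lincomb G (a : V -> R[i]) := \sum_(g <- G) a g *: g.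

Lemma lincomb_ip G a h : onseq G -> h \in G -> ip (lincomb G a) h = a h.
Proof.
move=> [uG oG] hG; rewrite ip_suml (bigD1_seq h)//= ipZl oG// eqxx mulr1.
rewrite big_seq_cond big1 ?addr0// => g /andP[gG gh].
by rewrite ipZl oG// (negbTE gh) mulr0.
Qed.

Lemma lincomb_ip2 G a b : onseq G ->
  ip (lincomb G a) (lincomb G b) = \sum_(g <- G) a g * Num.conj (b g).
Proof.
move=> oG; rewrite [X in ip _ X]/lincomb ip_sumr !big_seq.
by apply: eq_bigr => g gG; rewrite ipZr lincomb_ip// mulrC.
Qed.

Lemma lincomb_norm G a : onseq G -> N (lincomb G a) ^+ 2 = \sum_(g <- G) normc (a g) ^+ 2.
Proof.
move=> oG; rewrite inorm_sqr lincomb_ip2// Re_sum.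
by apply: eq_bigr => g _; rewrite mul_conjc.
Qed.

Definition oproj G x := lincomb G (fun g => ip x g).

Lemma oproj_orth G x a : onseq G -> ip (x - oproj G x) (lincomb G a) = 0.
Proof.
move=> oG; rewrite [X in ip _ X]/lincomb ip_sumr big_seq big1// => g gG.
by rewrite ipZr ipBl lincomb_ip// subrr mulr0.
Qed.

Lemma oproj_best G x a : onseq G -> N (x - oproj G x) <= N (x - lincomb G a).
Proof.
move=> oG; rewrite -(ler_pXn2r (n:=2))// ?nnegrE ?inorm_ge0//.
have -> : x - lincomb G a = (x - oproj G x) + lincomb G (fun g => ip x g - a g).
  have -> : lincomb G (fun g => ip x g - a g) = oproj G x - lincomb G a.
    by rewrite /oproj /lincomb -sumrB; apply: eq_bigr => g _; rewrite scalerBl.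
  by rewrite addrA subrK.
by rewrite [in leRHS]inormD_sqr oproj_orth// mulr0 addr0 lerDl sqr_ge0.
Qed.

Lemma bessel G x : onseq G -> \sum_(g <- G) normc (ip x g) ^+ 2 <= N x ^+ 2.
Proof.
move=> oG; rewrite -(lincomb_norm (fun g => ip x g))// -/(oproj G x).
rewrite -{2}(subrK (oproj G x) x) inormD_sqr.
rewrite (_ : ip (x - oproj G x) (oproj G x) = 0) ?mulr0 ?addr0; last exact: oproj_orth.
by rewrite lerDr sqr_ge0.
Qed.

Definition inspan G y := exists a, y = lincomb G a.

Lemma inspanS G G' y : uniq G -> uniq G' -> {subset G <= G'} -> inspan G y -> inspan G' y.
Proof.
move=> uG uG' GG' [a ->]; exists (fun g => if g \in G then a g else 0).
rewrite /lincomb [RHS](bigID (mem G))/= [X in _ + X]big1 ?addr0; last first.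
  by move=> g /negbTE ->; rewrite scale0r.
rewrite -[RHS]big_filter (perm_big [seq g <- G' | g \in G]).
  by rewrite big_seq [RHS]big_seq; apply: eq_bigr => g; rewrite mem_filter => /andP[-> _].
apply: uniq_perm => //; first exact: filter_uniq.
by move=> g; rewrite mem_filter; case: (boolP (g \in G)) => //= /GG' ->.
Qed.

Lemma inspanD G y z a : inspan G y -> inspan G z -> inspan G (a *: y + z).
Proof.
move=> [b ->] [c ->]; exists (fun g => a * b g + c g).
rewrite /lincomb scaler_sumr -big_split; apply: eq_bigr => g _ /=.
by rewrite scalerA scalerDl.
Qed.

Lemma inspan_mem G g : uniq G -> g \in G -> inspan G g.
Proof.
move=> uG gG; exists (fun h => (h == g)%:R).
rewrite /lincomb (bigD1_seq g)//= eqxx scale1r big1 ?addr0// => h /negbTE ->.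
by rewrite scale0r.
Qed.

Lemma onb_onseq B G : orthonormal_basis ip B -> uniq G -> (forall g, g \in G -> B g) -> onseq G.
Proof. by move=> [oB _] uG GB; split=> // u v uu vv; apply: oB; exact: GB. Qed.

(** The span of an orthonormal basis is dense, and enlarging a finite part of the
    basis does not worsen projections onto it. *)
Lemma onb_approx B (xs F : seq V) e : cauchy_complete ip -> orthonormal_basis ip B ->
  0 < e -> uniq F -> (forall g, g \in F -> B g) ->
  exists G, [/\ uniq G, (forall g, g \in G -> B g), {subset F <= G} &
    forall x, x \in xs -> N (x - oproj G x) < e].
Proof.
move=> cpl oB e0 uF FB; elim: xs => [|x xs [G [uG GB FG hG]]].
  by exists F; split.
have [s hs] : exists s : seq (R[i] * B), N (comb (fun b : B => val b) s - x) < e.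
  apply: comb_dense => // g hg; apply: oB.2 => b Bb.
  by have := hg (SigSub (mem_set Bb) : B).
pose G' := undup (G ++ [seq val p.2 | p <- s]).
have uG' : uniq G' by exact: undup_uniq.
have GG' : {subset G <= G'} by move=> g gG; rewrite mem_undup mem_cat gG.
have G'B g : g \in G' -> B g.
  rewrite mem_undup mem_cat => /orP[/GB//|/mapP[p _ ->]].
  by have := valP p.2; rewrite inE.
have oG' := onb_onseq oB uG' G'B.
exists G'; split=> // [g /FG /GG'//|y]; rewrite inE => /predU1P[->|yxs].
  have [a ha] : inspan G' (comb (fun b : B => val b) s).
    have : forall p, p \in s -> val p.2 \in G'.
      by move=> p ps; rewrite mem_undup mem_cat; apply/orP; right; apply/mapP; exists p.
    elim: s {hs} G' {GG' G'B oG'} uG' => [|p s IH] G' uG' hG'.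
      by exists (fun=> 0); rewrite /comb /lincomb big_nil big1// => ? _; rewrite scale0r.
    rewrite /comb big_cons; apply: inspanD.
      by apply: inspan_mem => //; apply: hG'; rewrite inE eqxx.
    by apply: IH => // q qs; apply: hG'; rewrite inE qs orbT.
  by rewrite (le_lt_trans (oproj_best x a oG'))// -ha inormB.
have [a ha] : inspan G' (oproj G y).
  by apply: (inspanS uG) => //; exists (fun g => ip y g).
by rewrite (le_lt_trans (oproj_best y a oG'))// -ha hG.
Qed.

End Orthonormal.

Lemma sum_ord_recl (W : nmodType) n (F : nat -> W) :
  \sum_(k < n.+1) F k = F 0%N + \sum_(k < n) F k.+1.
Proof. by rewrite big_ord_recl. Qed.

Section PositiveForms.
Context (R : realType) (V : lmodType R[i]).

Definition posform (q : V -> V -> R[i]) :=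
  [/\ forall a x y z, q (a *: x + y) z = a * q x z + q y z,
      forall x y, q y x = Num.conj (q x y) & forall x, 0 <= complex.Re (q x x)].

Lemma posform_Im q x : posform q -> q x x = (complex.Re (q x x))%:C%C.
Proof.
move=> [_ /(_ x x) h _]; have : complex.Im (q x x) = - complex.Im (q x x).
  by rewrite {1}h Im_cnj.
by move=> h1; apply/eqP; rewrite eq_complex /= eqxx /=; apply/eqP; lra.
Qed.

(** Cauchy-Schwarz for degenerate forms: when q x x vanishes, the positivity of
    q (t x + y) (t x + y) for large t forces q x y = 0. *)
Lemma posform_cs q x y : posform q ->
  normc (q x y) ^+ 2 <= complex.Re (q x x) * complex.Re (q y y).
Proof.
move=> pq; have [ql qc qp] := pq.
have qr a u v w : q w (a *: u + v) = Num.conj a * q w u + q w v.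
  by rewrite qc ql cnjD cnjM -!qc.
set X := complex.Re (q x x); set Y := complex.Re (q y y).
set c := q x y; set D := normc c ^+ 2.
have key (t : R) : 0 <= t ^+ 2 * D * X - 2 * t * D + Y.
  have := qp ((- t%:C%C * Num.conj c) *: x + y).
  rewrite ql !qr (posform_Im x pq) (posform_Im y pq) -/X -/Y (qc x y) -/c.
  set u := (_ + _); suff -> : u = (t ^+ 2 * D * X - 2 * t * D + Y)%:C%C by [].
  have hD : D%:C%C = c * Num.conj c by rewrite mul_conjc.
  rewrite /u cnjM cnjN cnjR cnjK expr2; clearbody D X Y.
  rewrite rmorphD rmorphB !rmorphM /= hD.
  rewrite (_ : (2%:R)%:C%C = 2%:R :> R[i]) ?rmorphMn//; ring.
have D0 : 0 <= D by exact: sqr_ge0.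
have X0 : 0 <= X := qp x; have Y0 : 0 <= Y := qp y.
have [->|Dn] := eqVneq D 0; first exact: mulr_ge0.
have Dp : 0 < D by rewrite lt_neqAle eq_sym Dn.
have [X00|Xn] := eqVneq X 0.
  have := key ((Y + 1) / D); rewrite X00 mulr0 add0r.
  have -> : 2 * ((Y + 1) / D) * D = 2 * (Y + 1) by rewrite -mulrA divfK.
  by lra.
have Xp : 0 < X by rewrite lt_neqAle eq_sym Xn.
have := key X^-1.
have -> : X^-1 ^+ 2 * D * X - 2 * X^-1 * D + Y = (X * Y - D) / X by field.
by rewrite pmulr_lge0 ?invr_gt0// subr_ge0.
Qed.

(** On a finite set a positive form is a sum of rank one forms dominated by it: a
    Cholesky decomposition, obtained by successive Schur complements. *)
Lemma posform_factor (G : seq V) (q : V -> V -> R[i]) : posform q ->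
  exists n (phi : nat -> V -> R[i]),
  [/\ forall k a x y, phi k (a *: x + y) = a * phi k x + phi k y,
      forall x, \sum_(k < n) normc (phi k x) ^+ 2 <= complex.Re (q x x) &
      forall x y, x \in G -> q x y = \sum_(k < n) phi k x * Num.conj (phi k y)].
Proof.
elim: G q => [|g G IH] q pq.
  exists 0%N, (fun _ _ => 0); split=> // [k a x y|x].
    by rewrite mulr0 addr0.
  by rewrite big_ord0; case: pq.
have [ql qc qp] := pq.
set s := complex.Re (q g g).
have [s0|sn] := eqVneq s 0.
  have q0 y : q g y = 0.
    apply: eq0_normc; apply/eqP; rewrite -sqrf_eq0 eq_le sqr_ge0 andbT.
    by rewrite (le_trans (posform_cs _ _ pq))// -/s s0 mul0r.
  have [n [phi [h1 h2 h3]]] := IH q pq; exists n, phi; split=> // x y.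
  rewrite inE => /predU1P[->|]; last exact: h3.
  have := h2 g; rewrite -/s s0 => h4; rewrite q0 big1// => k _.
  rewrite [phi k g](_ : _ = 0) ?mul0r//; apply: eq0_normc; apply/eqP.
  rewrite -sqrf_eq0 eq_le sqr_ge0 andbT (le_trans _ h4)//.
  by rewrite (bigD1 k)//= lerDl sumr_ge0// => j _; exact: sqr_ge0.
have sp : 0 < s by rewrite lt_neqAle eq_sym sn qp.
have qgg : q g g = s%:C%C by exact: posform_Im.
have sC : s%:C%C != 0 :> R[i] by rewrite fmorph_eq0.
(* the Schur complement of q with respect to g *)
pose q' x y := q x y - q x g * q g y / s%:C%C.
have pq' : posform q'.
  split=> [a x y z|x y|x].
  - by rewrite /q' !ql; ring.
  - rewrite /q' (qc x y) cnjD cnjN !cnjM (_ : Num.conj (s%:C%C^-1) = s%:C%C^-1).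
      by rewrite -!qc; ring.
    by rewrite -fmorphV; exact: cnjR.
  - rewrite /q' (qc x g) mul_conjc -fmorphV -rmorphM ReD ReN Re_rc subr_ge0.
    by rewrite ler_pdivrMr// posform_cs.
have [n [phi [h1 h2 h3]]] := IH q' pq'.
pose t := Num.sqrt s.
have tt : t ^+ 2 = s by rewrite sqr_sqrtr// ltW.
have ttC : t%:C%C * t%:C%C = s%:C%C :> R[i] by rewrite -rmorphM -expr2 tt.
have tC : t%:C%C != 0 :> R[i] by apply: contra_neq sC => t0; rewrite -ttC t0 mul0r.
have q'g y : q' g y = 0.
  by rewrite /q' qgg mulrAC divff// mul1r subrr.
have phig k : (k < n)%N -> phi k g = 0.
  move=> kn; have := h2 g; rewrite q'g => h4; apply: eq0_normc; apply/eqP.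
  rewrite -sqrf_eq0 eq_le sqr_ge0 andbT (le_trans _ h4)//.
  by rewrite (bigD1 (Ordinal kn))//= lerDl sumr_ge0// => j _; exact: sqr_ge0.
pose psi k := if k is j.+1 then phi j else fun x => q x g / t%:C%C.
exists n.+1, psi; split.
- by case=> [|k] a x y; rewrite /psi ?h1// ql mulrDl mulrA.
- move=> x; rewrite (sum_ord_recl _ (fun k => normc (psi k x) ^+ 2)) /=.
  have := h2 x; rewrite /q' (qc x g) mul_conjc -fmorphV -rmorphM ReD ReN Re_rc.
  by rewrite normcM -fmorphV normc_real exprMn real_normK ?num_real// exprVn tt; lra.
- move=> x y; rewrite inE (sum_ord_recl _ (fun k => psi k x * Num.conj (psi k y))) /=.
  rewrite cnjM (_ : Num.conj (t%:C%C^-1) = t%:C%C^-1); last by rewrite -fmorphV; exact: cnjR.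
  have -> : q x g / t%:C%C * (Num.conj (q y g) / t%:C%C) = q x g * q g y / s%:C%C.
    by rewrite -qc -ttC; field.
  move=> /predU1P[->|xG].
    rewrite big1 ?addr0; last by move=> k _; rewrite phig// mul0r.
    by rewrite qgg mulrAC divff// mul1r.
  by rewrite -h3// /q' addrC subrK.
Qed.

End PositiveForms.

(** * Traces of trace class operators *)

Lemma even_or_odd n : exists m, n = (m + m)%N \/ n = (m + m).+1.
Proof.
exists n./2; have := odd_double_half n; rewrite -addnn.
by case: (odd n) => /= h; [right|left]; rewrite -{1}h.
Qed.

Section PositiveOperators.
Context (R : realType) (V : lmodType R[i]) (ip : {dot V for Num.conj}).
Local Notation N := (inorm ip).
Implicit Types (u v w : V).

(** Polarisation: a complex operator with real quadratic form is symmetric. *)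
Lemma positive_op_sym (P : {linear V -> V}) : positive_op ip P ->
  forall u v, ip (P u) v = ip u (P v).
Proof.
move=> Pp u v; rewrite [RHS]ipC.
have PD x y : P (x + y) = P x + P y by exact: linearD.
have PZ a x : P (a *: x) = a *: P x by exact: linearZ.
have im w : complex.Im (ip (P w) w) = 0 by apply: ger0_Im; exact: Pp.
have h1 := im (u + v); have h2 := im (u + 'i%C *: v).
move: h1 h2; rewrite !PD PZ !(ipDl, ipDr, ipZl, ipZr) !ImD.
have := im u; have := im v => -> ->.
case: (ip (P u) v) => a b; case: (ip (P v) u) => c e /=.
have := im v; case: (ip (P v) v) => x y /= y0.
rewrite y0 => h1 h2; apply/eqP; rewrite eq_complex /=; apply/andP; split; apply/eqP; lra.
Qed.

Section Contraction.
Context (X : V -> V).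
Hypothesis Xlin : forall a u v, X (a *: u + v) = a *: X u + X v.
Hypothesis Xsym : forall u v, ip (X u) v = ip u (X v).
Hypothesis Xge0 : forall u, 0 <= complex.Re (ip (X u) u).
Hypothesis Xle1 : forall u, complex.Re (ip (X u) u) <= N u ^+ 2.

Lemma iter_lin n a u v : iter n X (a *: u + v) = a *: iter n X u + iter n X v.
Proof. by elim: n => //= n ->; rewrite Xlin. Qed.

Lemma iter_sym n u v : ip (iter n X u) v = ip u (iter n X v).
Proof. by elim: n u v => //= n IH u v; rewrite Xsym IH -iterSr. Qed.

Let b n u := complex.Re (ip (iter n X u) u).

Lemma iter_even n u : b (n + n) u = N (iter n X u) ^+ 2.
Proof. by rewrite /b iterD iter_sym inorm_sqr. Qed.

Lemma iter_odd n u : b (n + n).+1 u = complex.Re (ip (X (iter n X u)) (iter n X u)).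
Proof. by rewrite /b -addnS iterD iter_sym. Qed.

Lemma contraction_sqr w : N (X w) ^+ 2 <= complex.Re (ip (X w) w).
Proof.
have Xsub u v : X (u - v) = X u - X v by rewrite addrC -scaleN1r Xlin scaleN1r addrC.
have h1 := Xge0 (w - X w); have h2 := Xle1 (X w).
move: h1 h2; rewrite !inorm_sqr Xsub !(ipBl, ipBr) !(ReD, ReN).
have -> : ip (X (X w)) w = ip (X w) (X w) by rewrite Xsym.
by lra.
Qed.

(** The moments <X^n u, u> of an operator 0 <= X <= 1 decrease. They are
    |X^m u|^2 or <X X^m u, X^m u> according to the parity of n, which avoids square
    roots of X. *)
Lemma iter_mono n u : b n.+1 u <= b n u.
Proof.
have [m [hn|hn]] := even_or_odd n.
  by rewrite hn iter_odd iter_even Xle1.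
rewrite hn iter_odd -addnS -addSn iter_even iterS; exact: contraction_sqr.
Qed.

Lemma iter_ge0 n u : 0 <= b n u.
Proof.
have [m [->|->]] := even_or_odd n.
  by rewrite iter_even sqr_ge0.
by rewrite iter_odd.
Qed.

Lemma iter_le m n u : (m <= n)%N -> b n u <= b m u.
Proof.
by move=> /subnK <-; elim: (n - m)%N => // k IH; rewrite addSn (le_trans (iter_mono _ _)).
Qed.

Lemma sub_iter_contraction n u : N (u - iter n X u) <= N u.
Proof.
rewrite -(ler_pXn2r (n:=2))// ?nnegrE ?inorm_ge0//.
rewrite inormD_sqr inormN ipNr ReN ipC Re_cnj -/(b n u) -iter_even.
have := iter_le u (leq_addr n n); have := iter_ge0 n u.
by move: (b _ _) (b _ _) => x y; lra.
Qed.

Lemma iter_diff_sqr n u : N (iter n X u - iter n.+1 X u) ^+ 2 <= b (n + n) u - b (n + n).+1 u.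
Proof.
rewrite inormD_sqr inormN ipNr ReN -iter_even -[N (iter n.+1 X u) ^+ 2]iter_even.
rewrite ipC Re_cnj iterS -iter_odd.
have := iter_mono (n + n).+1 u; rewrite addSn addnS.
by move: (b _ _) (b _ _) (b _ _) => x y z; lra.
Qed.

(** The squared norms of X^n u - X^(n+1) u are bounded by successive differences of
    the decreasing moments, which tend to 0. *)
Lemma iter_diff_small (F : seq V) e : 0 < e ->
  exists n, forall u, u \in F -> N (iter n X u - iter n.+1 X u) < e.
Proof.
move=> e0.
suff [n hn] : exists n, forall u, u \in F -> b (n + n) u - b (n + n).+1 u < e ^+ 2.
  exists n => u /hn h; rewrite -(ltr_pXn2r (n:=2))// ?nnegrE ?inorm_ge0 ?ltW//.
  exact: le_lt_trans (iter_diff_sqr _ _) h.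
have cv u : \forall n \near \oo, b n u - b n.+1 u < e ^+ 2.
  have bcv : cvgn (b ^~ u).
    apply: nonincreasing_is_cvgn; first by apply/nonincreasing_seqP => n; exact: iter_mono.
    by exists 0 => _ [n _ <-]; exact: iter_ge0.
  have h2 : b n u - b n.+1 u @[n --> \oo] --> limn (b ^~ u) - limn (b ^~ u).
    by apply: cvgB => //; have := bcv; rewrite -(cvg_shiftS (b ^~ u)).
  rewrite subrr in h2; have /cvgrPdist_lt /(_ (e ^+ 2)) := h2.
  rewrite exprn_gt0// => /(_ isT); apply: filterS => n.
  by rewrite sub0r normrN; apply: le_lt_trans; exact: ler_norm.
have [K hK] : exists K, forall u, u \in F -> forall n, (K <= n)%N -> b n u - b n.+1 u < e ^+ 2.
  elim: F => [|u F [K hK]]; first by exists 0%N.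
  have [K1 _ hK1] := cv u; exists (maxn K K1) => v; rewrite inE => /predU1P[->|vF] n.
    by rewrite geq_max => /andP[_ /hK1].
  by rewrite geq_max => /andP[/(hK _ vF)].
by exists K => u uF; apply: hK => //; exact: leq_addr.
Qed.

Lemma iter_telescope k u : \sum_(j < k) (iter j X u - iter j.+1 X u) = u - iter k X u.
Proof.
elim: k => [|k IH]; first by rewrite big_ord0 subrr.
by rewrite big_ord_recr /= IH addrA subrK.
Qed.

End Contraction.

Section TraceEstimate.
Hypothesis complete : cauchy_complete ip.
Context (T P : {linear V -> V}).
Hypothesis PT : is_absolute_value ip T P.
Context (B : set V).
Hypothesis oB : orthonormal_basis ip B.
Context (tau : R).
Hypothesis Ptau : forall G, uniq G -> (forall g, g \in G -> B g) ->
  \sum_(g <- G) complex.Re (ip (P g) g) <= tau.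

(** The trace of A T restricted to a finite part F of the basis is small when
    the trace of |T| on F is small, uniformly in the bounded operator A.
    With X = 1 - |T| normalised to 0 <= X <= 1, the operators
    T (1 + X + ... + X^(k-1)) are contractions which replace the partial
    isometry of the polar decomposition, and a finite Cholesky factorisation
    of |T| replaces its square root. *)
Lemma trace_tail (A : V -> V) c (F : seq V) t :
  (forall a u v, A (a *: u + v) = a *: A u + A v) ->
  (forall u, N (A u) <= c * N u) -> 0 <= c -> uniq F -> (forall g, g \in F -> B g) ->
  0 < t ->
  normc (\sum_(e <- F) ip (A (T e)) e) <=
    (t * \sum_(e <- F) complex.Re (ip (P e) e) + c ^+ 2 * tau / t) / 2.
Proof.
move=> Alin Abd c0 uF FB t0.
have [[M0 hM0] Pp PTe] := PT.
pose M := `|M0| + 1.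
have Mp : 0 < M by rewrite ltr_wpDl.
have hM u : N (P u) <= M * N u.
  apply: le_trans (hM0 u) _; rewrite ler_wpM2r ?inorm_ge0//.
  by rewrite (le_trans (ler_norm _))// lerDl.
have Psym := positive_op_sym Pp.
have PL a x y : P (a *: x + y) = a *: P x + P y by exact: linearP.
have TL a x y : T (a *: x + y) = a *: T x + T y by exact: linearP.
have TD x y : T (x + y) = T x + T y by exact: linearD.
have Pre u : 0 <= complex.Re (ip (P u) u) by have := Pp u; rewrite lecE => /andP[].
have NTP u : N (T u) = N (P u).
  apply/eqP; rewrite -(eqrXn2 (n := 2)) ?inorm_ge0// !inorm_sqr -PTe.
  by rewrite Psym.
(* X lies between 0 and 1, and q k, a partial Neumann series, inverts P up to X^k *)
pose X u := u - (M^-1)%:C%C *: P u.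
have MC : M%:C%C != 0 :> R[i] by rewrite fmorph_eq0 gt_eqF.
have Xlin a u v : X (a *: u + v) = a *: X u + X v.
  rewrite /X PL !scalerDr !scalerA opprD addrACA scalerN scalerA.
  by rewrite (mulrC a).
have Xsym u v : ip (X u) v = ip u (X v).
  by rewrite /X ipBl ipBr ipZl ipZr cnjR Psym.
have Xre u : complex.Re (ip (X u) u) = N u ^+ 2 - M^-1 * complex.Re (ip (P u) u).
  by rewrite /X ipBl ipZl ReD ReN ReZ inorm_sqr.
have Xge0 u : 0 <= complex.Re (ip (X u) u).
  rewrite Xre subr_ge0 ler_pdivrMl//.
  apply: le_trans (ler_norm _) _; apply: le_trans (normc_Re _) _.
  by apply: le_trans (cauchy_schwarz _ _ _) _; rewrite expr2 mulrA ler_wpM2r ?inorm_ge0.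
have Xle1 u : complex.Re (ip (X u) u) <= N u ^+ 2.
  by rewrite Xre lerBlDr lerDl mulr_ge0// invr_ge0 ltW.
have PX u : P u = M%:C%C *: (u - X u).
  by rewrite /X opprB addrC subrK scalerA -rmorphM mulfV ?gt_eqF// rmorph1 scale1r.
pose q k u := (M^-1)%:C%C *: \sum_(j < k) iter j X u.
have Xsub u v : X (u - v) = X u - X v by rewrite addrC -scaleN1r Xlin scaleN1r addrC.
have qP k u : q k (P u) = u - iter k X u.
  rewrite -(iter_telescope X) /q PX scaler_sumr; apply: eq_bigr => j _.
  have -> : M%:C%C *: (u - X u) = M%:C%C *: (u - X u) + 0 by rewrite addr0.
  have i0 : iter j X 0 = 0.
    by elim: (val j) => //= i ->; have := Xsub 0 0; rewrite !subrr.
  rewrite (iter_lin Xlin) i0 addr0 scalerA -rmorphM mulVf ?gt_eqF// scale1r.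
  rewrite -[u - X u]addrC -scaleN1r (iter_lin Xlin) scaleN1r addrC -iterSr.
  by [].
have Pq k u : P (q k u) = u - iter k X u.
  rewrite -(iter_telescope X) /q linearZ linear_sum /= scaler_sumr; apply: eq_bigr => j _.
  by rewrite PX scalerA -rmorphM mulVf ?gt_eqF// scale1r.
have qlin k a u v : q k (a *: u + v) = a *: q k u + q k v.
  rewrite /q; under eq_bigr do rewrite (iter_lin Xlin).
  by rewrite big_split -scaler_sumr /= scalerDr !scalerA mulrC.
apply/ler_addgt0Pr => eps eps0.
pose n := (size F).+1%:R : R.
have n0 : 0 < n by rewrite ltr0n.
have d1 : 0 < eps / 2 / n / (c + 1) / M.
  by rewrite !divr_gt0// ltr_wpDl.
have [k hk] := iter_diff_small Xlin Xsym Xge0 Xle1 F d1.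
have d2 : 0 < eps / 2 / n / (c + 1) by rewrite !divr_gt0// ltr_wpDl.
have [G [uG GB FG hG]] := onb_approx [seq P e | e <- F] complete oB d2 uF FB.
have oG := onb_onseq oB uG GB.
have oF := onb_onseq oB uF FB.
pose C u := A (T (q k u)).
have Clin a u v : C (a *: u + v) = a *: C u + C v.
  by rewrite /C qlin TL Alin.
have Cbd u : N (C u) <= c * N u.
  apply: le_trans (Abd _) _; rewrite ler_wpM2l// NTP Pq.
  exact: sub_iter_contraction.
have e1 e : e \in F -> N e = 1.
  move=> eF; apply/eqP; rewrite -(eqrXn2 (n := 2)) ?inorm_ge0// inorm_sqr.
  by rewrite oF.2// eqxx expr1n.
(* A T = C P + A T X^k, and P e is replaced by its projection on the span of G *)
have split e : ip (A (T e)) e = ip (C (oproj ip G (P e))) e +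
    (ip (C (P e - oproj ip G (P e))) e + ip (A (T (iter k X e))) e).
  have Csub u v : C (u - v) = C u - C v by rewrite addrC -scaleN1r Clin scaleN1r addrC.
  have AD u v : A (u + v) = A u + A v by have := Alin 1 u v; rewrite !scale1r.
  rewrite addrA -ipDl Csub [C _ + (_ - _)]addrC subrK /C qP -ipDl -AD -TD.
  by rewrite subrK.
under eq_bigr do rewrite split.
rewrite big_split /=; apply: le_trans (le_normcD _ _) _; apply: lerD; last first.
  apply: le_trans (normc_sum _ _ _) _.
  have -> : eps = n * (eps / n) by rewrite mulrC divfK// gt_eqF.
  apply: (@le_trans _ _ (\sum_(e <- F) (eps / n))); last first.
    rewrite big_const_seq count_predT iter_addr_0 -[_ *+ size F]mulr_natl.
    by rewrite ler_wpM2r ?divr_ge0 ?ltW// ltr_nat.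
  rewrite !big_seq; apply: ler_sum => e eF.
  apply: le_trans (le_normcD _ _) _.
  have -> : eps / n = eps / 2 / n + eps / 2 / n by field; rewrite gt_eqF.
  apply: lerD; apply: le_trans (cauchy_schwarz _ _ _) _; rewrite (e1 e)// mulr1.
    apply: le_trans (Cbd _) _.
    apply: (@le_trans _ _ (c * (eps / 2 / n / (c + 1)))).
      by rewrite ler_wpM2l// ltW// hG// map_f.
    have c1 : c + 1 != 0 by rewrite gt_eqF// ltr_wpDl.
    by rewrite mulrC mulrAC ler_pdivrMr ?ltr_wpDl// ler_wpM2l ?lerDl// !divr_ge0// ltW.
  apply: le_trans (Abd _) _; rewrite NTP PX inormZ normc_real gtr0_norm//.
  apply: (@le_trans _ _ (c * (eps / 2 / n / (c + 1)))).
    rewrite ler_wpM2l// -ler_pdivlMl// mulrC ltW//; exact: hk.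
  by rewrite mulrC mulrAC ler_pdivrMr ?ltr_wpDl// ler_wpM2l ?lerDl// !divr_ge0// ltW.
have pq : posform (fun x y => ip (P x) y).
  split=> [a x y z|x y|x] //.
  - by rewrite PL ipDl ipZl.
  - by rewrite Psym ipC.
have [m [phi [phil phib phie]]] := posform_factor F pq.
pose y j := lincomb G (fun g => Num.conj (phi j g)).
have Csum (I : Type) (r : seq I) (f : I -> V) a :
    C (\sum_(i <- r) a i *: f i) = \sum_(i <- r) a i *: C (f i).
  elim: r => [|i r IH]; last by rewrite !big_cons Clin IH.
  by rewrite !big_nil; have := Clin (-1) 0 0; rewrite scaler0 addr0 scaleN1r addNr.
have -> : \sum_(e <- F) ip (C (oproj ip G (P e))) e =
    \sum_(j < m) \sum_(e <- F) phi j e * ip (C (y j)) e.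
  rewrite exchange_big /= !big_seq; apply: eq_bigr => e eF.
  rewrite /oproj /lincomb Csum ip_suml.
  transitivity (\sum_(g <- G) \sum_(j < m) phi j e * Num.conj (phi j g) * ip (C g) e).
    by apply: eq_bigr => g _; rewrite ipZl phie// mulr_suml.
  rewrite exchange_big /=; apply: eq_bigr => j _.
  rewrite /y /lincomb Csum ip_suml mulr_sumr; apply: eq_bigr => g _.
  by rewrite ipZl mulrA.
apply: le_trans (normc_sum _ _ _) _.
apply: (@le_trans _ _ (\sum_(j < m) (\sum_(e <- F) (t * normc (phi j e) ^+ 2) / 2
    + c ^+ 2 * (\sum_(g <- G) normc (phi j g) ^+ 2) / t / 2))).
  apply: ler_sum => j _; apply: le_trans (normc_sum _ _ _) _.
  apply: (@le_trans _ _ (\sum_(e <- F) (t * normc (phi j e) ^+ 2 / 2 +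
     normc (ip (C (y j)) e) ^+ 2 / t / 2))).
    apply: ler_sum => e _; rewrite normcM.
    move: (normc (phi j e)) (normc (ip _ _)) => x z.
    have : 0 <= (t * x - z) ^+ 2 / t by rewrite divr_ge0 ?sqr_ge0// ltW.
    have -> : (t * x - z) ^+ 2 / t = t * x ^+ 2 - 2 * (x * z) + z ^+ 2 / t.
      by field; rewrite gt_eqF.
    by lra.
  rewrite big_split /= -!mulr_suml lerD2l ler_wpM2r// ler_wpM2r ?invr_ge0 ?(ltW t0)//.
  apply: le_trans (bessel _ oF) _.
  rewrite -[\sum_(g <- G) _](_ : N (y j) ^+ 2 = _).
    by rewrite -exprMn lerXn2r ?nnegrE ?mulr_ge0 ?inorm_ge0.
  by rewrite lincomb_norm//; apply: eq_bigr => g _; rewrite normc_conj.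
rewrite big_split /= -!mulr_suml -mulr_sumr mulrDl; apply: lerD.
  rewrite exchange_big /= mulr_sumr mulr_suml; apply: ler_sum => e _.
  by rewrite -mulr_suml -mulr_sumr ler_wpM2r// ler_wpM2l ?(ltW t0).
rewrite ler_wpM2r// ler_wpM2r ?invr_ge0 ?(ltW t0)// ler_wpM2l ?sqr_ge0//.
rewrite exchange_big /=; apply: le_trans (Ptau uG GB); apply: ler_sum => g _.
exact: phib.
Qed.

End TraceEstimate.
End PositiveOperators.

Section TraceLimit.
Context (R : realType) (V : lmodType R[i]) (ip : {dot V for Num.conj}).
Local Notation N := (inorm ip).
Hypothesis complete : cauchy_complete ip.

(** The sums of <|T| e, e> over finite parts of the basis have a supremum; a finite
    part that almost reaches it leaves little outside. *)
Lemma trace_class_tails (T : {linear V -> V}) : trace_class ip T ->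
  exists (P : {linear V -> V}) (B : set V) (tau : R),
  [/\ is_absolute_value ip T P, orthonormal_basis ip B, 0 <= tau,
    forall G, uniq G -> (forall g, g \in G -> B g) ->
      \sum_(g <- G) complex.Re (ip (P g) g) <= tau &
    forall e, 0 < e -> exists F, [/\ uniq F, forall g, g \in F -> B g &
      forall G, uniq G -> (forall g, g \in G -> B g) -> (forall g, g \in G -> g \notin F) ->
        \sum_(g <- G) complex.Re (ip (P g) g) <= e]].
Proof.
move=> [_ [P [PT [B [oB hB]]]]].
have P0 g : 0 <= complex.Re (ip (P g) g).
  by have [_ Pp _] := PT; have := Pp g; rewrite lecE => /andP[].
pose S := [set \sum_(g <- G) complex.Re (ip (P g) g) | G in
  [set G : seq V | uniq G /\ forall g, g \in G -> B g]].
have S0 : S 0 by exists [::] => //; rewrite big_nil.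
have Sb G : uniq G -> (forall g, g \in G -> B g) ->
    \sum_(g <- G) complex.Re (ip (P g) g) <=
      fine (\esum_(e in B) (complex.Re (ip (P e) e))%:E)%E.
  move=> uG GB.
  have h : ((\sum_(g <- G) complex.Re (ip (P g) g))%:E <=
      \esum_(e in B) (complex.Re (ip (P e) e))%:E)%E.
    apply: esum_ge; exists [set` G]; first by (split; [exact: finite_seq|move=> g /= /GB]).
    by rewrite -fsbig_seq// sumEFin.
  rewrite -lee_fin fineK// ge0_fin_numE//; apply: esum_ge0 => e _.
  by rewrite lee_fin.
have hS : has_sup S.
  split; first by exists 0.
  by exists (fine (\esum_(e in B) (complex.Re (ip (P e) e))%:E)%E) => _ [G [uG GB] <-]; exact: Sb.
have ub G : uniq G -> (forall g, g \in G -> B g) ->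
    \sum_(g <- G) complex.Re (ip (P g) g) <= sup S.
  by move=> uG GB; apply: sup_upper_bound => //; exists G.
exists P, B, (sup S); split=> //; first exact: sup_upper_bound.
move=> e e0; have [_ [F [uF FB] <-] hF] := sup_adherent e0 hS.
exists F; split=> // G uG GB GF.
have := ub (F ++ G); rewrite cat_uniq uF uG andbT/=.
have -> : ~~ has (mem F) G by apply/hasPn => g gG; exact: GF.
move=> /(_ isT) h; have := h _; rewrite big_cat /=.
have hh : forall g, g \in F ++ G -> B g by move=> g; rewrite mem_cat => /orP[/FB|/GB].
by move=> /(_ hh); lra.
Qed.

Lemma lift_seq (B : set V) (F : seq V) : (forall g, g \in F -> B g) ->
  exists s : seq B, [seq val b | b <- s] = F.
Proof.
elim: F => [|g F IH] FB; first by exists [::].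
have [|s hs] := IH; first by move=> h hF; apply: FB; rewrite inE hF orbT.
have Bg : B g by apply: FB; rewrite inE eqxx.
by exists ((SigSub (mem_set Bg) : B) :: s); rewrite /= hs.
Qed.

(** The trace of A_n T over a finite part of the basis tends to 0 term by term, and the
    remainder is small uniformly in n by [trace_tail]. *)
Lemma trace_null (T : {linear V -> V}) (A : nat -> V -> V) c :
  trace_class ip T -> 0 <= c ->
  (forall n a u v, A n (a *: u + v) = a *: A n u + A n v) ->
  (forall n u, N (A n u) <= c * N u) ->
  (forall u v, ip (A n u) v @[n --> \oo] --> (0 : R[i])) ->
  trace ip (A n \o T) @[n --> \oo] --> (0 : R[i]).
Proof.
move=> tT c0 Alin Abd Awot.
have [P [B [tau [PT oB tau0 ub tl]]]] := trace_class_tails tT.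
apply/cvgc_normc/cvgrPdist_lt => eps eps0.
have e4 : 0 < eps / 4 by rewrite divr_gt0.
pose t := (c ^+ 2 * tau + 1) / (eps / 4).
have t0 : 0 < t by rewrite divr_gt0// ltr_wpDl// mulr_ge0 ?sqr_ge0.
have [F [uF FB hF]] := tl (eps / 4 / t) (divr_gt0 e4 t0).
have tailF n G : uniq G -> (forall g, g \in G -> B g) -> (forall g, g \in G -> g \notin F) ->
    normc (\sum_(e <- G) ip (A n (T e)) e) <= eps / 4.
  move=> uG GB GF.
  apply: le_trans (trace_tail complete PT oB ub (Alin n) (Abd n) c0 uG GB t0) _.
  have h1 : t * \sum_(e <- G) complex.Re (ip (P e) e) <= eps / 4.
    by rewrite -ler_pdivlMl// mulrC hF.
  have h2 : c ^+ 2 * tau / t <= eps / 4.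
    rewrite ler_pdivrMr// /t [eps / 4 * _]mulrC divfK ?gt_eqF//.
    by rewrite lerDl.
  by lra.
have FA : normc (\sum_(e <- F) ip (A n (T e)) e) @[n --> \oo] --> (0 : R).
  have : (\sum_(e <- F) ip (A n (T e)) e) @[n --> \oo] --> \sum_(e <- F) (0 : R[i]).
    by apply: cvg_finite_sum => e; exact: Awot.
  by rewrite big1// => /cvgc_normc; under eq_fun do rewrite subr0.
have /cvgrPdist_lt /(_ _ e4) := FA; apply: filterS => n.
rewrite !sub0r !normrN !ger0_norm ?normc_ge0// subr0 => hn.
have [[tr0 tr0P]|ntr] := pselect (exists t, is_trace ip (A n \o T) t); last first.
  by rewrite /trace xgetPN ?normc0// => z hz; apply: ntr; exists z.
have := xgetPex 0 (ex_intro _ tr0 tr0P); rewrite -/(trace ip (A n \o T)).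
set tr := trace _ _ => trP.
have FF : Filter (@summability.totally B) by exact: @summability.totally_filter B.
have := trP B oB => /cvgc_normc /cvgrPdist_lt /(_ _ e4) [J0 _ hJ].
have [s hs] := lift_seq FB.
pose J := finmap.fsetU J0 (finmap.seq_fset tt s).
have hps : summability.partial_sum (fun e : B => ip ((A n \o T) (val e)) (val e)) J =
    \sum_(e <- [seq val b | b <- finmap.enum_fset J]) ip (A n (T e)) e.
  by rewrite big_map finmap.big_seq_fsetE.
have : normc (\sum_(e <- [seq val b | b <- finmap.enum_fset J]) ip (A n (T e)) e - tr) < eps / 4.
  rewrite -hps; have := hJ J (finmap.fsubsetUl _ _).
  by rewrite sub0r normrN ger0_norm ?normc_ge0.
set G := [seq val b | b <- _].
have uG : uniq G by rewrite map_inj_uniq ?finmap.fset_uniq//; exact: val_inj.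
have GB g : g \in G -> B g by move=> /mapP[b _ ->]; have := valP b; rewrite inE.
have FG : {subset F <= G}.
  move=> g; rewrite -hs => /mapP[b bs ->]; apply/mapP; exists b => //.
  by rewrite finmap.in_fsetU finmap.seq_fsetE bs orbT.
rewrite (bigID (mem F))/= -big_filter -[X in _ + X - _]big_filter.
have -> : \sum_(i <- [seq i <- G | i \in F]) ip (A n (T i)) i = \sum_(i <- F) ip (A n (T i)) i.
  apply: perm_big; apply: uniq_perm => //; first exact: filter_uniq.
  by move=> g; rewrite mem_filter; case: (boolP (g \in F)) => //= /FG ->.
have := tailF n [seq i <- G | i \notin F] (filter_uniq _ uG) _ _.
set Z := \sum_(i <- [seq i <- G | i \notin F]) _ => hZ.
have {}hZ : normc Z <= eps / 4.
  apply: hZ => g; rewrite mem_filter => /andP[//].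
  by move=> _ /GB.
set Y := \sum_(e <- F) _ in hn * => h.
rewrite (_ : tr = Y + Z - (Y + Z - tr)); last by rewrite subKr.
apply: le_lt_trans (le_normcD _ _) _; rewrite normcN.
have := le_normcD Y Z; lra.
Qed.

End TraceLimit.

(** * Henkin functionals along sequences *)

Section MultOp.
Context (R : realType) (X : Type) (H : rkhs R X).
Local Notation ip := (rkhs_dot H).
Local Notation N := (inorm ip).

Lemma mult_opE (phi : Mult H) f :
  rkhs_fun H (mult_op phi f) = (fun x => val phi x * rkhs_fun H f x).
Proof.
have /asboolP h := valP phi; have hf := h f.
exact: (xgetPex 0 hf).
Qed.

Lemma mult_op_unique (phi : Mult H) f g :
  rkhs_fun H g = (fun x => val phi x * rkhs_fun H f x) -> mult_op phi f = g.
Proof. by move=> h; apply: (@rkhs_fun_inj _ _ H); rewrite mult_opE h. Qed.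

Lemma rkhs_fun_lin a u v x :
  rkhs_fun H (a *: u + v) x = a * rkhs_fun H u x + rkhs_fun H v x.
Proof. by rewrite linearP. Qed.

Lemma mult_op_lin (phi : Mult H) a u v :
  mult_op phi (a *: u + v) = a *: mult_op phi u + mult_op phi v.
Proof.
apply: mult_op_unique; apply/funext => x; rewrite !rkhs_fun_lin !mult_opE; ring.
Qed.

(** The weak-* topology only tests a sequence of multipliers against trace class
    operators, to which [trace_null] applies. *)
Lemma weakstar_cvg (phi : nat -> Mult H) c : 0 <= c ->
  (forall n u, N (mult_op (phi n) u) <= c * N u) ->
  (forall u v, ip (mult_op (phi n) u) v @[n --> \oo] --> (0 : R[i])) ->
  forall L : {scalar Mult H}, continuous (L : weakstar H -> R[i]) ->
  L (phi n) @[n --> \oo] --> (0 : R[i]).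
Proof.
move=> c0 bd wot L Lc.
have t0 (T : traceClass H) : trace_pairing (0 : Mult H) T = 0.
  have z u : mult_op (0 : Mult H) u = 0.
    by apply: mult_op_unique; rewrite linear0; apply/funext => x; rewrite /= mul0r.
  have := @trace_null _ _ ip (@rkhs_complete _ _ H) (sval T) (fun=> mult_op (0 : Mult H)) 0
    (svalP T) (lexx 0) (fun n => mult_op_lin 0).
  have h1 : nat -> forall u, N (mult_op (0 : Mult H) u) <= 0 * N u.
    by move=> _ u; rewrite z inorm0 mul0r.
  have h2 u v : ip (mult_op (0 : Mult H) u) v @[_ --> \oo] --> (0 : R[i]).
    by rewrite z ip0l; exact: cvg_cst.
  move=> /(_ h1 h2) => h; rewrite /trace_pairing.
  exact: (cvg_unique _ (cvg_cst _) h).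
have pc : (fun n => trace_pairing (phi n)) @ \oo -->
    (trace_pairing (0 : Mult H) : {ptws traceClass H -> R[i]}).
  apply/cvg_sup => T U [_ [[W oW <-] W0] WU].
  have nW : nbhs (0 : R[i]) W by apply: open_nbhs_nbhs; split => //; rewrite -(t0 T).
  have := trace_null (@rkhs_complete _ _ H) (svalP T) c0 (fun n => mult_op_lin (phi n)) bd wot.
  move=> /(_ _ nW) [K _ hK]; exists K => // n Kn; apply: WU; exact: hK.
have wc : (fun n => (phi n : weakstar H)) @ \oo --> ((0 : Mult H) : weakstar H).
  move=> U [_ [[W oW <-] W0] WU].
  have nW : nbhs (trace_pairing (0 : Mult H) : {ptws traceClass H -> R[i]}) W.
    by apply: open_nbhs_nbhs; split.
  by have [K _ hK] := pc _ nW; exists K => // n Kn; apply: WU; exact: hK.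
have := @cvg_comp _ _ _ (fun n => (phi n : weakstar H)) (L : weakstar H -> R[i])
  _ _ _ wc (Lc (0 : Mult H)).
by rewrite linear0.
Qed.

End MultOp.

Section HenkinNull.
Context (R : realType) (d : nat) (H : rkhs R (unit_ball R d)).
Hypothesis regH : regular_unitarily_invariant H.
Local Notation C := (R[i]).
Local Notation ip := (rkhs_dot H).
Local Notation N := (inorm ip).
Implicit Types (p q : mpoly.mpoly d C).

Lemma pmult_multiplier p c : pmult H p c ->
  multiplier H (fun x : unit_ball R d => poly_fun p (val x)).
Proof. by move=> [_ hp]; apply/asboolP => f; have [g [hg _]] := hp f; exists g. Qed.

Definition polyMult p : Mult H :=
  exist _ (fun x : unit_ball R d => poly_fun p (val x))
    (pmult_multiplier (projT2 (cid (pmult_ex regH p)))).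

Lemma polyMult_is_poly p : is_poly p (polyMult p).
Proof. by []. Qed.

Lemma polyMult_bound p c f : pmult H p c -> N (mult_op (polyMult p) f) <= c * N f.
Proof.
move=> [c0 hp]; have [g [g1 g2]] := hp f.
by rewrite (mult_op_unique (phi := polyMult p) g1).
Qed.

(** Bounded pointwise convergence on the ball is convergence in the weak operator
    topology, since kernel vectors span a dense subspace. *)
Lemma henkin_null mu (p : nat -> mpoly.mpoly d C) c : henkin H mu ->
  (forall n, pmult H (p n) c) ->
  (forall z, unit_ball R d z -> poly_fun (p n) z @[n --> \oo] --> (0 : C)) ->
  cintegral mu (poly_fun (p n)) @[n --> \oo] --> (0 : C).
Proof.
move=> [_ [L [Lc Lp]]] bd p0.
have c0 : 0 <= c by case: (bd 0%N).
rewrite (_ : (fun n => _) = fun n => L (polyMult (p n))); last first.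
  by apply/funext => n; rewrite (Lp _ _ (polyMult_is_poly (p n))).
apply: (weakstar_cvg c0) => // [n u|u v]; first exact: polyMult_bound.
apply/cvgc_normc/cvgrPdist_lt => e e0.
have e2 : 0 < e / 2 / (c * N u + 1).
  by rewrite !divr_gt0// ltr_wpDl// mulr_ge0 ?inorm_ge0.
have [s hs] := comb_dense (@rkhs_complete _ _ H) (@kvec_total _ _ H) v e2.
have : ip (mult_op (polyMult (p n)) u) (comb (kvec H) s) @[n --> \oo] --> (0 : C).
  have h : \sum_(i <- s) (Num.conj i.1 * (poly_fun (p n) (val i.2) * rkhs_fun H u i.2))
      @[n --> \oo] --> \sum_(i <- s) (0 : C).
    apply: cvg_finite_sum => -[a w] /=.
    rewrite -(mulr0 (Num.conj a)) -(mul0r (rkhs_fun H u w)).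
    apply: cvgM; first exact: cvg_cst.
    apply: cvgM; last exact: cvg_cst.
    by apply: p0; have := valP w; rewrite inE.
  rewrite big1// in h; apply: cvg_trans h; apply: near_eq_cvg; apply: nearW => n.
  rewrite /comb ip_sumr; apply: eq_bigr => -[a w] _ /=.
  by rewrite ipZr -reproducing mult_opE.
move=> /cvgc_normc /cvgrPdist_lt /(_ (e / 2)).
rewrite divr_gt0// => /(_ isT); apply: filterS => n.
rewrite !sub0r !normrN !ger0_norm ?normc_ge0// !subr0 => h.
rewrite (_ : v = comb (kvec H) s - (comb (kvec H) s - v)); last by rewrite subKr.
rewrite ipBr; apply: le_lt_trans (le_normcD _ _) _; rewrite normcN.
have h2 : normc (ip (mult_op (polyMult (p n)) u) (comb (kvec H) s - v)) <= e / 2.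
  apply: le_trans (cauchy_schwarz _ _ _) _.
  apply: (@le_trans _ _ (c * N u * (e / 2 / (c * N u + 1)))).
    rewrite ler_pM ?inorm_ge0//; first exact: polyMult_bound.
    exact: ltW.
  rewrite mulrCA ger_pMr ?divr_gt0// ler_pdivrMr ?mul1r ?lerDl//.
  by rewrite ltr_wpDl// mulr_ge0 ?inorm_ge0.
move: h h2; set x := normc _; set y := normc _; lra.
Qed.

End HenkinNull.

(** * Estimates for polynomials in one variable *)

Section OneVariable.
Context (R : realType).
Local Notation C := (R[i]).
Implicit Types (P Q : {poly C}).

(** Averaging over rotations of order 2^m removes all the coefficients whose
    index is not 1 modulo 2^m and keeps bounds on circles. This finite average
    replaces the contour integral in Cauchy's estimate. *)
Lemma rotation_average P (r M : R) m :
  (forall x, normc x = r -> normc P.[x] <= M) ->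
  exists Q, [/\ forall x, normc x = r -> normc Q.[x] <= M, Q`_1 = P`_1 &
    forall j, Q`_j != 0 -> P`_j != 0 /\ j = 1 %[mod 2 ^ m]].
Proof.
move=> hP; elim: m => [|m [Q [Qb Q1 Qc]]].
  by exists P; split=> // j; rewrite expn0 !modn1.
pose z : C := (2 ^ m).-root (-1).
have zm : z ^+ (2 ^ m) = -1 by apply: rootCK; rewrite expn_gt0.
have nz : normc z = 1.
  apply/eqP; rewrite -(@pexpr_eq1 _ _ (2 ^ m)) ?normc_ge0 ?expn_gt0//.
  by rewrite -normcX zm normcN normc1.
have z0 : z != 0.
  by apply: contraTneq (oner_neq0 R) => z0; rewrite -nz z0 normc0 eqxx.
have cc j : (Q \Po (z *: 'X))`_j = z ^+ j * Q`_j.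
  rewrite comp_polyE coef_sum.
  have [jQ|jQ] := ltnP j (size Q).
    rewrite (bigD1 (Ordinal jQ))//= exprZn coefZ coefZ coefXn eqxx mulr1 mulrC.
    rewrite big1 ?addr0// => k kj; rewrite exprZn !coefZ coefXn.
    have /negbTE -> : j != k :> nat by rewrite eq_sym.
    by rewrite !mulr0.
  rewrite nth_default// mulr0 big1// => k _; rewrite exprZn !coefZ coefXn.
  by rewrite gtn_eqF ?mulr0// (leq_trans (ltn_ord k)).
exists (2^-1 *: (Q + z^-1 *: (Q \Po (z *: 'X)))); split.
- move=> x xr; rewrite hornerZ hornerD hornerZ horner_comp hornerZ hornerX normcM.
  have -> : (2^-1 : C) = (2^-1 : R)%:C%C by rewrite fmorphV rmorphMn.
  rewrite normc_real ger0_norm ?invr_ge0//.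
  have h1 := Qb x xr; have := Qb (z * x); rewrite normcM nz mul1r => /(_ xr) h2.
  have := le_normcD Q.[x] (z^-1 * Q.[z * x]).
  rewrite normcM normcV nz invr1 mul1r; lra.
- rewrite coefZ coefD coefZ cc expr1 mulKf// Q1.
  have : (2 : C) != 0 by rewrite pnatr_eq0.
  by move=> ?; field.
- move=> j; rewrite coefZ coefD coefZ cc mulrA -[Q`_j in X in X + _]mul1r -mulrDl.
  rewrite mulf_eq0 negb_or => /andP[_]; rewrite mulf_eq0 negb_or => /andP[h /Qc[h1 h2]].
  split=> //; case: j h h1 h2 => [|j] h h1 h2.
    have [m0|m1] := posnP m.
      have z1 : z = -1 by move: zm; rewrite [in X in X -> _]m0 expn0 expr1.
      by move: h; rewrite z1 expr0 mulr1 invrN1 subrr eqxx.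
    have m2 : (1 < 2 ^ m)%N by rewrite -{1}(expn0 2) ltn_exp2l.
    by have := h2; rewrite mod0n modn_small.
  have [l jl] : exists l, j = (l * 2 ^ m)%N.
    apply/dvdnP; have := h2; rewrite -[j.+1]add1n => /eqP.
    by rewrite -[X in _ == X %[mod _]](addn0 1%N) eqn_modDl mod0n.
  move: h; rewrite exprS mulKf// jl mulnC exprM zm.
  case: (boolP (odd l)) => ol; first by rewrite -signr_odd ol expr1 subrr eqxx.
  move=> _; have [k ->] : exists k, (2 ^ m * l)%N = (k * 2 ^ m.+1)%N.
    by exists l./2; rewrite -{1}[l]odd_double_half (negbTE ol) add0n -muln2 mulnCA expnSr.
  by rewrite -add1n addnC modnMDl.
Qed.

(** For 2^m larger than the degree only the linear term survives the average. *)
Lemma poly_cauchy P (r M : R) : 0 < r ->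
  (forall x, normc x = r -> normc P.[x] <= M) -> normc (P^`()).[0] <= M / r.
Proof.
move=> r0 hP; have [Q [Qb Q1 Qc]] := rotation_average (size P).+1 hP.
have QX : Q = Q`_1 *: 'X.
  apply/polyP => j; rewrite coefZ coefX; case: (eqVneq j 1%N) => [->|j1]; first by rewrite mulr1.
  rewrite mulr0; apply/eqP; apply: contraT => /Qc[Pj hj].
  have jP : (j < size P)%N by rewrite ltnNge; apply: contra Pj => h; rewrite nth_default.
  have s2 : (size P < 2 ^ (size P).+1)%N by rewrite (ltn_trans (ltnSn _))// ltn_expl.
  move: hj; rewrite !modn_small ?(leq_ltn_trans jP)//; last exact: ltn_trans s2.
    by move=> h; rewrite h eqxx in j1.
  by rewrite -{1}(expn0 2) ltn_exp2l.
have dP : (P^`()).[0] = P`_1 by rewrite horner_coef0 coef_deriv.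
rewrite dP -Q1 ler_pdivlMr//.
have nr : normc (r%:C%C : C) = r by rewrite normc_real gtr0_norm.
by have := Qb r%:C%C nr; rewrite QX hornerZ hornerX normcM nr coefZ coefX mulr1.
Qed.

(** The real part of Q on the real axis, as a real polynomial, to which the real mean
    value theorem applies. *)
Definition repoly Q : {poly R} := \poly_(j < size Q) complex.Re Q`_j.

Lemma coef_repoly Q j : (repoly Q)`_j = complex.Re Q`_j.
Proof. by rewrite coef_poly; case: ltnP => // h; rewrite nth_default. Qed.

Lemma horner_repoly Q t : (repoly Q).[t] = complex.Re Q.[t%:C%C].
Proof.
rewrite (@horner_coef_wide _ (size Q)) ?size_poly// horner_coef Re_sum.
apply: eq_bigr => j _; rewrite coef_repoly -rmorphXn /= mulrC.
by rewrite -ReZ mulrC.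
Qed.

Lemma deriv_repoly Q : (repoly Q)^`() = repoly Q^`().
Proof.
apply/polyP => j; rewrite coef_deriv !coef_repoly coef_deriv.
by move: (Q`_j.+1) => q; move: j.+1; elim=> [|k IH]; rewrite ?mulr0n// !mulrS ReD IH.
Qed.

(** Rotate Q so that the increment is a positive real number, and apply the mean value
    theorem to its real part. *)
Lemma poly_mean_value Q (a b M : R) : a <= b ->
  (forall t, a <= t <= b -> normc (Q^`()).[t%:C%C] <= M) ->
  normc (Q.[b%:C%C] - Q.[a%:C%C]) <= M * (b - a).
Proof.
rewrite le_eqVlt => /predU1P[->|ab] hM; first by rewrite !subrr normc0 mulr0.
set z := _ - _; have [->|z0] := eqVneq z 0.
  rewrite normc0 mulr_ge0 ?subr_ge0 ?(ltW ab)//.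
  by apply: le_trans (normc_ge0 _) (hM a _); rewrite lexx ltW.
have nz : normc z != 0 by apply: contra_neq z0; exact: eq0_normc.
pose c := ((normc z)^-1)%:C%C * Num.conj z.
have nc : normc c = 1.
  by rewrite normcM normc_conj normc_real ger0_norm ?invr_ge0 ?normc_ge0// mulVf.
have cz : complex.Re (c * z) = normc z.
  by rewrite /c -mulrA (mulrC _ z) mul_conjc ReZ Re_rc expr2 mulKf.
have [t tab] := polyrcf.poly_mvt (repoly (c *: Q)) ab.
rewrite deriv_repoly !horner_repoly derivZ !hornerZ -ReN -ReD -mulrBr -/z cz => ->.
rewrite ler_wpM2r ?subr_ge0 ?(ltW ab)//; apply: le_trans (ler_norm _) _.
apply: le_trans (normc_Re _) _; rewrite normcM nc mul1r; apply: hM.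
by move: tab; rewrite in_itv /= => /andP[? ?]; rewrite !ltW.
Qed.

Lemma poly_bound_unit Q : exists2 L, 0 <= L & forall t : R, 0 <= t <= 1 -> normc Q.[t%:C%C] <= L.
Proof.
exists (\sum_(j < size Q) normc Q`_j) => [|t /andP[t0 t1]].
  by rewrite sumr_ge0// => j _; exact: normc_ge0.
rewrite horner_coef; apply: le_trans (normc_sum _ _ _) _; apply: ler_sum => j _.
rewrite normcM normcX normc_real ger0_norm// ler_piMr ?normc_ge0// exprn_ile1//.
Qed.

End OneVariable.

(** * The Gleason problem and null sequences *)

Section Gleason.
Context (R : realType) (d : nat).
Local Notation C := (R[i]).
Local Notation Cd := 'rV[C]_d.
Implicit Types (p q : mpoly.mpoly d C) (z w v : Cd).

Definition nsq z : R := \sum_(i < d) normc (z 0 i) ^+ 2.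

Lemma cdotzz z : cdot z z = (nsq z)%:C%C.
Proof. by rewrite /nsq rmorph_sum; apply: eq_bigr => i _; rewrite mul_conjc. Qed.
Lemma nsq_ge0 z : 0 <= nsq z.
Proof. by apply: sumr_ge0 => i _; exact: sqr_ge0. Qed.
Lemma unit_ballE z : unit_ball R d z <-> nsq z < 1.
Proof. by rewrite /unit_ball /= cdotzz -(rmorph1 (real_complex R)) ltcR. Qed.
Lemma unit_sphereE z : unit_sphere R d z <-> nsq z = 1.
Proof.
rewrite /unit_sphere /= cdotzz -(rmorph1 (real_complex R)); split => [|->//].
exact: complexI.
Qed.
Lemma closed_unit_ballE z : closed_unit_ball z <-> nsq z <= 1.
Proof. by rewrite /closed_unit_ball /= cdotzz -(rmorph1 (real_complex R)) lecR. Qed.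
Lemma nsqZ a z : nsq (a *: z) = normc a ^+ 2 * nsq z.
Proof.
rewrite /nsq mulr_sumr; apply: eq_bigr => i _.
by rewrite mxE normcM exprMn.
Qed.
Lemma nsqD z w : nsq (z + w) = nsq z + nsq w + 2 * complex.Re (cdot z w).
Proof.
rewrite /nsq /cdot Re_sum mulr_sumr -!big_split /=; apply: eq_bigr => i _.
rewrite mxE; case: (z 0 i) (w 0 i) => a b [x y] /=.
rewrite !sqr_sqrtr ?addr_ge0 ?sqr_ge0//; ring.
Qed.

Definition line p w v : {poly C} :=
  mpoly.mmap (polyC : C -> {poly C}) (fun i => (w 0 i)%:P + v 0 i *: 'X) p.

Lemma lineC c w v : line (mpoly.mpolyC d c) w v = c%:P.
Proof. exact: mpoly.mmapC. Qed.
Lemma lineX i w v : line (mpoly.mpolyX C (mpoly.mnm1 i)) w v = (w 0 i)%:P + v 0 i *: 'X.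
Proof. by rewrite /line mpoly.mmapX mpoly.mmap1U. Qed.
Lemma lineD p q w v : line (p + q) w v = line p w v + line q w v.
Proof. exact: (raddfD (mpoly.mmap (polyC : {rmorphism C -> {poly C}}) _)). Qed.
Lemma lineM p q w v : line (p * q) w v = line p w v * line q w v.
Proof. exact: (rmorphM (mpoly.mmap (polyC : {rmorphism C -> {poly C}}) _)). Qed.
Lemma lineZ c p w v : line (c *: p) w v = c *: line p w v.
Proof. by rewrite -mpoly.mul_mpolyC lineM lineC mul_polyC. Qed.

Lemma horner_line p w v t : (line p w v).[t] = poly_fun p (w + t *: v).
Proof.
elim/mpoly_gen_ind : p => [c|i|p q hp hq|p q hp hq].
- by rewrite lineC hornerC poly_funC.
- by rewrite lineX hornerD hornerC hornerZ hornerX poly_funX !mxE mulrC.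
- by rewrite lineD hornerD hp hq poly_funD.
- by rewrite lineM hornerM hp hq poly_funM.
Qed.

Definition dirder p w v : C := \sum_(i < d) v 0 i * poly_fun (mpoly.mderiv i p) w.

Lemma deriv_line p w v :
  (line p w v)^`() = \sum_(i < d) v 0 i *: line (mpoly.mderiv i p) w v.
Proof.
elim/mpoly_gen_ind : p => [c|i|p q hp hq|p q hp hq].
- rewrite lineC derivC big1// => i _.
  by rewrite mpoly.mderivC -(mpoly.mpolyC0 d C) lineC polyC0 scaler0.
- rewrite lineX derivD derivC add0r derivZ derivX (bigD1 i)//= big1 ?addr0.
    rewrite mpoly.mderivX mpoly.mnm1E eqxx scale1r.
    rewrite (_ : mpoly.mnm_sub _ _ = mpoly.mnm0); last first.
      by apply/mpoly.mnmP => j; rewrite mpoly.mnmBE subnn mpoly.mnm0E.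
    by rewrite mpoly.mpolyX0 -(mpoly.mpolyC1 d C) lineC.
  move=> j ji; rewrite mpoly.mderivX mpoly.mnm1E eq_sym (negbTE ji) scale0r.
  by rewrite -(mpoly.mpolyC0 d C) lineC polyC0 scaler0.
- rewrite lineD derivD hp hq -big_split; apply: eq_bigr => i _ /=.
  by rewrite mpoly.mderivD lineD scalerDr.
- rewrite lineM derivM hp hq mulr_suml mulr_sumr -big_split; apply: eq_bigr => i _ /=.
  by rewrite mpoly.mderivM lineD !lineM scalerDr scalerAl scalerAr.
Qed.

Lemma horner_deriv_line p w v t : ((line p w v)^`()).[t] = dirder p (w + t *: v) v.
Proof.
rewrite deriv_line horner_sum; apply: eq_bigr => i _.
by rewrite hornerZ horner_line.
Qed.

Lemma line_monomial m z : line (mpoly.mpolyX C m) 0 z =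
  (poly_fun (mpoly.mpolyX C m) z) *: 'X^(mpoly.mdeg m).
Proof.
rewrite /line mpoly.mmapX /mpoly.mmap1 /poly_fun mpoly.mevalX mpoly.mdegE.
elim/big_rec3 : _ => [|i a b e _ ->]; first by rewrite scale1r expr0.
rewrite mxE polyC0 add0r exprZn -scalerAl -scalerAr scalerA -exprD.
by rewrite mulrC.
Qed.

(** The solution g(z) = int_0^1 (d_i p)(t z) dt of the Gleason problem: t g(t z) is an
    antiderivative of the i-th partial derivative of p along rays. On monomials
    the integral is a division by the degree. *)
Lemma gleason_ex i p : exists q, forall z,
  ('X * line q 0 z)^`() = line (mpoly.mderiv i p) 0 z.
Proof.
elim/mpoly.mpolyind : p => [|c m p _ _ [q hq]].
  exists 0 => z; rewrite mpoly.mderiv0 -(mpoly.mpolyC0 d C) lineC polyC0 mulr0.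
  by rewrite deriv0.
exists ((c * (mpoly.fun_of_multinom m i)%:R / (mpoly.mdeg m)%:R) *:
   mpoly.mpolyX C (mpoly.mnm_sub m (mpoly.mnm1 i)) + q) => z.
rewrite lineD mulrDr derivD hq mpoly.mderivD lineD mpoly.mderivZ mpoly.mderivX.
rewrite !lineZ line_monomial -scalerAr derivZ -scalerAr derivZ -exprS derivXn.
congr (_ + _); have [m0|m0] := posnP (mpoly.fun_of_multinom m i).
  by rewrite m0 mulr0 mul0r !scale0r scaler0.
have im : mpoly.lem (mpoly.mnm1 i) m.
  by rewrite mpoly.lep1mP -lt0n.
have dm : mpoly.mdeg m = (mpoly.mdeg (mpoly.mnm_sub m (mpoly.mnm1 i))).+1.
  by rewrite -{1}(mpoly.submK im) mpoly.mdegD mpoly.mdeg1 addn1.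
rewrite /= -dm -['X^_ *+ _]scaler_nat !scalerA; congr (_ *: _).
have : (mpoly.mdeg m)%:R != 0 :> C by rewrite pnatr_eq0 dm.
move: (mpoly.mdeg m)%:R (poly_fun _ z) => b e b0.
by rewrite mulrAC divfK.
Qed.

End Gleason.

Section GleasonEstimates.
Context (R : realType) (d : nat).
Local Notation C := (R[i]).
Local Notation Cd := 'rV[C]_d.
Implicit Types (p q : mpoly.mpoly d C) (z w v : Cd) (K e s t : R) (i : 'I_d).

Definition bounded_by p K s := forall z, nsq z <= s -> normc (poly_fun p z) <= K.

Lemma dirder_cauchy p w v r K s : 0 < r ->
  (forall x, normc x = r -> nsq (w + x *: v) <= s) -> bounded_by p K s ->
  normc (dirder p w v) <= K / r.
Proof.
move=> r0 hr hp; have := @poly_cauchy _ (line p w v) r K r0.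
rewrite horner_deriv_line scale0r addr0; apply => x xr.
by rewrite horner_line; apply: hp; exact: hr.
Qed.

Definition gleason i p := projT1 (cid (gleason_ex i p)).

Lemma gleasonP i p z : ('X * line (gleason i p) 0 z)^`() = line (mpoly.mderiv i p) 0 z.
Proof. exact: (projT2 (cid (gleason_ex i p))). Qed.

Local Notation unitv i := (delta_mx 0 i : Cd).

Lemma dirder_unitv p w i : dirder p w (unitv i) = poly_fun (mpoly.mderiv i p) w.
Proof.
rewrite /dirder (bigD1 i)//= big1 ?addr0 ?mxE ?eqxx ?mul1r// => j ji.
by rewrite mxE eqxx (negbTE ji) mul0r.
Qed.

Lemma dirderB p w u v a : dirder p w (u - a *: v) = dirder p w u - a * dirder p w v.
Proof.
rewrite /dirder mulr_sumr -sumrB; apply: eq_bigr => j _.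
by rewrite !mxE mulrBl mulrA.
Qed.

Lemma coord_le_nsq z i : normc (z 0 i) ^+ 2 <= nsq z.
Proof. by rewrite /nsq (bigD1 i)//= lerDl sumr_ge0// => j _; exact: sqr_ge0. Qed.

Lemma nsq_unitv i : nsq (unitv i) = 1.
Proof.
rewrite /nsq (bigD1 i)//= big1 ?addr0; first by rewrite mxE !eqxx normc1 expr1n.
by move=> j ji; rewrite mxE eqxx (negbTE ji) mulr0n normc0 expr0n.
Qed.

Lemma cdot_unitv z i : cdot z (unitv i) = z 0 i.
Proof.
rewrite /cdot (bigD1 i)//= big1 ?addr0; first by rewrite mxE !eqxx conjC1 mulr1.
by move=> j ji; rewrite mxE eqxx (negbTE ji) mulr0n conjC0 mulr0.
Qed.

Lemma cdotC z w : cdot z w = Num.conj (cdot w z).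
Proof. by rewrite /cdot cnj_sum; apply: eq_bigr => j _; rewrite cnjM cnjK mulrC. Qed.

Lemma cdotZr z w a : cdot z (a *: w) = Num.conj a * cdot z w.
Proof. by rewrite /cdot mulr_sumr; apply: eq_bigr => j _; rewrite mxE cnjM; ring. Qed.

Lemma cdotZl z w a : cdot (a *: z) w = a * cdot z w.
Proof. by rewrite /cdot mulr_sumr; apply: eq_bigr => j _; rewrite mxE mulrA. Qed.

Lemma cdotBr z w v : cdot z (w - v) = cdot z w - cdot z v.
Proof.
rewrite /cdot -sumrB; apply: eq_bigr => j _.
by rewrite !mxE cnjD cnjN mulrDr mulrN.
Qed.

(** The component of the i-th coordinate vector tangent to the sphere at z. *)
Definition tangent i z : Cd := unitv i - Num.conj (z 0 i) *: z.

(** A tangential disc of radius r around t z only reaches the squared radius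
    t^2 + r^2. This gain over radial discs makes the integral of Cauchy's estimate
    along the ray converge. *)
Lemma nsq_tangent i z t x : nsq z = 1 -> nsq (t%:C%C *: z + x *: tangent i z) <= t ^+ 2 + normc x ^+ 2.
Proof.
move=> z1; have oz : cdot z (tangent i z) = 0.
  by rewrite cdotBr cdotZr cdot_unitv cdotzz z1 cnjK rmorph1 mulr1 subrr.
rewrite nsqD !nsqZ z1 mulr1 normc_real real_normK ?num_real// cdotZl cdotZr oz !mulr0 addr0.
rewrite lerD2l ler_piMr ?sqr_ge0// /tangent nsqD nsq_unitv -scaleNr nsqZ z1.
rewrite cdotZr cdotC cdot_unitv cnjN cnjK normcN normc_conj mulr1 mulNr mul_conjc ReN Re_rc.
by have := sqr_ge0 (normc (z 0 i)); lra.
Qed.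

Lemma nsq_shift i z t x : nsq z = 1 -> 0 <= t ->
  nsq (t%:C%C *: z + x *: unitv i) <= (t + normc x) ^+ 2.
Proof.
move=> z1 t0; rewrite nsqD !nsqZ z1 nsq_unitv !mulr1 normc_real real_normK ?num_real//.
rewrite cdotZl cdotZr cdot_unitv ReZ.
have h1 : normc (z 0 i) <= 1.
  by rewrite -(ler_pXn2r (n:=2))// ?nnegrE ?normc_ge0// expr1n -z1 coord_le_nsq.
have h2 : complex.Re (Num.conj x * z 0 i) <= normc x.
  apply: le_trans (ler_norm _) _; apply: le_trans (normc_Re _) _.
  by rewrite normcM normc_conj ler_piMr ?normc_ge0.
have := ler_wpM2l t0 h2; rewrite sqrrD; lra.
Qed.

Section Ray.
Context (i : 'I_d) (f : mpoly.mpoly d C) (z : Cd).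
Hypothesis z1 : nsq z = 1.
Let g := gleason i f.
Let Q := 'X * line g 0 z - (Num.conj (z 0 i)) *: line f 0 z.

Lemma ray_horner t : Q.[t%:C%C] = t%:C%C * poly_fun g (t%:C%C *: z) -
  Num.conj (z 0 i) * poly_fun f (t%:C%C *: z).
Proof. by rewrite hornerD hornerN hornerM hornerX hornerZ !horner_line !add0r. Qed.

Lemma ray_deriv t : (Q^`()).[t%:C%C] = dirder f (t%:C%C *: z) (tangent i z).
Proof.
rewrite derivB derivZ gleasonP hornerD hornerN hornerZ horner_line horner_deriv_line add0r.
by rewrite dirderB dirder_unitv.
Qed.

Let h k : R := 2^-1 ^+ k.
Let h_gt0 k : 0 < h k. Proof. by rewrite exprn_gt0// invr_gt0. Qed.
Let hS k : h k.+1 = h k / 2. Proof. by rewrite /h exprSr. Qed.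

(** Along a ray the error Q has derivative of size (1 - t)^(-1/2), by Cauchy's
    estimate in the tangential direction, so that its total variation is
    controlled by f on a smaller ball, up to a small contribution of a dyadic
    neighbourhood of the sphere. *)
Lemma ray_estimate K e k : 0 <= K -> 0 <= e ->
  bounded_by f K 1 -> bounded_by f e (1 - 3 / 4 * h k ^+ 2) ->
  forall t, 0 <= t <= 1 -> normc (Q.[t%:C%C] - Q.[0]) <= 2 * e / h k + 4 * K * h k.
Proof.
move=> K0 e0 fK fe.
(* up to 1 - h k ^+ 2 by the smallness of f, then in dyadic steps by its boundedness *)
have base t : 0 <= t <= 1 - h k ^+ 2 -> normc (Q.[t%:C%C] - Q.[0]) <= 2 * e / h k.
  move=> /andP[t0 tk]; have t1 : t <= 1 by rewrite (le_trans tk)// gerBl sqr_ge0.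
  have -> : 2 * e / h k = e / (h k / 2) by field; rewrite gt_eqF.
  rewrite -[in Q.[0]](rmorph0 (real_complex R)).
  apply: (@le_trans _ _ (e / (h k / 2) * (t - 0))).
    apply: poly_mean_value => // u /andP[u0 ut]; rewrite ray_deriv.
    apply: dirder_cauchy fe => [|x xr]; first by rewrite divr_gt0.
    apply: le_trans (nsq_tangent _ _ _ z1) _; rewrite xr.
    have : u ^+ 2 <= u by rewrite expr2 ler_piMr// (le_trans ut).
    rewrite expr_div_n; have -> : (2 : R) ^+ 2 = 4 by ring.
    lra.
  by rewrite subr0 ler_piMr// divr_ge0// divr_ge0// ltW.
have main m t : 0 <= t <= 1 - h (k + m) ^+ 2 ->
    normc (Q.[t%:C%C] - Q.[0]) <= 2 * e / h k + 4 * K * (h k - h (k + m)).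
  elim: m t => [|m IH] t.
    by rewrite addn0 => /base h1; rewrite subrr mulr0 addr0.
  have hh := h_gt0 (k + m).
  move=> /andP[t0 tm]; have [tk|tk] := lerP t (1 - h (k + m) ^+ 2).
    apply: le_trans (IH t _) _; first by rewrite t0.
    rewrite lerD2l ler_wpM2l ?mulr_ge0// lerD2l lerN2 addnS hS.
    lra.
  set u := 1 - h (k + m) ^+ 2 in tk *.
  have u0 : 0 <= u by rewrite subr_ge0 exprn_ile1 ?(ltW hh)// exprn_ile1// ?invr_ge0// invf_le1// ler1n.
  have := IH u; rewrite u0 lexx => /(_ isT) hu.
  have -> : Q.[t%:C%C] - Q.[0] = (Q.[t%:C%C] - Q.[u%:C%C]) + (Q.[u%:C%C] - Q.[0]).
    by rewrite addrA subrK.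
  apply: le_trans (le_normcD _ _) _.
  have tm' : t <= 1 - h (k + m) ^+ 2 / 4.
    move: tm; rewrite addnS hS expr_div_n; have -> : (2 : R) ^+ 2 = 4 by ring.
    by [].
  have : normc (Q.[t%:C%C] - Q.[u%:C%C]) <= K / (h (k + m) / 2) * (t - u).
    apply: poly_mean_value => [|x /andP[ux xt]]; first exact: ltW.
    rewrite ray_deriv; apply: dirder_cauchy fK => [|y yr]; first by rewrite divr_gt0.
    apply: le_trans (nsq_tangent _ _ _ z1) _; rewrite yr.
    have x0 : 0 <= x by exact: le_trans ux.
    have x1 : x <= 1 by rewrite (le_trans xt)// (le_trans tm')// gerBl divr_ge0 ?sqr_ge0.
    have : x ^+ 2 <= x by rewrite expr2 ler_piMr.
    rewrite expr_div_n; have -> : (2 : R) ^+ 2 = 4 by ring.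
    lra.
  have : K / (h (k + m) / 2) * (t - u) <= 4 * K * (h (k + m) - h (k + m).+1).
    rewrite hS; apply: (@le_trans _ _ (K / (h (k + m) / 2) * (h (k + m) ^+ 2))).
      rewrite ler_wpM2l ?divr_ge0//; first exact: ltW.
      have := sqr_ge0 (h (k + m)); rewrite /u; lra.
    rewrite le_eqVlt; apply/orP; left; apply/eqP; field; exact: lt0r_neq0.
  rewrite addnS; move: hu; move: (h (k + m).+1) (h (k + m)) (2 * e / h k) (h k) => x1 x2 x3 x4.
  by move: (K / _ * _) => x5; lra.
have lt1 t : 0 <= t < 1 -> normc (Q.[t%:C%C] - Q.[0]) <= 2 * e / h k + 4 * K * h k.
  move=> /andP[t0 t1].
  have [m hm] : exists m, h (k + m) ^+ 2 <= 1 - t.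
    have t1' : 0 < 1 - t by rewrite subr_gt0.
    have [m hm] := invS_lt t1'; exists m.
    apply: le_trans (ltW (hm m (leqnn m))).
    have h1 n : h n <= 1 by rewrite exprn_ile1// ?invr_ge0// invf_le1// ler1n.
    apply: (@le_trans _ _ (h m)).
      rewrite expr2 (@le_trans _ _ (h (k + m)))//; first by rewrite ler_piMr// ltW.
      by rewrite /h exprD ler_piMl ?exprn_ge0 ?invr_ge0.
    rewrite /h exprVn lef_pV2 ?posrE ?exprn_gt0 ?ltr0n//.
    by rewrite -natrX ler_nat ltn_expl.
  apply: le_trans (main m t _) _; first by rewrite t0 lerBrDl addrC -lerBrDl.
  by rewrite lerD2l ler_wpM2l ?mulr_ge0// gerBl ltW.
move=> t /andP[t0]; rewrite le_eqVlt => /predU1P[->|t1]; last by apply: lt1; rewrite t0.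
have [L L0 hL] := poly_bound_unit Q^`().
apply/ler_addgt0Pr => x x0.
pose u : R := 1 - x / (x + L + 1).
have D0 : 0 < x + L + 1 by rewrite ltr_wpDl// addr_ge0// ltW.
have u0 : 0 <= u by rewrite subr_ge0 ler_pdivrMr// mul1r -addrA lerDl addr_ge0.
have u1 : u < 1 by rewrite gtrBl divr_gt0.
have -> : Q.[1%:C%C] - Q.[0] = (Q.[u%:C%C] - Q.[0]) + (Q.[1%:C%C] - Q.[u%:C%C]).
  by rewrite [RHS]addrC addrA subrK.
apply: le_trans (le_normcD _ _) _; apply: lerD; first by apply: lt1; rewrite u0.
apply: (@le_trans _ _ (L * (1 - u))).
  apply: poly_mean_value => [|y /andP[uy y1]]; first exact: ltW.
  by apply: hL; rewrite y1 (le_trans u0).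
rewrite /u subKr mulrA ler_pdivrMr// mulrC ler_wpM2l ?(ltW x0)//.
by rewrite addrAC addrC lerDl addr_ge0// ltW.
Qed.

Lemma ray_small e s : 0 <= e -> 0 <= s < 1 -> bounded_by f e (((1 + s) / 2) ^+ 2) ->
  forall t, 0 < t <= s -> normc (poly_fun g (t%:C%C *: z)) <= e * (2 / (1 - s)).
Proof.
move=> e0 /andP[s0 s1] fe t /andP[t0 ts].
have := @poly_mean_value _ ('X * line g 0 z) 0 t (e * (2 / (1 - s))) (ltW t0).
rewrite !hornerM !hornerX rmorph0 mul0r subr0 horner_line add0r normcM normc_real gtr0_norm//.
rewrite subr0 [t * normc _]mulrC ler_pM2r//; apply => u /andP[u0 ut].
rewrite gleasonP horner_line add0r -dirder_unitv.
have -> : e * (2 / (1 - s)) = e / ((1 - s) / 2) by rewrite invf_div.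
apply: dirder_cauchy fe => [|x xr]; first by rewrite divr_gt0// subr_gt0.
apply: le_trans (nsq_shift _ _ z1 u0) _.
have us := le_trans ut ts.
by rewrite xr lerXn2r ?nnegrE//; lra.
Qed.

End Ray.

Lemma polar z : z != 0 -> exists t u, [/\ 0 < t, t ^+ 2 = nsq z, nsq u = 1 & z = t%:C%C *: u].
Proof.
move=> z0; have n0 : 0 < nsq z.
  rewrite lt_neqAle nsq_ge0 andbT eq_sym; apply: contra_neq z0 => h.
  apply/rowP => j; rewrite mxE; apply: eq0_normc; apply/eqP.
  by rewrite -sqrf_eq0 eq_le sqr_ge0 andbT -h coord_le_nsq.
have s0 : 0 < Num.sqrt (nsq z) by rewrite sqrtr_gt0.
exists (Num.sqrt (nsq z)), ((Num.sqrt (nsq z))^-1%:C%C *: z); split=> //.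
- by rewrite sqr_sqrtr// ltW.
- rewrite nsqZ normc_real ger0_norm ?invr_ge0 ?(ltW s0)// exprVn sqr_sqrtr ?(ltW n0)//.
  by rewrite mulVf// gt_eqF.
- by rewrite scalerA -rmorphM mulfV ?gt_eqF// rmorph1 scale1r.
Qed.

Lemma gleason_small i f e s : 0 <= e -> 0 <= s < 1 -> bounded_by f e (((1 + s) / 2) ^+ 2) ->
  bounded_by (gleason i f) (e * (2 / (1 - s))) (s ^+ 2).
Proof.
move=> e0 s01 fe z zs; have /andP[s0 s1] := s01.
have [->|z0] := eqVneq z 0.
  have : ('X * line (gleason i f) 0 0)^`().[0] = poly_fun (gleason i f) 0.
    by rewrite derivM derivX mul1r hornerD hornerM hornerX mul0r addr0 horner_line scaler0 addr0.
  move=> <-; rewrite gleasonP horner_line scaler0 addr0 -dirder_unitv.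
  have -> : e * (2 / (1 - s)) = e / ((1 - s) / 2) by rewrite invf_div.
  apply: dirder_cauchy fe => [|x xr]; first by rewrite divr_gt0// subr_gt0.
  by rewrite add0r nsqZ nsq_unitv mulr1 xr lerXn2r ?nnegrE//; lra.
have [t [u [t0 tz u1 ->]]] := polar z0.
apply: (ray_small i u1 e0 s01 fe); rewrite t0 /=.
by rewrite -(ler_pXn2r (n:=2))// ?nnegrE ?(ltW t0)// tz.
Qed.

Lemma gleason_bound i f K : 0 <= K -> bounded_by f K 1 -> bounded_by (gleason i f) (16 * K) 1.
Proof.
move=> K0 fK z z1; have [zs|zs] := leP (nsq z) (2^-1 ^+ 2).
  have fK' : bounded_by f K (((1 + 2^-1) / 2) ^+ 2).
    move=> w hw; apply: fK; apply: le_trans hw _; rewrite exprn_ile1//; lra.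
  have s01 : 0 <= (2^-1 : R) < 1 by lra.
  apply: le_trans (gleason_small i K0 s01 fK' zs) _.
  rewrite mulrC ler_wpM2r//.
  have -> : (2 : R) / (1 - 2^-1) = 4 by field.
  by lra.
(* away from the origin, the ray estimate is divided by t > 1/2 *)
have z0 : z != 0.
  apply: contraTneq zs => ->; rewrite -leNgt /nsq big1 ?sqr_ge0// => j _.
  by rewrite mxE normc0 expr0n.
have [t [u [t0 tz u1 zE]]] := polar z0.
have t1 : t <= 1 by rewrite -(ler_pXn2r (n:=2))// ?nnegrE ?(ltW t0)// tz expr1n.
have ht : 2^-1 < t by rewrite -(ltr_pXn2r (n:=2))// ?nnegrE ?(ltW t0) ?invr_ge0// tz.
have fK' : bounded_by f K (1 - 3 / 4 * (2^-1 ^+ 0) ^+ 2).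
  by move=> w hw; apply: fK; apply: le_trans hw _; rewrite expr0 expr1n; lra.
have := ray_estimate i u1 K0 K0 fK fK' (t := t); rewrite (ltW t0) t1 => /(_ isT).
rewrite expr0 !mulr1 divr1 -[in X in _ - X](rmorph0 (real_complex R)) !ray_horner.
rewrite rmorph0 mul0r sub0r opprK scale0r -zE.
set G := _ * poly_fun (gleason i f) z; set F := _ * poly_fun f z; set F0 := _ * poly_fun f 0.
have u_i : normc (u 0 i) <= 1.
  by rewrite -(ler_pXn2r (n:=2))// ?nnegrE ?normc_ge0// expr1n -u1 coord_le_nsq.
have bF w : nsq w <= 1 -> normc (Num.conj (u 0 i) * poly_fun f w) <= K.
  move=> w1; rewrite normcM normc_conj; apply: le_trans (fK _ w1).
  by rewrite ler_piMl ?normc_ge0.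
have hF : normc F <= K by exact: bF.
have hF0 : normc F0 <= K.
  by apply: bF; rewrite /nsq big1// => j _; rewrite mxE normc0 expr0n.
have GE : G = (G - F + F0) + (F - F0) by ring.
have nG : normc G = t * normc (poly_fun (gleason i f) z) by rewrite normcM normc_real gtr0_norm.
have := le_normcD (G - F + F0) (F - F0); rewrite -GE nG.
have := le_normcD F (- F0); rewrite normcN => h1 h2 h3.
have h4 : t * normc (poly_fun (gleason i f) z) <= 8 * K by lra.
have := normc_ge0 (poly_fun (gleason i f) z); move: (normc _) h4 => x h4 x0.
have : 2^-1 * x <= t * x by rewrite ler_wpM2r// ltW.
by lra.
Qed.

(** The ray estimate at t = 1 compares g with conj z_i f, since Q(0) is small. *)
Lemma gleason_sphere i f K e k z : 0 <= K -> 0 <= e -> bounded_by f K 1 ->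
  bounded_by f e (1 - 3 / 4 * (2^-1 ^+ k) ^+ 2) -> nsq z = 1 ->
  normc (poly_fun (gleason i f) z - Num.conj (z 0 i) * poly_fun f z) <=
    e + 2 * e / 2^-1 ^+ k + 4 * K * 2^-1 ^+ k.
Proof.
move=> K0 e0 fK fe z1.
have := ray_estimate i z1 K0 e0 fK fe (t := 1); rewrite lexx ler01 => /(_ isT).
rewrite -[in X in _ - X](rmorph0 (real_complex R)) !ray_horner.
rewrite rmorph0 rmorph1 mul0r sub0r opprK scale0r scale1r mul1r.
set G := poly_fun (gleason i f) z - _; set F0 := _ * poly_fun f 0.
have u_i : normc (z 0 i) <= 1.
  by rewrite -(ler_pXn2r (n:=2))// ?nnegrE ?normc_ge0// expr1n -z1 coord_le_nsq.
have hF0 : normc F0 <= e.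
  rewrite normcM normc_conj; apply: (@le_trans _ _ (normc (poly_fun f 0))).
    by rewrite ler_piMl ?normc_ge0.
  apply: fe; rewrite /nsq big1 => [|j _]; last by rewrite mxE normc0 expr0n.
  have : (2^-1 ^+ k) ^+ 2 <= (1 : R).
    by rewrite exprn_ile1// ?exprn_ge0// exprn_ile1//; lra.
  by lra.
have := le_normcD (G + F0) (- F0); rewrite addrK normcN.
lra.
Qed.

End GleasonEstimates.

Section NullSequences.
Context (R : realType) (d : nat).
Local Notation C := (R[i]).
Local Notation Cd := 'rV[C]_d.
Implicit Types (f g : nat -> mpoly.mpoly d C) (psi : Cd -> C).

(** Bounded, locally uniform convergence to 0 on the ball. *)
Definition nullseq f := (exists2 K, 0 <= K & forall n, bounded_by (f n) K 1) /\
  forall s, s < 1 -> forall e : R, 0 < e -> exists n0, forall n, (n0 <= n)%N -> bounded_by (f n) e s.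

(** Although psi is not holomorphic, [psi f] is asymptotic on the sphere to a null
    sequence of polynomials whenever [f] is null. Shiftable functions form an
    algebra. *)
Definition shiftable psi := (exists M : R, forall z, nsq z = 1 -> normc (psi z) <= M) /\
  forall f, nullseq f -> exists2 g, nullseq g & forall e : R, 0 < e ->
    exists n0, forall n, (n0 <= n)%N -> forall z, nsq z = 1 ->
      normc (poly_fun (g n) z - psi z * poly_fun (f n) z) <= e.

Lemma nullseqM p f : nullseq f -> nullseq (fun n => p * f n).
Proof.
have [M M0 hM] : exists2 M, 0 <= M & bounded_by p M 1.
  elim/mpoly_gen_ind : p => [c|i|p q [M M0 hM] [M' M0' hM']|p q [M M0 hM] [M' M0' hM']].
  - by exists (normc c) => [|z _]; rewrite ?normc_ge0// poly_funC.
  - exists 1 => // z z1; rewrite poly_funX -(ler_pXn2r (n:=2))// ?nnegrE ?normc_ge0//.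
    by rewrite expr1n (le_trans (coord_le_nsq _ _)).
  - exists (M + M') => [|z z1]; first exact: addr_ge0.
    by rewrite poly_funD (le_trans (le_normcD _ _))// lerD ?hM ?hM'.
  - exists (M * M') => [|z z1]; first exact: mulr_ge0.
    by rewrite poly_funM normcM ler_pM ?normc_ge0 ?hM ?hM'.
move=> [[K K0 hK] hn]; split.
  exists (M * K) => [|n z z1]; first exact: mulr_ge0.
  by rewrite poly_funM normcM ler_pM ?normc_ge0 ?hM ?hK.
move=> s s1 e e0.
have e1 : 0 < e / (M + 1) by rewrite divr_gt0// ltr_wpDl.
have [n0 hn0] := hn s s1 _ e1; exists n0 => n nn z zs.
rewrite poly_funM normcM; apply: (@le_trans _ _ (M * (e / (M + 1)))).
  by rewrite ler_pM ?normc_ge0 ?(hM z) ?(hn0 n nn z)// (le_trans zs)// ltW.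
by rewrite mulrCA ger_pMr// ler_pdivrMr ?ltr_wpDl// mul1r lerDl.
Qed.

Lemma nullseqD f g : nullseq f -> nullseq g -> nullseq (fun n => f n + g n).
Proof.
move=> [[K K0 hK] hn] [[K' K0' hK'] hn']; split.
  exists (K + K') => [|n z z1]; first exact: addr_ge0.
  by rewrite poly_funD (le_trans (le_normcD _ _))// lerD ?hK ?hK'.
move=> s s1 e e0; have e2 : 0 < e / 2 by rewrite divr_gt0.
have [n0 hn0] := hn s s1 _ e2; have [n1 hn1] := hn' s s1 _ e2.
exists (maxn n0 n1) => n; rewrite geq_max => /andP[nn0 nn1] z zs.
rewrite poly_funD (le_trans (le_normcD _ _))// [e]splitr lerD//.
  exact: hn0.
exact: hn1.
Qed.

Lemma shiftableC c : shiftable (fun=> c).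
Proof.
split; first by exists (normc c).
move=> f nf; exists (fun n => mpoly.mpolyC d c * f n); first exact: nullseqM.
by move=> e e0; exists 0%N => n _ z _; rewrite poly_funM poly_funC subrr normc0 ltW.
Qed.

Lemma coord_sphere i (z : Cd) : nsq z = 1 -> normc (z 0 i) <= 1.
Proof.
by move=> z1; rewrite -(ler_pXn2r (n:=2))// ?nnegrE ?normc_ge0// expr1n -z1 coord_le_nsq.
Qed.

Lemma shiftableX i : shiftable (fun z => z 0 i).
Proof.
split; first by exists 1 => z; exact: coord_sphere.
move=> f nf; exists (fun n => mpoly.mpolyX C (mpoly.mnm1 i) * f n); first exact: nullseqM.
by move=> e e0; exists 0%N => n _ z _; rewrite poly_funM poly_funX subrr normc0 ltW.
Qed.

(** The solution g of the Gleason problem for f is asymptotic to conj z_i f: the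
    integer k makes the contribution of the dyadic layer small, and then f is small
    inside that layer. *)
Lemma shiftable_conjX i : shiftable (fun z => Num.conj (z 0 i)).
Proof.
split; first by exists 1 => z z1; rewrite normc_conj coord_sphere.
move=> f [[K K0 hK] hn]; exists (fun n => gleason i (f n)).
  split; first by exists (16 * K) => [|n]; [rewrite mulr_ge0|exact: gleason_bound].
  move=> s s1 e e0.
  pose s' := Num.sqrt (Num.max s 0).
  have s01 : 0 <= s' < 1.
    rewrite sqrtr_ge0 /= -[ltRHS]sqrtr1 ltr_sqrt// gt_max s1; exact: ltr01.
  have ss : s <= s' ^+ 2 by rewrite sqr_sqrtr ?le_max ?lexx ?orbT.
  have /andP[s0 s1'] := s01.
  have s2 : ((1 + s') / 2) ^+ 2 < 1 by rewrite exprn_ilt1//; lra.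
  have e1 : 0 < e * ((1 - s') / 2) by rewrite mulr_gt0// divr_gt0// subr_gt0.
  have [n0 hn0] := hn _ s2 _ e1; exists n0 => n nn z zs.
  have := gleason_small i (ltW e1) s01 (hn0 n nn) (le_trans zs ss).
  rewrite -mulrA (_ : (1 - s') / 2 * (2 / (1 - s')) = 1) ?mulr1//.
  by field; rewrite subr_eq0 gt_eqF.
move=> e e0.
have K1 : 0 < 8 * K + 1 by rewrite ltr_wpDl// mulr_ge0.
have [k hk] := invS_lt (divr_gt0 e0 K1).
pose h : R := 2^-1 ^+ k.
have h0 : 0 < h by rewrite exprn_gt0// invr_gt0.
have hle : h <= e / (8 * K + 1).
  apply: le_trans (ltW (hk k (leqnn k))).
  rewrite /h exprVn lef_pV2 ?posrE ?exprn_gt0 ?ltr0n//.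
  by rewrite -natrX ler_nat ltn_expl.
have e1 : 0 < e / 2 / (1 + 2 / h) by rewrite !divr_gt0// ltr_pwDl// divr_ge0// ltW.
have s1 : 1 - 3 / 4 * h ^+ 2 < 1 by rewrite gtrBl mulr_gt0// exprn_gt0.
have [n0 hn0] := hn _ s1 _ e1; exists n0 => n nn z z1.
apply: le_trans (gleason_sphere i K0 (ltW e1) (hK n) (hn0 n nn) z1) _.
rewrite -/h; set x := e / 2 / _.
have -> : x + 2 * x / h = e / 2.
  by rewrite /x; field; rewrite gt_eqF// gt_eqF// addr_gt0.
have : 4 * K * h <= e / 2.
  apply: (@le_trans _ _ (4 * K * (e / (8 * K + 1)))).
    by rewrite ler_wpM2l// mulr_ge0.
  rewrite mulrA ler_pdivrMr//; nra.
by lra.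
Qed.

Lemma shiftableD psi phi : shiftable psi -> shiftable phi -> shiftable (fun z => psi z + phi z).
Proof.
move=> [[M hM] h] [[M' hM'] h']; split.
  by exists (M + M') => z z1; rewrite (le_trans (le_normcD _ _))// lerD ?hM ?hM'.
move=> f nf; have [g ng hg] := h f nf; have [g' ng' hg'] := h' f nf.
exists (fun n => g n + g' n); first exact: nullseqD.
move=> e e0; have e2 : 0 < e / 2 by rewrite divr_gt0.
have [n0 hn0] := hg _ e2; have [n1 hn1] := hg' _ e2.
exists (maxn n0 n1) => n; rewrite geq_max => /andP[nn0 nn1] z z1.
rewrite poly_funD mulrDl opprD addrACA (le_trans (le_normcD _ _))// [e]splitr lerD//.
  exact: hn0.
exact: hn1.
Qed.

Lemma shiftableM psi phi : shiftable psi -> shiftable phi -> shiftable (fun z => psi z * phi z).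
Proof.
move=> [[M hM] h] [[M' hM'] h']; split.
  exists (`|M| * `|M'|) => z z1; rewrite normcM ler_pM ?normc_ge0//.
    by rewrite (le_trans (hM _ z1))// ler_norm.
  by rewrite (le_trans (hM' _ z1))// ler_norm.
move=> f nf; have [g' ng' hg'] := h' f nf; have [g ng hg] := h g' ng'.
exists g => // e e0; have e2 : 0 < e / 2 by rewrite divr_gt0.
have M1 : 0 < `|M| + 1 by rewrite ltr_wpDl.
have [n0 hn0] := hg _ e2; have [n1 hn1] := hg' _ (divr_gt0 e2 M1).
exists (maxn n0 n1) => n; rewrite geq_max => /andP[nn0 nn1] z z1.
have -> : poly_fun (g n) z - psi z * phi z * poly_fun (f n) z =
  (poly_fun (g n) z - psi z * poly_fun (g' n) z) +
  psi z * (poly_fun (g' n) z - phi z * poly_fun (f n) z) by ring.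
rewrite (le_trans (le_normcD _ _))// [e]splitr lerD//; first exact: hn0.
rewrite normcM; apply: (@le_trans _ _ (`|M| * (e / 2 / (`|M| + 1)))).
  by rewrite ler_pM ?normc_ge0// ?(hn1 n nn1 z z1)// (le_trans (hM _ z1))// ler_norm.
by rewrite mulrCA ger_pMr// ler_pdivrMr// mul1r lerDl.
Qed.

End NullSequences.

(** * Integrals of bounded functions *)

Section BoundedIntegrals.
Context (R : realType) (dd : measure_display) (T : measurableType dd).
Context (S : set T) (mS : measurable S).
Implicit Types (g h : T -> R) (m : {finite_measure set T -> \bar R}).

(** Bounds are only asked on S, which will carry the measures, as polynomials are
    unbounded on the whole space. *)
Definition bounded_mfun g := measurable_fun setT g /\ exists M : R, forall z, S z -> `|g z| <= M.

Lemma bounded_mfunD g h : bounded_mfun g -> bounded_mfun h -> bounded_mfun (fun z => g z + h z).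
Proof.
move=> [mg [M hM]] [mh [M' hM']]; split; first exact: measurable_funD.
by exists (M + M') => z Sz; rewrite (le_trans (ler_normD _ _))// lerD ?hM ?hM'.
Qed.

Lemma bounded_mfunM g h : bounded_mfun g -> bounded_mfun h -> bounded_mfun (fun z => g z * h z).
Proof.
move=> [mg [M hM]] [mh [M' hM']]; split; first exact: measurable_funM.
by exists (M * M') => z Sz; rewrite normrM ler_pM ?hM ?hM'.
Qed.

Lemma bounded_mfun_cst (c : R) : bounded_mfun (fun=> c).
Proof. by split; [exact: measurable_cst|exists `|c|]. Qed.

Lemma bounded_mfunB g h : bounded_mfun g -> bounded_mfun h -> bounded_mfun (fun z => g z - h z).
Proof.
move=> hg hh; have := bounded_mfunD hg (bounded_mfunM (bounded_mfun_cst (-1)) hh).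
by congr bounded_mfun; apply/funext => z; rewrite mulN1r.
Qed.

Lemma bounded_mfun_norm g : bounded_mfun g -> bounded_mfun (fun z => `|g z|).
Proof.
move=> [mg [M hM]]; split; first exact: measurableT_comp.
by exists M => z Sz; rewrite normr_id hM.
Qed.

Lemma bounded_mfun_indic (A : set T) : measurable A -> bounded_mfun (\1_A).
Proof.
move=> mA; split; first exact: measurable_indic.
by exists 1 => z _; rewrite indicE; case: (_ \in _); rewrite ?normr1 ?normr0.
Qed.

Lemma bounded_mfun_integrable m g : bounded_mfun g -> m.-integrable S (EFin \o g).
Proof.
move=> [mg [M hM]]; apply: measurable_bounded_integrable => //.
- by rewrite ltey_eq fin_num_measure.
- exact: measurable_funTS.
- exists M; split; first exact: num_real.
  by move=> x Mx z Sz; exact: le_trans (hM z Sz) (ltW Mx).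
Qed.

(** Integration over S against a finite family of measures, as a positive
    functional on bounded functions. *)
Definition total_integral (I : finType) (ms : I -> {finite_measure set T -> \bar R}) g : R :=
  \sum_i Rintegral (ms i) S g.

Variables (I : finType) (ms : I -> {finite_measure set T -> \bar R}).
Local Notation K := (total_integral ms).

Lemma total_integralD g h : bounded_mfun g -> bounded_mfun h ->
  K (fun z => g z + h z) = K g + K h.
Proof.
move=> bg bh; rewrite /total_integral -big_split; apply: eq_bigr => m _ /=.
by apply: RintegralD => //; exact: bounded_mfun_integrable.
Qed.

Lemma total_integralZ c g : bounded_mfun g -> K (fun z => c * g z) = c * K g.
Proof.
move=> bg; rewrite /total_integral mulr_sumr; apply: eq_bigr => m _ /=.
by apply: RintegralZl => //; exact: bounded_mfun_integrable.
Qed.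

Lemma total_integral_le g h : bounded_mfun g -> bounded_mfun h ->
  (forall z, S z -> g z <= h z) -> K g <= K h.
Proof.
move=> bg bh gh; apply: ler_sum => m _.
by apply: le_Rintegral => //; exact: bounded_mfun_integrable.
Qed.

Lemma total_integral_ge0 g : (forall z, S z -> 0 <= g z) -> 0 <= K g.
Proof. by move=> g0; apply: sumr_ge0 => m _; exact: Rintegral_ge0. Qed.

Lemma total_integral_cst c : K (fun=> c) = c * K (fun=> 1).
Proof.
rewrite /total_integral mulr_sumr; apply: eq_bigr => m _.
by rewrite !Rintegral_cst// mul1r.
Qed.

Lemma total_integral_cvg (g : nat -> T -> R) h (M : R) :
  (forall n, measurable_fun setT (g n)) -> measurable_fun setT h ->
  (forall n z, S z -> `|g n z| <= M) ->
  (forall z, S z -> g n z @[n --> \oo] --> h z) ->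
  K (g n) @[n --> \oo] --> K h.
Proof.
move=> mg mh gM gh; apply: cvg_finite_sum => m.
have hM z : S z -> `|h z| <= M.
  move=> Sz; have hc : `|g n z| @[n --> \oo] --> `|h z| by apply: cvg_norm; exact: gh.
  rewrite -(cvg_lim _ hc)//; apply: limr_le; first by apply/cvg_ex; exists `|h z|.
  by apply: nearW => n; exact: gM.
have bh : bounded_mfun h by split=> //; exists M.
apply: fine_cvg; rewrite fineK; last first.
  by apply: integrable_fin_num => //; exact: bounded_mfun_integrable.
apply: (@dominated_cvg _ _ _ (ms m) S mS (fun n => EFin \o g n) (EFin \o h) (fun=> M%:E)).
- by move=> n; apply/measurable_EFinP; exact: measurable_funTS.
- by move=> z Sz; apply: cvg_EFin; [exact: nearW|exact: gh].
- by [].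
- have := bounded_mfun_integrable (ms m) (bounded_mfun_cst M); exact.
- by move=> n z Sz; rewrite lee_fin gM.
Qed.

End BoundedIntegrals.

(** * Approximation of indicator functions on the sphere *)

Section StepPolynomials.
Context (R : realType).
Implicit Types (x y : R).

Lemma bernoulli x k : -1 <= x -> 1 + k%:R * x <= (1 + x) ^+ k.
Proof.
move=> x1; elim: k => [|k IH]; first by rewrite mul0r addr0 expr0.
rewrite exprS; apply: (@le_trans _ _ ((1 + x) * (1 + k%:R * x))).
  rewrite -natr1; have := mulr_ge0 (ler0n R k) (sqr_ge0 x).
  rewrite expr2; move: (k%:R) => n; nra.
by rewrite ler_wpM2l//; lra.
Qed.

(** Polynomials with values in [0, 1] on [0, 1] that tend pointwise to the
    indicator function of y > 1/2: the inner exponents separate y > 1/2 from y <= 1/2, and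
    the outer power settles the limit at y = 1/2. The bounds come from
    Bernoulli's inequality. *)
Definition step m y := (1 - (1 - y ^+ (m ^ 2)) ^+ (2 ^ (m ^ 2))) ^+ m.

Lemma step_itv m y : 0 <= y <= 1 -> 0 <= step m y <= 1.
Proof.
move=> /andP[y0 y1].
have h1 : 0 <= y ^+ (m ^ 2) <= 1 by rewrite exprn_ge0// exprn_ile1.
set u := y ^+ _ in h1 *; have /andP[u0 u1] := h1.
have h2 : 0 <= (1 - u) ^+ (2 ^ (m ^ 2)) <= 1.
  by rewrite exprn_ge0 ?exprn_ile1//; lra.
rewrite /step -/u; set v := (1 - u) ^+ _ in h2 *; have /andP[v0 v1] := h2.
by rewrite exprn_ge0 ?exprn_ile1//; lra.
Qed.

Lemma step_low m y : 0 <= y <= 2^-1 -> (0 < m)%N -> step m y <= (3 / 4) ^+ m.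
Proof.
move=> /andP[y0 y1] m0; rewrite /step.
have : (0 < m ^ 2)%N by rewrite expn_gt0 m0.
case: (m ^ 2)%N => // n _.
set u := y ^+ n.+1.
have u0 : 0 <= u by rewrite exprn_ge0.
have hu : 2 ^+ n * u <= 2^-1.
  have -> : 2 ^+ n * u = (2 * y) ^+ n.+1 / 2 by rewrite exprMn exprS /u; field.
  by rewrite ler_piMl// ?exprn_ile1//; lra.
have u1 : u <= 1.
  by rewrite exprn_ile1//; lra.
have hb : 1 - 2 ^+ n * u <= (1 - u) ^+ (2 ^ n).
  have := @bernoulli (- u) (2 ^ n)%N; rewrite natrX mulrN; apply; lra.
have hb2 : 1 / 4 <= (1 - u) ^+ (2 ^ n.+1).
  rewrite expnSr exprM -[1 / 4](_ : (2^-1 : R) ^+ 2 = _); last by field.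
  by rewrite lerXn2r// ?nnegrE ?exprn_ge0//; lra.
have hv : (1 - u) ^+ (2 ^ n.+1) <= 1 by rewrite exprn_ile1//; lra.
by rewrite lerXn2r// ?nnegrE; lra.
Qed.

Lemma step_high m y : 2^-1 < y <= 1 -> (0 < m)%N -> 1 - (m%:R * (2 * y - 1))^-1 <= step m y.
Proof.
move=> /andP[y0 y1] m0; rewrite /step.
set n := (m ^ 2)%N; set u := y ^+ n.
have u0 : 0 <= u by rewrite exprn_ge0//; lra.
have u1 : u <= 1 by rewrite exprn_ile1//; lra.
set b := (1 - u) ^+ (2 ^ n).
have b0 : 0 <= b by rewrite exprn_ge0//; lra.
have b1 : b <= 1 by rewrite exprn_ile1//; lra.
have mp : 0 < m%:R :> R by rewrite ltr0n.
have hp : 0 < 2 * y - 1 by lra.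
have h1 : b * (1 + (2 ^ n)%:R * u) <= 1.
  apply: (@le_trans _ _ (b * (1 + u) ^+ (2 ^ n))).
    by rewrite ler_wpM2l// bernoulli//; lra.
  rewrite -exprMn exprn_ile1//; first by rewrite mulr_ge0//; lra.
  by have := sqr_ge0 u; nra.
have h2 : 1 + n%:R * (2 * y - 1) <= 2 ^+ n * u.
  rewrite -exprMn; have := @bernoulli (2 * y - 1) n.
  by rewrite addrCA subrr addr0; apply; lra.
have h3 : b * (n%:R * (2 * y - 1)) <= 1.
  apply: le_trans h1; rewrite ler_wpM2l// natrX; lra.
have h4 : m%:R * b <= (m%:R * (2 * y - 1))^-1.
  rewrite -[leRHS]mul1r ler_pdivlMr ?mulr_gt0//; move: h3.
  by rewrite /n natrX expr2; congr (_ <= _); ring.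
apply: (@le_trans _ _ (1 - m%:R * b)); first by rewrite lerD2l lerN2.
have := @bernoulli (- b) m; rewrite mulrN; apply; lra.
Qed.

Lemma step_cvg y : 0 <= y <= 1 -> step m y @[m --> \oo] --> ((2^-1 < y)%R%:R : R).
Proof.
move=> /andP[y0 y1]; have [yl|yl] := ltP 2^-1 y; last first.
  rewrite -(cvg_shiftS (fun m => step m y)) /=.
  have h : (3 / 4 : R) ^+ m.+1 @[m --> \oo] --> (0 : R).
    rewrite (cvg_shiftS (fun m => (3 / 4 : R) ^+ m)); apply: cvg_expr.
    by rewrite ger0_norm; lra.
  apply: squeeze_cvgr (cvg_cst 0) h; apply: nearW => m.
  have yy : 0 <= y <= 1 by rewrite y0.
  have /andP[-> _] := step_itv m.+1 yy.
  by rewrite step_low// y0.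
apply/cvgrPdist_le => e e0.
have hp : 0 < 2 * y - 1 by lra.
have [K hK] := invS_lt (mulr_gt0 e0 hp).
exists K.+1 => // -[//|m] /= Km.
have yy : 0 <= y <= 1 by rewrite y0.
have yy' : 2^-1 < y <= 1 by rewrite yl.
have /andP[s0 s1] := step_itv m.+1 yy; have := step_high yy' (ltn0Sn m).
have := hK m Km; rewrite invfM mulr1n ger0_norm ?subr_ge0// => h1.
have : m.+1%:R^-1 * (2 * y - 1)^-1 < e by rewrite ltr_pdivrMr.
by move: (_ / _) (step _ _) => x s; lra.
Qed.

End StepPolynomials.

Section Borel.
Context (R : realType) (d : nat).
Local Notation C := (R[i]).
Local Notation Cd := 'rV[C]_d.
Local Notation T := (Borel R d).

Lemma continuous_measurable_Borel (f : Cd -> R) : continuous f ->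
  measurable_fun setT (f : T -> R).
Proof.
move=> cf; apply: (measurability _ (RGenOInfty.measurableE R)) => //.
move=> /= _ [_ [a ->] <-]; rewrite setTI; apply: sub_sigma_algebra => /=.
by have /continuousP := cf; apply; exact: interval_open.
Qed.

Lemma open_measurable_Borel (U : set Cd) : open U -> measurable (U : set T).
Proof. by move=> oU; exact: sub_sigma_algebra. Qed.

Lemma closed_measurable_Borel (U : set Cd) : closed U -> measurable (U : set T).
Proof.
move=> cU; rewrite -(setCK U); apply: measurableC; apply: open_measurable_Borel.
exact: closed_openC.
Qed.

Lemma continuous_coord i : continuous (fun z : Cd => z 0 i).
Proof. exact: coord_continuous. Qed.

Lemma continuous_Re i : continuous (fun z : Cd => complex.Re (z 0 i)).
Proof. by move=> z; exact: (cvgRe _ (@continuous_coord i z)). Qed.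

Lemma continuous_Im i : continuous (fun z : Cd => complex.Im (z 0 i)).
Proof. by move=> z; exact: (cvgIm _ (@continuous_coord i z)). Qed.

Lemma continuous_nsq (w : Cd) : continuous (fun z : Cd => nsq (z - w)).
Proof.
move=> z; have FF : Filter (nbhs z) := @nbhs_filter Cd z.
apply: cvg_finite_sum => i.
under eq_fun do rewrite sqr_normc_ReIm !mxE ReD ImD !expr2.
rewrite sqr_normc_ReIm !mxE ReD ImD !expr2.
have hr : (fun x : Cd => complex.Re (x 0 i) + complex.Re (- w 0 i)) @ z -->
    complex.Re (z 0 i) + complex.Re (- w 0 i).
  exact: (cvgD (@continuous_Re i z) (cvg_cst _)).
have hi : (fun x : Cd => complex.Im (x 0 i) + complex.Im (- w 0 i)) @ z -->
    complex.Im (z 0 i) + complex.Im (- w 0 i).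
  exact: (cvgD (@continuous_Im i z) (cvg_cst _)).
exact: (cvgD (cvgM hr hr) (cvgM hi hi)).
Qed.

Lemma sphere_measurable : measurable (unit_sphere R d : set T).
Proof.
rewrite (_ : unit_sphere R d = (fun z : T => nsq (z - 0)) @^-1` [set 1]).
  have := continuous_measurable_Borel (@continuous_nsq 0) measurableT (@measurable_set1 _ (1 : R)).
  by rewrite setTI.
by apply/seteqP; split => z /=; rewrite subr0 => /unit_sphereE.
Qed.

(** Continuity makes these functions liftable to A(H), and shiftability lets them
    multiply null sequences. *)
Definition real_shiftable (psi : T -> R) :=
  (shiftable (fun z : Cd => (psi z)%:C%C) /\ continuous (psi : Cd -> R)) /\
  bounded_mfun (unit_sphere R d : set T) psi.

Lemma real_shiftable_cst c : real_shiftable (fun=> c).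
Proof.
by split; [split; [exact: shiftableC|exact: cst_continuous]|exact: bounded_mfun_cst].
Qed.

Lemma real_shiftableD f g : real_shiftable f -> real_shiftable g ->
  real_shiftable (fun z => f z + g z).
Proof.
move=> [[sf cf] bf] [[sg cg] bg]; split; last exact: bounded_mfunD.
split.
  rewrite (_ : (fun z => _) = fun z : Cd => (f z)%:C%C + (g z)%:C%C); first exact: shiftableD.
  by apply/funext => z; rewrite rmorphD.
move=> z; have FF : Filter (nbhs z) := @nbhs_filter Cd z.
by apply: cvgD; [exact: cf|exact: cg].
Qed.

Lemma real_shiftableM f g : real_shiftable f -> real_shiftable g ->
  real_shiftable (fun z => f z * g z).
Proof.
move=> [[sf cf] bf] [[sg cg] bg]; split; last exact: bounded_mfunM.
split.
  rewrite (_ : (fun z => _) = fun z : Cd => (f z)%:C%C * (g z)%:C%C); first exact: shiftableM.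
  by apply/funext => z; rewrite rmorphM.
move=> z; have FF : Filter (nbhs z) := @nbhs_filter Cd z.
by apply: cvgM; [exact: cf|exact: cg].
Qed.

Lemma real_shiftableB f g : real_shiftable f -> real_shiftable g ->
  real_shiftable (fun z => f z - g z).
Proof.
move=> hf hg; have := real_shiftableD hf (real_shiftableM (real_shiftable_cst (-1)) hg).
by congr real_shiftable; apply/funext => z; rewrite mulN1r.
Qed.

Lemma real_shiftableX f n : real_shiftable f -> real_shiftable (fun z => f z ^+ n).
Proof.
move=> hf; elim: n => [|n IH]; first exact: real_shiftable_cst.
by under eq_fun do rewrite exprS; exact: real_shiftableM.
Qed.

Lemma real_shiftable_Re i : real_shiftable (fun z : Cd => complex.Re (z 0 i)).
Proof.
split.
  split; last exact: continuous_Re.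
  rewrite (_ : (fun z => _) = fun z : Cd => 2^-1 * (z 0 i + Num.conj (z 0 i))).
    apply: shiftableM; first exact: shiftableC.
    by apply: shiftableD; [exact: shiftableX|exact: shiftable_conjX].
  by apply/funext => z; rewrite ReJ_add mulrC.
split; first by apply: continuous_measurable_Borel; exact: continuous_Re.
exists 1 => z /unit_sphereE z1; apply: le_trans (normc_Re _) _; exact: coord_sphere.
Qed.

Lemma real_shiftable_Im i : real_shiftable (fun z : Cd => complex.Im (z 0 i)).
Proof.
split.
  split; last exact: continuous_Im.
  rewrite (_ : (fun z => _) = fun z : Cd => (2^-1 * 'i%C) * (Num.conj (z 0 i) + -1 * z 0 i)).
    apply: shiftableM; first exact: shiftableC.
    apply: shiftableD; first exact: shiftable_conjX.
    by apply: shiftableM; [exact: shiftableC|exact: shiftableX].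
  by apply/funext => z; rewrite ImJ_sub -!conj_conjc; ring.
split; first by apply: continuous_measurable_Borel; exact: continuous_Im.
exists 1 => z /unit_sphereE z1; apply: le_trans (normc_Im _) _; exact: coord_sphere.
Qed.

Section Density.
Context (I : finType) (ms : I -> {finite_measure set T -> \bar R}).
Local Notation S := (unit_sphere R d : set T).
Local Notation K := (total_integral S ms).

(** The approximants take values in [0, 1], so that unions are approximated through
    products. *)
Definition approximable (A : set T) := measurable A /\ forall e : R, 0 < e ->
  exists psi, [/\ real_shiftable psi, forall z, S z -> 0 <= psi z <= 1 &
    K (fun z => `|\1_A z - psi z|) <= e].

Lemma approximableC A : approximable A -> approximable (~` A).
Proof.
move=> [mA hA]; split; first exact: measurableC.
move=> e e0; have [psi [s1 s2 s3]] := hA e e0; exists (fun z => 1 - psi z); split.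
- exact: real_shiftableB (real_shiftable_cst 1) s1.
- by move=> z Sz; have /andP[] := s2 z Sz; lra.
- apply: le_trans s3; rewrite le_eqVlt; apply/orP; left; apply/eqP; congr total_integral.
  apply/funext => z; rewrite !indicE in_setC; case: (z \in A) => /=.
    by rewrite distrC; congr `|_|; ring.
  by rewrite -[RHS]normrN; congr `|_|; ring.
Qed.

Lemma approximableU A B : approximable A -> approximable B -> approximable (A `|` B).
Proof.
move=> [mA hA] [mB hB]; split; first exact: measurableU.
move=> e e0; have e2 : 0 < e / 2 by rewrite divr_gt0.
have [f [f1 f2 f3]] := hA _ e2; have [g [g1 g2 g3]] := hB _ e2.
exists (fun z => 1 - (1 - f z) * (1 - g z)); split.
- apply: real_shiftableB; first exact: real_shiftable_cst.
  by apply: real_shiftableM; apply: real_shiftableB => //; exact: real_shiftable_cst.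
- by move=> z Sz; have /andP[a b] := f2 z Sz; have /andP[c h] := g2 z Sz; apply/andP; split; nra.
have bA := bounded_mfun_norm (bounded_mfunB (bounded_mfun_indic R S mA) f1.2).
have bB := bounded_mfun_norm (bounded_mfunB (bounded_mfun_indic R S mB) g1.2).
have bAB := bounded_mfun_norm (bounded_mfunB (bounded_mfun_indic R S (measurableU _ _ mA mB))
  (bounded_mfunB (bounded_mfun_cst S 1) (bounded_mfunM (bounded_mfunB (bounded_mfun_cst S 1) f1.2)
     (bounded_mfunB (bounded_mfun_cst S 1) g1.2)))).
apply: le_trans (total_integral_le sphere_measurable ms bAB (bounded_mfunD bA bB) _) _; last first.
  by rewrite (total_integralD sphere_measurable)// [e]splitr lerD.
move=> z Sz; have /andP[a b] := f2 z Sz; have /andP[c h] := g2 z Sz.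
rewrite !indicE in_setU.
move: (ler_norm ((z \in A)%:R - f z)) (ler_norm (f z - (z \in A)%:R)).
move: (ler_norm ((z \in B)%:R - g z)) (ler_norm (g z - (z \in B)%:R)).
rewrite (distrC (f z)) (distrC (g z)).
move: `|_ - f z| `|_ - g z| => p q.
by case: (z \in A); case: (z \in B) => /=; rewrite ?mulr1n ?mulr0n !ler_norml => *;
  apply/andP; split; nra.
Qed.

(** Finite unions exhaust a countable one, by bounded convergence. *)
Lemma approximable_bigcup (A : (set T)^nat) : (forall n, approximable (A n)) ->
  approximable (\bigcup_n A n).
Proof.
move=> hA; have mU : measurable (\bigcup_n A n).
  by apply: bigcupT_measurable => n; have [] := hA n.
split=> // e e0.
pose B n := \bigcup_(k in [set k | (k < n)%N]) A k.
have hB n : approximable (B n).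
  elim: n => [|n IH].
    rewrite (_ : B 0%N = set0); last first.
      by apply/seteqP; split=> [z [k]|].
    split=> // e' e0'; exists (fun=> 0); split=> [|z _|].
    - exact: real_shiftable_cst.
    - by rewrite lexx ler01.
    - rewrite (_ : (fun z => _) = fun=> 0).
        by rewrite (total_integral_cst sphere_measurable) mul0r ltW.
      by apply/funext => z; rewrite indic0 subrr normr0.
  rewrite (_ : B n.+1 = B n `|` A n); first exact: approximableU.
  apply/seteqP; split=> z.
    move=> [k /= kn Ak]; move: kn; rewrite ltnS leq_eqVlt => /predU1P[<-|kn]; first by right.
    by left; exists k.
  by move=> [[k /= kn Ak]|An]; [exists k => //=; rewrite ltnS ltnW|exists n => /=].
have mB n : measurable (B n) by have [] := hB n.
have cB : K (fun z => `|\1_(\bigcup_n A n) z - \1_(B n) z|) @[n --> \oo] --> K (fun=> 0).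
  apply: (@total_integral_cvg _ _ _ _ sphere_measurable _ _ _ _ 1).
  - move=> n; apply: measurableT_comp => //.
    by apply: measurable_funB; exact: measurable_indic.
  - exact: measurable_cst.
  - move=> n z _; rewrite normr_id !indicE.
    by case: (_ \in _); case: (_ \in _); rewrite ?subrr ?sub0r ?subr0 ?normrN ?normr1 ?normr0.
  - move=> z _; have [[k _ Ak]|nA] := pselect ((\bigcup_n A n) z).
      apply: cvg_near_cst; exists k.+1 => // n /= kn.
      rewrite !indicE !mem_set ?subrr ?normr0//; last by exists k.
      by exists k.
    apply: cvg_near_cst; apply: nearW => n.
    rewrite !indicE !memNset ?subrr ?normr0// => -[k _ Ak]; apply: nA.
    by exists k.
have e2 : 0 < e / 2 by rewrite divr_gt0.
rewrite (total_integral_cst sphere_measurable) mul0r in cB.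
have /cvgrPdist_lt /(_ _ e2) [n _ hn] := cB.
have {hn} := hn n (leqnn n); rewrite sub0r normrN => /(le_lt_trans (ler_norm _)) hn.
have [psi [p1 p2 p3]] := (hB n).2 _ e2; exists psi; split=> //.
have b1 := bounded_mfun_norm (bounded_mfunB (bounded_mfun_indic R S mU) (bounded_mfun_indic R S (mB n))).
have b2 := bounded_mfun_norm (bounded_mfunB (bounded_mfun_indic R S (mB n)) p1.2).
have b3 := bounded_mfun_norm (bounded_mfunB (bounded_mfun_indic R S mU) p1.2).
apply: le_trans (total_integral_le sphere_measurable ms b3 (bounded_mfunD b1 b2) _) _; last first.
  by rewrite (total_integralD sphere_measurable)// [e]splitr lerD// ltW.
by move=> z Sz; exact: ler_distD.
Qed.

(** Rescale f affinely to values in [0, 1] with the level q at 1/2, and compose with the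
    step polynomials. *)
Lemma approximable_gt f q : real_shiftable f -> approximable [set z | q < f z].
Proof.
move=> [sf [mf [M0 hM0]]].
pose M := `|M0| + `|q| + 1.
have Mp : 0 < M by rewrite ltr_wpDl// addr_ge0.
pose y z := 2^-1 * (1 + M^-1 * (f z - q)).
have ry : real_shiftable y.
  apply: real_shiftableM; first exact: real_shiftable_cst.
  apply: real_shiftableD; first exact: real_shiftable_cst.
  apply: real_shiftableM; first exact: real_shiftable_cst.
  apply: real_shiftableB; last exact: real_shiftable_cst.
  by split=> //; split=> //; exists M0.
have y01 z : S z -> 0 <= y z <= 1.
  move=> Sz; have h : `|M^-1 * (f z - q)| <= 1.
    rewrite normrM gtr0_norm ?invr_gt0// ler_pdivrMl// mulr1.
    apply: le_trans (ler_normB _ _) _; rewrite /M.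
    by have := le_trans (hM0 z Sz) (ler_norm _); lra.
  by move: h; rewrite /y ler_norml => /andP[]; set x := M^-1 * _; lra.
have yq z : (2^-1 < y z) = (q < f z).
  rewrite /y -[ltLHS]mulr1 ltr_pM2l ?invr_gt0// ltrDl pmulr_rgt0 ?invr_gt0//.
  by rewrite subr_gt0.
have mA : measurable [set z : T | q < f z].
  rewrite (_ : [set z | _] = f @^-1` `]q, +oo[); last first.
    by apply/seteqP; split=> z /=; rewrite in_itv /= andbT.
  by rewrite -[_ @^-1` _]setTI; apply: mf => //; exact: measurable_itv.
split=> // e e0.
pose psi m z := step m (y z).
have rpsi m : real_shiftable (psi m).
  apply: real_shiftableX; apply: real_shiftableB; first exact: real_shiftable_cst.
  apply: real_shiftableX; apply: real_shiftableB; first exact: real_shiftable_cst.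
  exact: real_shiftableX.
have : K (fun z => `|\1_[set z | q < f z] z - psi m z|) @[m --> \oo] --> K (fun=> 0).
  apply: (@total_integral_cvg _ _ _ _ sphere_measurable _ _ _ _ 2).
  - move=> m; apply: measurableT_comp => //.
    apply: measurable_funB; first exact: measurable_indic.
    by have [_ []] := rpsi m.
  - exact: measurable_cst.
  - move=> m z Sz; rewrite normr_id indicE; apply: le_trans (ler_normB _ _) _.
    have /andP[a b] := step_itv m (y01 z Sz); rewrite [`|psi m z|]ger0_norm//.
    rewrite /psi; case: (_ \in _); rewrite ?normr1 ?normr0; lra.
  - move=> z Sz; have h := step_cvg (y01 z Sz).
    rewrite -(normr0 R) -(subrr ((2^-1 < y z)%R%:R : R)).
    apply: cvg_norm; apply: cvgB => //; rewrite indicE yq.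
    have -> : (z \in [set z0 | q < f z0]) = (q < f z).
      by apply/idP/idP; rewrite inE.
    exact: cvg_cst.
rewrite (total_integral_cst sphere_measurable) mul0r => /cvgrPdist_lt /(_ _ e0) [m _ hm].
exists (psi m); split=> //; first by move=> z Sz; exact: step_itv (y01 z Sz).
by have := hm m (leqnn m); rewrite sub0r normrN => /(le_lt_trans (ler_norm _)) /ltW.
Qed.

End Density.
End Borel.

Section BorelDensity.
Context (R : realType) (d : nat).
Local Notation C := (R[i]).
Local Notation Cd := 'rV[C]_d.
Local Notation T := (Borel R d).
Context (I : finType) (ms : I -> {finite_measure set T -> \bar R}).
Local Notation approx := (approximable ms).

Lemma approximableT : approx setT.
Proof.
split=> // e e0; exists (fun=> 1); split=> [|z _|].
- exact: real_shiftable_cst.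
- by rewrite lexx ler01.
- rewrite (_ : (fun z => _) = fun=> 0).
    by rewrite (total_integral_cst (@sphere_measurable R d)) mul0r ltW.
  by apply/funext => z; rewrite indicT subrr normr0.
Qed.

Lemma approximableI A B : approx A -> approx B -> approx (A `&` B).
Proof.
move=> hA hB; rewrite -(setCK (A `&` B)) setCI.
by apply: approximableC; apply: approximableU; exact: approximableC.
Qed.

Lemma approximable_forall (J : finType) (P : J -> set T) : (forall i, approx (P i)) ->
  approx [set z | forall i, P i z].
Proof.
move=> hP; suff h (s : seq J) : approx [set z | forall i, i \in s -> P i z].
  have := h (enum J); congr approx; apply/seteqP; split=> z /= hz i; last by move=> _.
  by apply: hz; rewrite mem_enum.
elim: s => [|j s IH].
  by have := approximableT; congr approx; apply/seteqP; split.
have := approximableI (hP j) IH; congr approx; apply/seteqP; split=> z /=.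
  by move=> [Pj hs] i; rewrite inE => /predU1P[->//|/hs].
by move=> hz; split=> [|i si]; apply: hz; rewrite inE ?eqxx// si orbT.
Qed.

Lemma approximable_between f (a b : R) : real_shiftable f -> approx [set z | a < f z < b].
Proof.
move=> hf; have h1 := approximable_gt ms a hf.
have h2 := approximable_gt ms (- b) (real_shiftableB (real_shiftable_cst d 0) hf).
have := approximableI h1 h2; congr approx; apply/seteqP; split=> z /=.
  by rewrite sub0r ltrN2 => -[-> ->].
by rewrite sub0r ltrN2 => /andP[].
Qed.

(** Open boxes with rational corners are a countable base of the topology. *)
Definition rational_box (q : {ffun 'I_d -> (rat * rat) * (rat * rat)}) : set Cd :=
  [set z | forall i, (ratr (q i).1.1 < complex.Re (z 0 i) < ratr (q i).1.2) /\
                     (ratr (q i).2.1 < complex.Im (z 0 i) < ratr (q i).2.2)].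

Lemma open_rational_box (U : set Cd) z : open U -> U z ->
  exists2 q, rational_box q z & rational_box q `<=` U.
Proof.
move=> oU Uz; have /nbhs_ballP [e /= e0 he] := open_nbhs_nbhs (conj oU Uz).
have ee : e = (complex.Re e)%:C%C by apply/esym/RRe_real; exact: gtr0_real.
have r0 : 0 < complex.Re e / 2.
  by rewrite divr_gt0//; move: e0; rewrite {1}ee ltcR.
have hq (x : R) : {q : rat * rat | ratr q.1 < x < ratr q.2 /\
    (x - complex.Re e / 2 < ratr q.1 /\ ratr q.2 < x + complex.Re e / 2)}.
  apply: cid; have [a] : exists a : rat, ratr a \in `]x - complex.Re e / 2, x[.
    by apply: rat_in_itvoo; lra.
  have [b] : exists b : rat, ratr b \in `]x, x + complex.Re e / 2[.
    by apply: rat_in_itvoo; lra.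
  by rewrite !in_itv /= => /andP[h1 h2] /andP[h3 h4]; exists (a, b); rewrite h1 h4 h3 h2.
exists [ffun i => (sval (hq (complex.Re (z 0 i))), sval (hq (complex.Im (z 0 i))))].
  move=> i; rewrite ffunE /=.
  by case: (hq _) => /= p [-> _]; case: (hq _) => /= p' [-> _].
move=> x hx; apply: he; split=> [|i j] //; rewrite (ord1 i) {i}.
have := hx j; rewrite ffunE /=.
case: (hq _) => /= p [/andP[p1 p2] [p3 p4]]; case: (hq _) => /= p' [/andP[q1 q2] [q3 q4]].
move=> [/andP[x1 x2] /andP[x3 x4]].
rewrite -ball_normE /= ee.
rewrite (_ : `|_| = (normc (z 0 j - x 0 j))%:C%C)// ltcR.
apply: le_lt_trans (normc_ReIm _) _; rewrite ReD ImD ReN ImN.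
have h1 : `|complex.Re (z 0 j) - complex.Re (x 0 j)| < complex.Re e / 2.
  by rewrite ltr_norml; apply/andP; split; lra.
have h2 : `|complex.Im (z 0 j) - complex.Im (x 0 j)| < complex.Re e / 2.
  by rewrite ltr_norml; apply/andP; split; lra.
by rewrite [complex.Re e]splitr ltrD.
Qed.

Lemma approximable_open (U : set Cd) : open U -> approx U.
Proof.
move=> oU.
pose A n : set T := if unpickle n is Some q then
  if `[< rational_box q `<=` U >] then rational_box q else set0 else set0.
have a0 : approx set0 by rewrite -setCT; apply: approximableC; exact: approximableT.
rewrite (_ : U = \bigcup_n A n).
  apply: approximable_bigcup => n; rewrite /A; case: (unpickle n) => // q.
  case: ifP => // _; apply: approximable_forall => i.
  by apply: approximableI; apply: approximable_between; [exact: real_shiftable_Re|exact: real_shiftable_Im].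
apply/seteqP; split=> z.
  move=> Uz; have [q qz qU] := open_rational_box oU Uz; exists (pickle q) => //.
  by rewrite /A pickleK ifT//; apply/asboolP.
by move=> [n _]; rewrite /A; case: (unpickle n) => // q; case: ifP => // /asboolP qU /qU.
Qed.

(** Approximable sets form a sigma-algebra that contains the open sets. *)
Lemma approximable_measurable (A : set T) : measurable A -> approx A.
Proof.
move: A; apply: smallest_sub; last exact: approximable_open.
split.
- by rewrite -setCT; apply: approximableC; exact: approximableT.
- by move=> A hA; rewrite setTD; exact: approximableC.
- by move=> A hA; exact: approximable_bigcup.
Qed.

End BorelDensity.

(** * Complex measures through positive measures *)

Local Notation total_variation := Defs.total_variation.

Section JordanParts.
Context (R : realType) (dd : measure_display) (T : measurableType dd).
Implicit Types (nu : {charge set T -> \bar R}) (b : bool).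

(** The Hahn decomposition is the one chosen in the definition of [charge_integral],
    so that [charge_integralE] holds by conversion. The boolean is the sign. *)
Definition hahn_set nu b : set T :=
  let hP := cid (Hahn_decomposition nu) in if b then sval hP else sval (cid (svalP hP)).

Definition jordan_part nu b : {finite_measure set T -> \bar R} :=
  let hP := cid (Hahn_decomposition nu) in let hN := cid (svalP hP) in
  if b then [the {finite_measure set T -> \bar R} of jordan_pos (svalP hN)]
  else [the {finite_measure set T -> \bar R} of jordan_neg (svalP hN)].

Definition jordan_sign b : R := if b then 1 else -1.

Lemma hahn_set_decomposition nu : hahn_decomposition nu (hahn_set nu true) (hahn_set nu false).
Proof. by rewrite /hahn_set; case: cid => P hP /=; case: cid. Qed.

Lemma hahn_set_measurable nu b : measurable (hahn_set nu b).
Proof. by have [[mP _] [mN _] _ _] := hahn_set_decomposition nu; case: b. Qed.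

Lemma jordan_partE nu b A : measurable A ->
  jordan_part nu b A = ((jordan_sign b)%:E * nu (A `&` hahn_set nu b))%E.
Proof.
move=> mA; rewrite /jordan_part /hahn_set; case: b => /=.
  by rewrite jordan_posE cjordan_posE /crestr0 mem_set// /crestr mul1e.
by rewrite jordan_negE cjordan_negE /crestr0 mem_set// /crestr EFinN mulN1e.
Qed.

Lemma jordan_part_other nu b A : measurable A ->
  jordan_part nu b (A `&` hahn_set nu (~~ b)) = 0%E.
Proof.
move=> mA; have mP := hahn_set_measurable nu (~~ b).
rewrite jordan_partE; last exact: measurableI.
have [_ _ _ h0] := hahn_set_decomposition nu.
rewrite -setIA (_ : _ `&` hahn_set nu b = set0) ?setI0 ?charge0 ?mule0//.
by case: b {mP} => //=; rewrite setIC.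
Qed.

Lemma charge_jordan nu A : measurable A ->
  nu A = (jordan_part nu true A - jordan_part nu false A)%E.
Proof.
move=> mA.
have := jordan_decomp (svalP (cid (svalP (cid (Hahn_decomposition nu))))) mA.
by rewrite /cadd /= cscaleN1.
Qed.

Lemma charge_integralE nu g : charge_integral nu g =
  Rintegral (jordan_part nu true) setT g - Rintegral (jordan_part nu false) setT g.
Proof. by []. Qed.

Implicit Types (mu : complex_measure R T) (i : bool * bool).

Definition cpart mu i : {charge set T -> \bar R} := if i.1 then re_part mu else im_part mu.
(** The four positive measures of which a complex measure is a combination. *)
Definition parts mu i : {finite_measure set T -> \bar R} := jordan_part (cpart mu i) i.2.
Definition part_set mu i : set T := hahn_set (cpart mu i) i.2.
Definition part_coef i : R[i] := (if i.1 then 1 else 'i%C) * (jordan_sign i.2)%:C%C.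

(** The set E is partitioned into A, E \ A and empty sets. *)
Lemma total_variation_ge mu (A E : set T) : measurable A -> measurable E -> A `<=` E ->
  ((normc (cmeas mu A))%:E <= total_variation mu E)%E.
Proof.
move=> mA mE AE; pose F n := if n is k.+1 then if k is _.+1 then set0 else E `\` A else A.
apply: (@le_trans _ _ (\sum_(0 <= k <oo) (normc (cmeas mu (F k)))%:E)%E).
  have := @nneseries_lim_ge _ (fun k => (normc (cmeas mu (F k)))%:E) xpredT 0%N 1%N.
  by rewrite big_nat1; apply=> n _ _; rewrite lee_fin normc_ge0.
apply: ereal_sup_ubound; exists F => //; split.
- by move=> [|[|k]] //=; exact: measurableD.
- apply/trivIsetP => /= i j _ _; wlog ij : i j / (i < j)%N => [h|_].
    rewrite neq_ltn => /orP[] ij; first by apply: h => //; rewrite ltn_eqF.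
    by rewrite setIC; apply: h => //; rewrite ltn_eqF.
  case: i j ij => [|i] [|[|j]] //= _; rewrite ?setI0//.
  by apply/seteqP; split=> // z [? [_]].
- apply/seteqP; split=> z.
    by move=> [[|[|k]] _] //=; [exact: AE|case].
  by move=> Ez; have [Az|nAz] := pselect (A z); [exists 0%N|exists 1%N].
Qed.

Lemma cmeas_part mu i A : measurable A ->
  fine (parts mu i A) <= normc (cmeas mu (A `&` part_set mu i)).
Proof.
move=> mA; rewrite /parts jordan_partE//.
rewrite fineM//; last by apply: fin_num_measure; apply: measurableI => //; exact: hahn_set_measurable.
rewrite /part_set /=; move: (A `&` _) => B.
have sg (x : R) : jordan_sign i.2 * x <= `|x|.
  rewrite /jordan_sign; case: i.2; rewrite ?mul1r ?mulN1r ?ler_norm//.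
  by rewrite -normrN ler_norm.
apply: le_trans (sg _) _; rewrite /cpart; case: i.1.
  exact: (normc_Re (cmeas mu B)).
exact: (normc_Im (cmeas mu B)).
Qed.

(** Each positive part of E is at most the modulus of the measure of the piece of E in
    the corresponding Hahn set. *)
Lemma total_variation_eq0 mu E : measurable E ->
  total_variation mu E = 0%E <-> forall i, parts mu i E = 0%E.
Proof.
move=> mE; split=> [E0 i|h].
  have mP : measurable (E `&` part_set mu i) by apply: measurableI => //; exact: hahn_set_measurable.
  have := total_variation_ge mu mP mE (@subIsetl _ _ _).
  rewrite E0 lee_fin => /(le_trans (cmeas_part mu i mE)) h.
  have := fineK (fin_num_measure (parts mu i) _ mE) => <-; apply/eqP; rewrite eqe eq_le h.
  by rewrite fine_ge0.
have c0 A : measurable A -> A `<=` E -> cmeas mu A = 0.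
  move=> mA AE.
  have hA i : parts mu i A = 0%E.
    by apply/eqP; rewrite eq_le measure_ge0 andbT -(h i) le_measure// inE.
  rewrite /cmeas !charge_jordan//.
  have := hA (true, true); have := hA (true, false).
  have := hA (false, true); have := hA (false, false).
  by rewrite /parts /cpart /= => -> -> -> ->; rewrite subee.
apply/eqP; rewrite eq_le; apply/andP; split.
  apply: ge_ereal_sup => _ [F [mF _ FE] <-]; rewrite eseries0// => k _ _.
  rewrite c0//; last by rewrite -FE; exact: bigcup_sup.
  by rewrite normr0.
have := total_variation_ge mu measurable0 mE (@sub0set _ _).
by apply: le_trans; rewrite lee_fin normc_ge0.
Qed.

Lemma Rintegral_carrier (m : {finite_measure set T -> \bar R}) (S : set T) g :
  measurable S -> m (~` S) = 0%E -> bounded_mfun S g -> Rintegral m setT g = Rintegral m S g.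
Proof.
move=> mS mS0 bg; have mCS := measurableC mS.
have mg : measurable_fun setT (EFin \o g) by apply/measurable_EFinP; case: bg.
have ST : setT `\` ~` S = S by rewrite setTD setCK.
have ig : m.-integrable setT (EFin \o g).
  apply/(negligible_integrable mCS measurableT mg mS0); rewrite ST.
  exact: bounded_mfun_integrable.
by rewrite /Rintegral (negligible_integral mCS _ ig)// ST.
Qed.

Definition bounded_cfun (S : set T) (g : T -> R[i]) :=
  bounded_mfun S (fun z => complex.Re (g z)) /\ bounded_mfun S (fun z => complex.Im (g z)).

(** The integral, for a measure carried by S, as a combination of integrals against
    positive measures; it is additive on functions that are bounded on S only. *)
Definition carried_integral (S : set T) mu (g : T -> R[i]) : R[i] :=
  \sum_i part_coef i * (Rintegral (parts mu i) S (fun z => complex.Re (g z)) +i*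
                        Rintegral (parts mu i) S (fun z => complex.Im (g z)))%C.

Lemma cintegral_carried (S : set T) mu g : measurable S -> total_variation mu (~` S) = 0%E ->
  bounded_cfun S g -> cintegral mu g = carried_integral S mu g.
Proof.
move=> mS /total_variation_eq0 h [br bi]; have {}h := h (measurableC mS).
rewrite /cintegral !charge_integralE.
have hr i : Rintegral (parts mu i) setT (fun z => complex.Re (g z)) =
    Rintegral (parts mu i) S (fun z => complex.Re (g z)) by exact: Rintegral_carrier.
have hi i : Rintegral (parts mu i) setT (fun z => complex.Im (g z)) =
    Rintegral (parts mu i) S (fun z => complex.Im (g z)) by exact: Rintegral_carrier.
rewrite /carried_integral.
have -> : \sum_i part_coef i * (Rintegral (parts mu i) S (fun z => complex.Re (g z)) +i*
                        Rintegral (parts mu i) S (fun z => complex.Im (g z)))%C =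
  \sum_(a : bool) \sum_(b : bool) part_coef (a, b) *
     (Rintegral (parts mu (a, b)) setT (fun z => complex.Re (g z)) +i*
      Rintegral (parts mu (a, b)) setT (fun z => complex.Im (g z)))%C.
  by rewrite pair_bigA; apply: eq_bigr => -[a b] _; rewrite hr hi.
rewrite !big_bool /part_coef /jordan_sign /parts /cpart /=.
by apply/eqP; rewrite eq_complex /=; apply/andP; split; apply/eqP; ring.
Qed.

Lemma bounded_cfunD S f g : bounded_cfun S f -> bounded_cfun S g ->
  bounded_cfun S (fun z => f z + g z).
Proof.
move=> [f1 f2] [g1 g2]; split.
  by under eq_fun do rewrite ReD; exact: bounded_mfunD.
by under eq_fun do rewrite ImD; exact: bounded_mfunD.
Qed.

Lemma bounded_cfunM S f g : bounded_cfun S f -> bounded_cfun S g ->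
  bounded_cfun S (fun z => f z * g z).
Proof.
move=> [f1 f2] [g1 g2].
have hr z : complex.Re (f z * g z) =
    complex.Re (f z) * complex.Re (g z) - complex.Im (f z) * complex.Im (g z).
  by case: (f z) (g z) => a b [].
have hi z : complex.Im (f z * g z) =
    complex.Re (f z) * complex.Im (g z) + complex.Im (f z) * complex.Re (g z).
  by case: (f z) (g z) => a b [].
split.
  by under eq_fun do rewrite hr; apply: bounded_mfunB; exact: bounded_mfunM.
by under eq_fun do rewrite hi; apply: bounded_mfunD; exact: bounded_mfunM.
Qed.

Lemma bounded_cfun_real S (f : T -> R) : bounded_mfun S f -> bounded_cfun S (fun z => (f z)%:C%C).
Proof. by move=> hf; split=> //=; exact: bounded_mfun_cst. Qed.

Lemma bounded_cfun_cst S c : bounded_cfun S (fun=> c).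
Proof. by split; exact: bounded_mfun_cst. Qed.

Lemma bounded_cfunB S f g : bounded_cfun S f -> bounded_cfun S g ->
  bounded_cfun S (fun z => f z - g z).
Proof.
move=> hf hg; have := bounded_cfunD hf (bounded_cfunM (bounded_cfun_cst S (-1)) hg).
by congr bounded_cfun; apply/funext => z; rewrite mulN1r.
Qed.

Lemma carried_integralD S mu f g : measurable S -> bounded_cfun S f -> bounded_cfun S g ->
  carried_integral S mu (fun z => f z + g z) = carried_integral S mu f + carried_integral S mu g.
Proof.
move=> mS [f1 f2] [g1 g2]; rewrite /carried_integral -big_split; apply: eq_bigr => i _ /=.
rewrite -mulrDr; congr (_ * _).
under eq_Rintegral do rewrite ReD.
under [X in (_ +i* X)%C]eq_Rintegral do rewrite ImD.
rewrite !RintegralD//; exact: bounded_mfun_integrable.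
Qed.

Lemma carried_integral_le S mu g h : measurable S -> bounded_cfun S g -> bounded_mfun S h ->
  (forall z, S z -> normc (g z) <= h z) ->
  normc (carried_integral S mu g) <= 2 * total_integral S (parts mu) h.
Proof.
move=> mS [g1 g2] bh gh; apply: le_trans (normc_sum _ _ _) _.
rewrite /total_integral mulr_sumr; apply: ler_sum => i _.
rewrite normcM (_ : normc (part_coef i) = 1) ?mul1r; last first.
  rewrite /part_coef normcM normc_real /jordan_sign.
  rewrite (_ : `|_| = 1) ?mulr1; last by case: i.2; rewrite ?normrN normr1.
  by case: i.1; rewrite ?normc1//= expr0n expr1n add0r sqrtr1.
have hle f : bounded_mfun S f -> (forall z, S z -> `|f z| <= h z) ->
    `|Rintegral (parts mu i) S f| <= Rintegral (parts mu i) S h.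
  move=> bf fh; apply: le_trans (le_normr_Rintegral mS (bounded_mfun_integrable mS _ bf)) _.
  apply: le_Rintegral => //; last exact: bounded_mfun_integrable.
  by apply: bounded_mfun_integrable => //; exact: bounded_mfun_norm.
apply: le_trans (normc_ReIm _) _; rewrite mulr_natl mulr2n lerD// hle// => z Sz.
  exact: le_trans (normc_Re _) (gh z Sz).
exact: le_trans (normc_Im _) (gh z Sz).
Qed.

End JordanParts.

(** * Null sequences against Henkin measures *)

Section HenkinPairs.
Context (R : realType) (d : nat) (H : rkhs R (unit_ball R d)).
Hypothesis regH : regular_unitarily_invariant H.
Local Notation C := (R[i]).
Local Notation Cd := 'rV[C]_d.
Local Notation T := (Borel R d).
Local Notation S := (unit_sphere R d : set T).
Implicit Types (mu : complex_measure R T) (f : nat -> mpoly.mpoly d C).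

Lemma poly_bounded_cfun p : bounded_cfun S (poly_fun p : T -> C).
Proof.
elim/mpoly_gen_ind : p => [c|i|p q hp hq|p q hp hq].
- rewrite (_ : poly_fun _ = fun=> c); first exact: bounded_cfun_cst.
  by apply/funext => z; exact: poly_funC.
- rewrite (_ : poly_fun _ = fun z : Cd => z 0 i); last by apply/funext => z; exact: poly_funX.
  by split; [have [] := real_shiftable_Re R i|have [] := real_shiftable_Im R i].
- rewrite (_ : poly_fun _ = fun z : Cd => poly_fun p z + poly_fun q z).
    exact: bounded_cfunD.
  by apply/funext => z; exact: poly_funD.
- rewrite (_ : poly_fun _ = fun z : Cd => poly_fun p z * poly_fun q z).
    exact: bounded_cfunM.
  by apply/funext => z; exact: poly_funM.
Qed.

Lemma henkin_cintegral mu g : henkin H mu -> bounded_cfun S g ->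
  cintegral mu g = carried_integral S mu g.
Proof. by move=> [[h _ _] _] bg; apply: cintegral_carried => //; exact: sphere_measurable. Qed.

(** Multiplication by an indicator function is not multiplication by a polynomial,
    but on the sphere it is approximated in L1 by shiftable functions, and these
    send null sequences to null sequences of polynomials. For such a polynomial g,
    [henkin_null] applies to g f_n. *)
Lemma henkin_null_pair mu f c (A : set T) : henkin H mu -> nullseq f ->
  (forall n, pmult H (f n) c) -> measurable A -> forall e : R, 0 < e ->
  exists m0, forall m, (m0 <= m)%N -> exists n0, forall n, (n0 <= n)%N ->
  normc (carried_integral S mu
    (fun z => (\1_A z)%:C%C * (poly_fun (f n) z * poly_fun (f m) z))) <= e.
Proof.
move=> hmu nf fc mA e e0; have mS := @sphere_measurable R d.
have [[K K0 hK] fs] := nf.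
pose K1 := total_integral S (parts mu) (fun=> 1).
have K10 : 0 <= K1 by apply: total_integral_ge0.
(* the factor of the common error t in the three contributions *)
pose a := 2 * K ^+ 2 + 2 * (K * K1) + 1.
have a0 : 0 < a by rewrite /a; have := mulr_ge0 K0 K10; have := sqr_ge0 K; lra.
pose t := e / a; have t0 : 0 < t by rewrite divr_gt0.
have [_ /(_ t t0) [psi [p1 p2 p3]]] := approximable_measurable (parts mu) mA.
have [[sp _] bp] := p1.
have [g ng hg] := sp.2 f nf; have {hg} [m0 hm0] := hg t t0; exists m0 => m m0m.
have [cm hcm] := pmult_ex regH (g m).
have h0 := @henkin_null _ _ _ regH mu (fun n => g m * f n) (cm * c) hmu
  (fun n => pmultM hcm (fc n)).
have {h0} : cintegral mu (poly_fun (g m * f n)) @[n --> \oo] --> (0 : C).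
  apply: h0 => z /unit_ballE z1; apply/cvgc_normc.
  have [Kg Kg0 hKg] := ng.1.
  apply/cvgrPdist_le => d1 d10.
  have d2 : 0 < d1 / (Kg + 1) by rewrite divr_gt0// ltr_wpDl.
  have [n0 hn0] := fs _ z1 _ d2; exists n0 => // n /= n0n.
  rewrite subr0 sub0r normrN ger0_norm ?normc_ge0// poly_funM normcM.
  apply: le_trans (_ : Kg * (d1 / (Kg + 1)) <= _).
    by rewrite ler_pM ?normc_ge0//; [apply: hKg; exact: ltW|apply: hn0].
  rewrite mulrCA ler_piMr//; first exact: ltW.
  by rewrite ler_pdivrMr ?ltr_wpDl// mul1r lerDl.
move=> /cvgc_normc /cvgrPdist_le /(_ t t0) [n0 _ hn0]; exists n0 => n n0n.
have {hn0} := hn0 n n0n; rewrite subr0 sub0r normrN ger0_norm ?normc_ge0//.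
rewrite (henkin_cintegral hmu (poly_bounded_cfun _)) => hI.
pose u z := poly_fun (f n) z * poly_fun (f m) z.
have bu : bounded_cfun S u by apply: bounded_cfunM; exact: poly_bounded_cfun.
have b1 : bounded_cfun S (fun z => (\1_A z - psi z)%:C%C * u z).
  apply: bounded_cfunM => //; apply: bounded_cfun_real; apply: bounded_mfunB => //.
  exact: bounded_mfun_indic.
pose v z := (poly_fun (g m) z - (psi z)%:C%C * poly_fun (f m) z) * poly_fun (f n) z.
have bv : bounded_cfun S v.
  apply: bounded_cfunM; last exact: poly_bounded_cfun.
  apply: bounded_cfunB; first exact: poly_bounded_cfun.
  by apply: bounded_cfunM; [exact: bounded_cfun_real|exact: poly_bounded_cfun].
have -> : (fun z : T => (\1_A z)%:C%C * (poly_fun (f n) z * poly_fun (f m) z)) =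
    fun z => (((\1_A z - psi z)%:C%C * u z) - v z) + poly_fun (g m * f n) z.
  by apply/funext => z; rewrite /u /v poly_funM rmorphB /=; ring.
rewrite carried_integralD//; [|exact: bounded_cfunB|exact: poly_bounded_cfun].
pose h z := K ^+ 2 * `|\1_A z - psi z| + K * t.
have b2 : bounded_mfun S (fun z => `|\1_A z - psi z|).
  by apply: bounded_mfun_norm; apply: bounded_mfunB => //; exact: bounded_mfun_indic.
have b3 : bounded_mfun S (fun z => K ^+ 2 * `|\1_A z - psi z|).
  by apply: bounded_mfunM => //; exact: bounded_mfun_cst.
have bh : bounded_mfun S h by apply: bounded_mfunD => //; exact: bounded_mfun_cst.
have h1 : normc (carried_integral S mu (fun z => (\1_A z - psi z)%:C%C * u z - v z)) <=
    2 * total_integral S (parts mu) h.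
  apply: carried_integral_le => //; first exact: bounded_cfunB.
  move=> z /unit_sphereE z1; have fz k : normc (poly_fun (f k) z) <= K by apply: hK; rewrite z1.
  apply: le_trans (le_normcD _ _) _; rewrite normcN !normcM normc_real /h lerD//.
    by rewrite mulrC ler_wpM2r// expr2 ler_pM ?normc_ge0.
  by rewrite mulrC ler_pM ?normc_ge0//; exact: hm0.
apply: le_trans (le_normcD _ _) _.
apply: le_trans (lerD h1 hI) _.
rewrite (total_integralD mS)//; last exact: bounded_mfun_cst.
rewrite (total_integralZ mS)// (total_integral_cst mS (parts mu) (K * t)) -/K1.
have -> : e = t * a by rewrite /t divfK// gt_eqF.
have : K ^+ 2 * total_integral S (parts mu) (fun z => `|\1_A z - psi z|) <= K ^+ 2 * t.
  by rewrite ler_wpM2l ?sqr_ge0.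
by rewrite /a; move: (K ^+ 2 * _) => x; lra.
Qed.

End HenkinPairs.

(** * Uniform lifting from A(H) *)

Section Lifting.
Context (R : realType) (d : nat) (H : rkhs R (unit_ball R d)).
Hypothesis regH : regular_unitarily_invariant H.
Local Notation C := (R[i]).
Local Notation Cd := 'rV[C]_d.
Local Notation N := (inorm (rkhs_dot H)).

Lemma continuous_poly p : continuous (poly_fun p : Cd -> C).
Proof.
elim/mpoly_gen_ind : p => [c|i|p q hp hq|p q hp hq].
- rewrite (_ : poly_fun _ = fun=> c); last by apply/funext => z; exact: poly_funC.
  exact: cst_continuous.
- rewrite (_ : poly_fun _ = fun z : Cd => z 0 i); first exact: continuous_coord.
  by apply/funext => z; exact: poly_funX.
- rewrite (_ : poly_fun _ = fun z : Cd => poly_fun p z + poly_fun q z).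
    by move=> z; have FF : Filter (nbhs z) := @nbhs_filter Cd z; apply: cvgD; [exact: hp|exact: hq].
  by apply/funext => z; exact: poly_funD.
- rewrite (_ : poly_fun _ = fun z : Cd => poly_fun p z * poly_fun q z).
    by move=> z; have FF : Filter (nbhs z) := @nbhs_filter Cd z; apply: cvgM; [exact: hp|exact: hq].
  by apply/funext => z; exact: poly_funM.
Qed.

Lemma mult_norm_bound (phi : Mult H) (e : R) : (mult_norm phi < e%:E)%E ->
  forall f, N (mult_op phi f) <= e * N f.
Proof.
move=> h f; have h1 u : N u <= 1 -> N (mult_op phi u) <= e.
  move=> u1; rewrite -lee_fin; apply: le_trans (ltW h).
  by apply: ereal_sup_ubound; exists u.
have lin a u : mult_op phi (a *: u) = a *: mult_op phi u.
  have z0 : mult_op phi 0 = 0.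
    by apply: mult_op_unique; rewrite linear0; apply/funext => x /=; rewrite mulr0.
  by have := mult_op_lin phi a u 0; rewrite z0 !addr0.
have [f0|fN] := eqVneq (N f) 0.
  rewrite (inorm_eq0 f0) inorm0 mulr0.
  have -> : mult_op phi 0 = 0 by have := lin 0 0; rewrite !scale0r.
  by rewrite inorm0.
have fp : 0 < N f by rewrite lt_neqAle eq_sym fN inorm_ge0.
have := h1 ((N f)^-1%:C%C *: f); rewrite lin !inormZ normc_real ger0_norm ?invr_ge0 ?inorm_ge0//.
by rewrite mulVf// lexx mulrC => /(_ isT); rewrite ler_pdivrMr.
Qed.

(** Boundary points are approached along radii. *)
Lemma closed_ball_limit (F : Cd -> C) (e : R) : {within @closed_unit_ball R d, continuous F} ->
  (forall z, unit_ball R d z -> normc (F z) <= e) -> forall z, nsq z <= 1 -> normc (F z) <= e.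
Proof.
move=> /subspace_continuousP cF h z z1.
pose t n : C := (1 - n.+1%:R^-1 : R)%:C%C.
have t01 n : 0 <= 1 - (n.+1%:R^-1 : R) < 1.
  have h1 := invS_gt0 R n; rewrite subr_ge0 gtrBl h1 andbT.
  by rewrite invf_le1 ?ler1n ?ltr0n.
have tz n : unit_ball R d (t n *: z).
  apply/unit_ballE; rewrite nsqZ normc_real; have /andP[t0 t1] := t01 n.
  rewrite ger0_norm//; apply: le_lt_trans (_ : (1 - n.+1%:R^-1 : R) ^+ 2 < 1).
    by rewrite ler_piMr ?sqr_ge0.
  by rewrite expr_lt1.
have zB : @closed_unit_ball R d z by apply/closed_unit_ballE.
have tcvg : t n @[n --> \oo] --> (1 : C).
  apply/cvgc_normc; apply/cvgrPdist_lt => r r0; have [K hK] := invS_lt r0.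
  exists K => // n Kn; rewrite sub0r normrN ger0_norm ?normc_ge0//.
  rewrite (_ : normc _ = n.+1%:R^-1); first exact: hK.
  suff h1 : t n - 1 = (- n.+1%:R^-1 : R)%:C%C.
    by rewrite -[LHS]/(normc (t n - 1)) h1 normc_real normrN ger0_norm ?invr_ge0.
  by rewrite /t rmorphB rmorphN /= rmorph1; ring.
have xcvg : (fun n => t n *: z) @ \oo --> z.
  rewrite -[X in _ --> X](scale1r z); apply: cvgZr_tmp => //; exact: cvg_cst.
have Fc : (fun n => F (t n *: z)) @ \oo --> F z.
  move=> U /(cF z zB); rewrite /within /= => hU; have [M _ hM] := xcvg _ hU.
  exists M => // n Mn; apply: (hM n Mn).
  by apply/closed_unit_ballE; apply: ltW; apply/unit_ballE.
have Fn : normc (F (t n *: z) - F z) @[n --> \oo] --> (0 : R) by apply/cvgc_normc.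
apply/ler_addgt0Pr => r r0.
have /cvgrPdist_lt /(_ _ r0) [n _ hn] := Fn.
have {hn} := hn n (leqnn n); rewrite sub0r normrN ger0_norm ?normc_ge0// normc_sub => hn.
have E : F z = F (t n *: z) + (F z - F (t n *: z)) by rewrite addrC subrK.
rewrite E; apply: le_trans (le_normcD _ _) _; rewrite lerD ?(ltW hn)//.
exact: (h _ (tz n)).
Qed.

(** The multiplier norm dominates the sup norm, so polynomials that approximate phi in
    Mult(H) do so uniformly; those at distance at most 1 from phi have bounded
    multiplier norms. *)
Lemma A_algebra_approx (phi : Mult H) F : A_algebra phi -> continuous_extension phi F ->
  exists c, forall e : R, 0 < e -> exists2 p, pmult H p c &
    forall z, nsq z <= 1 -> normc (poly_fun p z - F z) <= e.
Proof.
move=> hA [cF hF].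
have valB (a b : Mult H) x : val (a - b) x = val a x - val b x by [].
have [p0 [psi0 [ip0 h0]]] := hA 1 ltr01.
have [c hc] := pmult_ex regH p0.
exists (2 + c) => e e0.
have m0 : 0 < Num.min 1 e by rewrite lt_min ltr01.
have [p [psi [ip hp]]] := hA _ m0; exists p.
  rewrite -(subrK p0 p); apply: pmultD => //; split=> // f.
  exists (mult_op (phi - psi0) f - mult_op (phi - psi) f); split.
    rewrite linearB /= !mult_opE; apply/funext => x; rewrite !fctE poly_funB -ip -ip0.
    by rewrite !valB; ring.
  apply: le_trans (inormD _ _ _) _; rewrite inormN.
  have b1 := mult_norm_bound h0 f; have b2 := mult_norm_bound hp f.
  have b3 : Num.min 1 e * N f <= 1 * N f by rewrite ler_wpM2r ?inorm_ge0// ge_min lexx.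
  by move: (le_trans b2 b3) b1; lra.
apply: closed_ball_limit.
  apply/subspace_continuousP => z zB; have /subspace_continuousP /(_ z zB) h := cF.
  apply: (@cvgB _ _ _ _ _ _ _ _ _ _ h).
  exact: cvg_within_filter (@continuous_poly p z).
move=> z zB; rewrite normc_sub.
have := hF (SigSub (mem_set zB) : unit_ball R d) => /= ->.
have -> : poly_fun p z = val psi (SigSub (mem_set zB) : unit_ball R d) by rewrite ip.
apply: (mult_sup regH (phi := fun x => val phi x - val psi x)) => f.
exists (mult_op (phi - psi) f); split; first by rewrite mult_opE.
apply: le_trans (mult_norm_bound hp f) _; rewrite ler_wpM2r ?inorm_ge0// ge_min.
by rewrite lexx orbT.
Qed.

End Lifting.

Section UniformLifting.
Context (R : realType) (d : nat) (H : rkhs R (unit_ball R d)).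
Hypothesis regH : regular_unitarily_invariant H.
Local Notation C := (R[i]).
Local Notation Cd := 'rV[C]_d.
Variable E : set Cd.
Hypothesis subE : E `<=` unit_sphere R d.
Hypothesis surjE : restriction_surjective H E.
Implicit Types (g h : Cd -> R).

(** Exact lifting to A(H) carries no bound that can be used; uniform approximation by
    polynomials of bounded multiplier norm does, and is a closed condition on g. *)
Definition liftable (k : R) g := forall e : R, 0 < e -> exists2 p, pmult H p k &
  forall z, E z -> normc (poly_fun p z - (g z)%:C%C) <= e.

Lemma liftable_ex g : {within E, continuous g} -> exists k : nat, liftable k%:R g.
Proof.
move=> cg; have cg' : {within E, continuous (fun z => (g z)%:C%C)}.
  apply/subspace_continuousP => z Ez; apply/cvgc_normc.
  have /subspace_continuousP /(_ z Ez) /cvgrPdist_lt h := cg.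
  apply/cvgrPdist_lt => e /h; apply: filterS => x.
  rewrite /from_subspace => hx.
  rewrite sub0r normrN ger0_norm ?normc_ge0// -[X in normc X](rmorphB (real_complex R)).
  by rewrite normc_real distrC.
have [phi [F [pA cF Fg]]] := surjE cg'.
have [c hc] := A_algebra_approx regH pA cF.
exists (Num.truncn c).+1 => e e0; have [p pc hp] := hc e e0; exists p.
  by apply: pmult_mono pc; rewrite ltW// truncnS_gt.
by move=> z Ez; rewrite -Fg//; apply: hp; have /unit_sphereE -> := subE Ez.
Qed.

(** Limits of nested balls, without completeness of a function space: [g n - 2 r n]
    increases, [g n + 2 r n] decreases, and the limit is the supremum of the former. *)
Lemma nested_limit (g : nat -> Cd -> R) (r : nat -> R) :
  (forall n, {within E, continuous (g n)}) -> (forall n, 0 < r n) ->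
  (forall n, r n.+1 <= r n / 2) -> (forall n, r n.+1 <= n.+1%:R^-1) ->
  (forall n z, E z -> `|g n.+1 z - g n z| <= r n) ->
  exists2 h, {within E, continuous h} & forall n z, E z -> `|h z - g n z| <= 2 * r n.
Proof.
move=> cg r0 r2 r1 hg.
pose b z n := g n z - 2 * r n; pose a z n := g n z + 2 * r n.
have bS z n : E z -> b z n <= b z n.+1.
  move=> Ez; have := hg n z Ez; rewrite ler_norml /b => /andP[]; have := r2 n; lra.
have aS z n : E z -> a z n.+1 <= a z n.
  move=> Ez; have := hg n z Ez; rewrite ler_norml /a => /andP[]; have := r2 n; lra.
have ba z m n : E z -> b z m <= a z n.
  move=> Ez.
  have b_mono k l : (k <= l)%N -> b z k <= b z l.
    by move=> /subnK <-; elim: (l - k)%N => // i IH; rewrite (le_trans IH)// addSn bS.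
  have a_mono k l : (k <= l)%N -> a z l <= a z k.
    by move=> /subnK <-; elim: (l - k)%N => // i IH; rewrite (le_trans _ IH)// addSn aS.
  apply: le_trans (b_mono _ _ (leq_maxl m n)) _; apply: le_trans (a_mono _ _ (leq_maxr m n)).
  by rewrite /a /b; have := r0 (maxn m n); lra.
pose h z := sup [set b z n | n in setT].
have hh n z : E z -> `|h z - g n z| <= 2 * r n.
  move=> Ez; have ub k : ubound [set b z n | n in setT] (a z k).
    by move=> _ [m _ <-]; exact: ba.
  have h1 : h z <= a z n by apply: ge_sup => //; exists (b z 0%N); exists 0%N.
  have h2 : b z n <= h z by apply: ub_le_sup; [exists (a z 0%N)|exists n].
  by move: h1 h2; rewrite /a /b ler_norml => *; apply/andP; split; lra.
exists h => //; apply/subspace_continuousP => z Ez; apply/cvgrPdist_le => e e0.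
have e5 : 0 < e / 5 by rewrite divr_gt0.
have [K hK] := invS_lt e5.
have rK : r K.+1 <= e / 5 by rewrite (le_trans (r1 K))// ltW// hK.
have /subspace_continuousP /(_ z Ez) /cvgrPdist_le /(_ _ e5) := cg K.+1.
rewrite !near_withinE; apply: (@filterS _ _ (@nbhs_filter Cd z)) => x hx Ex; have {hx} := hx Ex.
have := hh K.+1 z Ez; have := hh K.+1 x Ex; rewrite /from_subspace !ler_norml.
by move=> /andP[? ?] /andP[? ?] /andP[? ?]; apply/andP; split; lra.
Qed.

(** Baire category. If no set of liftable functions had an interior point, then nested
    balls would lead to a continuous function that is not liftable with any constant. *)
Lemma liftable_ball : exists (k : nat) g0 (r : R), [/\ {within E, continuous g0}, 0 < r &
  forall h, {within E, continuous h} -> (forall z, E z -> `|h z - g0 z| <= r) -> liftable k%:R h].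
Proof.
apply: contrapT => hno.
pose St := {x : (Cd -> R) * R | {within E, continuous x.1} /\ 0 < x.2}.
have step (a : nat * St) : exists y : St, [/\ forall z, E z -> `|(sval y).1 z - (sval a.2).1 z| <= (sval a.2).2,
   (sval y).2 <= (sval a.2).2 / 2, (sval y).2 <= a.1.+1%:R^-1 &
   forall p, pmult H p a.1%:R -> exists2 z, E z &
     3 * (sval y).2 < normc (poly_fun p z - ((sval y).1 z)%:C%C)].
  case: a => n [[g0 r] [/= cg r0]].
  have [h [ch hg] hl] : exists2 h, {within E, continuous h} /\ (forall z, E z -> `|h z - g0 z| <= r)
      & ~ liftable n%:R h.
    apply: contrapT => hno2; apply: hno; exists n, g0, r; split=> // h ch hg.
    by apply: contrapT => hl; apply: hno2; exists h.
  have [e e0 he] : exists2 e : R, 0 < e & forall p, pmult H p n%:R ->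
      exists2 z, E z & e < normc (poly_fun p z - (h z)%:C%C).
    apply: contrapT => hno2; apply: hl => e e0; apply: contrapT => hp; apply: hno2.
    exists e => // p pn; apply: contrapT => hz; apply: hp; exists p => // z Ez.
    by rewrite leNgt; apply/negP => ez; apply: hz; exists z.
  (* the limit of the centres will be at distance at most 2 s from h, and 3 s <= e *)
  pose s := Num.min (e / 3) (Num.min (r / 2) n.+1%:R^-1).
  have s0 : 0 < s by rewrite /s !lt_min !divr_gt0//= invr_gt0.
  exists (exist _ (h, s) (conj ch s0)) => /=; split=> //.
  - by rewrite /s !ge_min lexx !orbT.
  - by rewrite /s !ge_min lexx !orbT.
  - move=> p pn; have [z Ez hz] := he p pn; exists z => //; apply: le_lt_trans hz.
    rewrite -ler_pdivlMl// mulrC (_ : _ / _ = e / 3)//.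
    by rewrite /s ge_min lexx.
have [f hf] := choice step.
have c0 : {within E, continuous (fun=> 0 : R)}.
  by apply: continuous_subspaceT; exact: cst_continuous.
pose x0 : St := exist _ ((fun=> 0), 1) (conj c0 ltr01).
pose x := fix x n := if n is m.+1 then f (m, x m) else x0.
have hx n := hf (n, x n).
have [h ch hh] : exists2 h, {within E, continuous h} &
    forall n z, E z -> `|h z - (sval (x n)).1 z| <= 2 * (sval (x n)).2.
  apply: nested_limit => [n|n|n|n|n]; [by case: (svalP (x n))|by case: (svalP (x n))|..];
    by case: (hx n).
have [k hk] := liftable_ex ch.
have rk : 0 < (sval (x k.+1)).2 by case: (svalP (x k.+1)).
have [p pk hp] := hk _ rk.
have [_ _ _ /(_ p pk) [z Ez]] := hx k; apply/negP; rewrite -leNgt -[f _]/(x k.+1).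
have -> : poly_fun p z - ((sval (x k.+1)).1 z)%:C%C =
    (poly_fun p z - (h z)%:C%C) + (h z - (sval (x k.+1)).1 z)%:C%C by rewrite rmorphB /=; ring.
apply: le_trans (le_normcD _ _) _; rewrite normc_real.
by have := hp z Ez; have := hh k.+1 z Ez; move: (normc _) `|_| => u v; lra.
Qed.

(** Open mapping: differences of functions in the ball of [liftable_ball] fill a ball
    around 0. *)
Lemma uniform_lifting : exists2 c, 0 <= c & forall g, {within E, continuous g} ->
  (forall z, E z -> `|g z| <= 1) -> liftable c g.
Proof.
have [k [g0 [r [cg0 r0 hk]]]] := liftable_ball.
exists (r^-1 * (k%:R + k%:R)); first by rewrite mulr_ge0 ?addr_ge0// invr_ge0 ltW.
move=> g cg g1 e e0.
have cgr : {within E, continuous (fun z => g0 z + r * g z)}.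
  apply/subspace_continuousP => z Ez.
  move/subspace_continuousP : cg0 => /(_ z Ez) h0; move/subspace_continuousP : cg => /(_ z Ez) h1.
  by apply: cvgD => //; apply: cvgM => //; exact: cvg_cst.
have er : 0 < r * e / 2 by rewrite divr_gt0// mulr_gt0.
have l1 : liftable k%:R (fun z => g0 z + r * g z).
  apply: hk => // z Ez; rewrite addrAC subrr add0r normrM gtr0_norm//.
  by rewrite ler_piMr ?g1// ltW.
have l0 : liftable k%:R g0 by apply: hk => // z _; rewrite subrr normr0 ltW.
have [p1 pk1 hp1] := l1 _ er; have [p0 pk0 hp0] := l0 _ er.
exists (r^-1%:C%C *: (p1 - p0)).
  have := pmultZ r^-1%:C%C (pmultB pk1 pk0).
  by rewrite normc_real ger0_norm// invr_ge0 ltW.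
move=> z Ez; rewrite poly_funZ poly_funB.
have rN : r%:C%C != 0 :> C by rewrite (inj_eq (@complexI _)) gt_eqF.
have -> : r^-1%:C%C * (poly_fun p1 z - poly_fun p0 z) - (g z)%:C%C =
   r^-1%:C%C * ((poly_fun p1 z - (g0 z + r * g z)%:C%C) - (poly_fun p0 z - (g0 z)%:C%C)).
  rewrite rmorphD rmorphM /= fmorphV; field; exact: rN.
rewrite normcM normc_real gtr0_norm ?invr_gt0// ler_pdivrMl//.
apply: le_trans (le_normcD _ _) _; rewrite normcN.
by have := hp1 z Ez; have := hp0 z Ez; move: (normc _) (normc _) => u v; lra.
Qed.

End UniformLifting.

(** * Unitary invariance and point masses *)

Lemma partial_sum_reindex (K : numFieldType) (W : normedModType K) (I J : choiceType)
    (h : I -> J) (h' : J -> I) (F : J -> W) (t : W) : cancel h h' -> cancel h' h ->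
  summability.partial_sum F @ summability.totally --> t ->
  summability.partial_sum (F \o h) @ summability.totally --> t.
Proof.
move=> hK h'K hF U /hF [A _ hA]; exists (finmap.seq_fset tt [seq h' j | j <- finmap.enum_fset A]) => //.
move=> B /finmap.fsubsetP AB.
change (U (summability.partial_sum (F \o h) B)).
suff -> : summability.partial_sum (F \o h) B =
    summability.partial_sum F (finmap.seq_fset tt [seq h i | i <- finmap.enum_fset B]).
  apply: hA; apply/finmap.fsubsetP => j jA; rewrite finmap.seq_fsetE.
  rewrite -[j]h'K map_f//; apply: AB; rewrite finmap.seq_fsetE.
  exact: (map_f h').
have psE (X : choiceType) (G : X -> W) D :
    summability.partial_sum G D = \sum_(x <- finmap.enum_fset D) G x.
  by rewrite finmap.big_seq_fsetE.
rewrite !psE -(big_map h xpredT F); apply: perm_big; apply: uniq_perm.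
- by rewrite map_inj_uniq ?finmap.fset_uniq//; exact: can_inj hK.
- exact: finmap.fset_uniq.
- by move=> j; rewrite finmap.seq_fsetE.
Qed.

Section UnitaryConjugation.
Context (R : realType) (V : lmodType R[i]) (ip : {dot V for Num.conj}).
Local Notation N := (inorm ip).

Definition unitary_pair (W W' : {linear V -> V}) :=
  [/\ cancel W W', cancel W' W & forall u v, ip (W u) (W v) = ip u v].

Lemma unitary_pairC W W' : unitary_pair W W' -> unitary_pair W' W.
Proof. by move=> [k k' h]; split=> // u v; rewrite -h !k'. Qed.

Lemma onb_unitary W W' B : unitary_pair W W' -> orthonormal_basis ip B ->
  orthonormal_basis ip (W @` B).
Proof.
move=> [k k' h] oB; case: oB => orth tot; split.
  move=> _ _ [u Bu <-] [v Bv <-]; rewrite h orth//; congr (_%:R); congr nat_of_bool.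
  by apply/eqP/eqP => [->//|]; exact: (can_inj k).
move=> u hu; rewrite -(k' u) (_ : W' u = 0) ?linear0//; apply: tot => v Bv.
by rewrite -h k'; apply: hu; exists v.
Qed.

(** The sum of <W S W' e, e> over a basis B is the sum of <S e, e> over the basis W'(B). *)
Lemma is_trace_unitary W W' S t : unitary_pair W W' -> is_trace ip S t ->
  is_trace ip (fun u => W (S (W' u))) t.
Proof.
move=> U hS B oB; have [k k' h] := U.
have := hS _ (onb_unitary (unitary_pairC U) oB).
have m1 (e : B) : (W' @` B) (W' (val e)) by exists (val e) => //; have := valP e; rewrite inE.
have m2 (e : (W' @` B)) : B (W (val e)).
  by have := valP e; rewrite inE => -[u Bu uE]; rewrite -uE k'.
pose f (e : B) : (W' @` B) := SigSub (mem_set (m1 e)).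
pose g (e : (W' @` B)) : B := SigSub (mem_set (m2 e)).
have fK : cancel f g by move=> e; apply: val_inj; rewrite /= k'.
have gK : cancel g f by move=> e; apply: val_inj; rewrite /= k.
move=> /(partial_sum_reindex fK gK).
suff -> : (fun e : B => ip (W (S (W' (val e)))) (val e)) =
    (fun e : W' @` B => ip (S (val e)) (val e)) \o f by [].
by apply/funext => e /=; rewrite -[RHS]h k'.
Qed.

Lemma trace_unitary W W' S : unitary_pair W W' ->
  trace ip (fun u => W (S (W' u))) = trace ip S.
Proof.
move=> U; have [k k' _] := U; rewrite /trace; congr xget; apply/seteqP; split=> t /= ht.
  have := is_trace_unitary (unitary_pairC U) ht; congr is_trace.
  by apply/funext => u; rewrite !k.
exact: (is_trace_unitary U).
Qed.

Lemma trace_class_unitary W W' (T : {linear V -> V}) : unitary_pair W W' -> trace_class ip T ->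
  trace_class ip [the {linear V -> V} of W \o (T \o W')].
Proof.
move=> U [[M hM] [P [[[M' hM'] Pp PT] [B [oB hB]]]]]; have [k k' h] := U.
have h' u v : ip (W u) v = ip u (W' v) by rewrite -{1}(k' v) h.
have NW u : N (W u) = N u by rewrite /inorm h.
have NW' u : N (W' u) = N u by rewrite -NW k'.
split; first by exists M => u; rewrite /= NW -(NW' u).
exists [the {linear V -> V} of W \o (P \o W')]; split.
  split.
  - by exists M' => u; rewrite /= NW -(NW' u).
  - by move=> u; rewrite /= h'; exact: Pp.
  - by move=> u v; rewrite /= k h' PT h.
exists (W @` B); split; first exact: (onb_unitary U oB).
rewrite (esum_image B W)/=; last by move=> u v _ _; exact: (can_inj k).
by under eq_esum do rewrite k h.
Qed.

End UnitaryConjugation.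

Section BallUnitaries.
Context (R : realType) (d : nat).
Local Notation C := (R[i]).
Local Notation Cd := 'rV[C]_d.

Definition polynomial_map (U : Cd -> Cd) := forall i, exists q, forall z, poly_fun q z = (U z) 0 i.

(** Unitary maps of C^d with their inverses; the coordinates are only asked to be
    polynomials, which is what composition of polynomials needs. *)
Definition ball_unitary (U U' : Cd -> Cd) :=
  [/\ cancel U U', cancel U' U, forall z w, cdot (U z) (U w) = cdot z w,
      polynomial_map U & polynomial_map U'].

Lemma ball_unitaryC U U' : ball_unitary U U' -> ball_unitary U' U.
Proof. by move=> [k k' h q q']; split=> // z w; rewrite -h !k'. Qed.

Lemma poly_comp U p : polynomial_map U -> exists q, forall z, poly_fun q z = poly_fun p (U z).
Proof.
move=> hU; elim/mpoly_gen_ind : p => [c|i|p q [p' hp] [q' hq]|p q [p' hp] [q' hq]].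
- by exists (mpoly.mpolyC d c) => z; rewrite !poly_funC.
- by have [q hq] := hU i; exists q => z; rewrite hq poly_funX.
- by exists (p' + q') => z; rewrite !poly_funD hp hq.
- by exists (p' * q') => z; rewrite !poly_funM hp hq.
Qed.

Lemma nsq_unitary U U' z : ball_unitary U U' -> nsq (U z) = nsq z.
Proof. by move=> [_ _ h _ _]; apply: (@complexI R); rewrite -!cdotzz h. Qed.

End BallUnitaries.

Section Composition.
Context (R : realType) (d : nat) (H : rkhs R (unit_ball R d)).
Hypothesis regH : regular_unitarily_invariant H.
Local Notation C := (R[i]).
Local Notation Cd := 'rV[C]_d.
Local Notation ip := (rkhs_dot H).
Local Notation N := (inorm ip).
Variables (U U' : Cd -> Cd).
Hypothesis UU : ball_unitary U U'.

Definition ball_map (z : unit_ball R d) : unit_ball R d :=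
  SigSub (mem_set (proj2 (unit_ballE (U (val z)))
    (eq_ind_r (fun x => x < 1) (proj1 (unit_ballE _) (set_mem (valP z))) (nsq_unitary (val z) UU)))).

Lemma ball_mapE z : val (ball_map z) = U (val z). Proof. by []. Qed.

Lemma composition_contractive f : exists g, rkhs_fun H g = rkhs_fun H f \o ball_map /\ N g <= N f.
Proof.
have [a [_ _ _ ak]] := kernel_series regH.
have kU z w : rkhs_kernel H (ball_map z) (ball_map w) = rkhs_kernel H z w.
  have h1 := ak (ball_map z) (ball_map w); have h2 := ak z w.
  have cU : cdot (val (ball_map z)) (val (ball_map w)) = cdot (val z) (val w).
    by have [_ _ hU _ _] := UU; exact: hU.
  rewrite cU in h1.
  exact: (cvg_unique _ h1 h2).
have [|g [g1 g2]] := @weighted_composition _ _ H (fun=> 1) ball_map 1 ler01 _ f.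
  rewrite (_ : (fun z w => _) = fun _ _ => 0); last first.
    by apply/funext => z; apply/funext => w; rewrite kU rmorph1 expr1n !mul1r subrr.
  by move=> s; rewrite big1// => i _; rewrite big1// => j _; rewrite mulr0.
exists g; rewrite -[N f]mul1r; split=> //; rewrite g1.
by apply/funext => x /=; rewrite mul1r.
Qed.

End Composition.

Section CompositionOperator.
Context (R : realType) (d : nat) (H : rkhs R (unit_ball R d)).
Hypothesis regH : regular_unitarily_invariant H.
Local Notation C := (R[i]).
Local Notation Cd := 'rV[C]_d.
Local Notation ip := (rkhs_dot H).
Local Notation N := (inorm ip).
Variables (U U' : Cd -> Cd).
Hypothesis UU : ball_unitary U U'.
Local Notation bU := (ball_map UU).
Local Notation bU' := (ball_map (ball_unitaryC UU)).

Lemma ball_mapK : cancel bU bU'.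
Proof. by move=> z; apply: val_inj; rewrite !ball_mapE; have [k _ _ _ _] := UU; rewrite k. Qed.

Lemma ball_mapKV : cancel bU' bU.
Proof. by move=> z; apply: val_inj; rewrite !ball_mapE; have [_ k _ _ _] := UU; rewrite k. Qed.

Lemma composition_linear V V' (bV := @ball_map R d V V') (VV : ball_unitary V V') :
  exists W : {linear rkhs_space H -> rkhs_space H},
    (forall f, rkhs_fun H (W f) = rkhs_fun H f \o bV VV) /\ forall f, N (W f) <= N f.
Proof.
have [W hW] := choice (composition_contractive regH VV).
have linW : linear W.
  move=> c f g; apply: (@rkhs_fun_inj _ _ H); rewrite (hW _).1; apply/funext => x.
  by rewrite rkhs_fun_lin (hW f).1 (hW g).1 /= rkhs_fun_lin.
pose Wl : {linear rkhs_space H -> rkhs_space H} :=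
  HB.pack W (GRing.isLinear.Build _ _ _ _ W linW).
by exists Wl; split=> f; have [] := hW f.
Qed.

(** Composition with a unitary map and with its inverse are both contractions, because
    the kernel is unitarily invariant. *)
Lemma composition_unitary : exists W W' : {linear rkhs_space H -> rkhs_space H},
  unitary_pair ip W W' /\ forall f, rkhs_fun H (W f) = rkhs_fun H f \o bU.
Proof.
have [W [hW NW]] := composition_linear UU.
have [W' [hW' NW']] := composition_linear (ball_unitaryC UU).
have k : cancel W W'.
  move=> f; apply: (@rkhs_fun_inj _ _ H); rewrite hW' hW; apply/funext => x /=.
  by rewrite ball_mapKV.
have k' : cancel W' W.
  move=> f; apply: (@rkhs_fun_inj _ _ H); rewrite hW hW'; apply/funext => x /=.
  by rewrite ball_mapK.
have eqN f : N (W f) = N f by apply/eqP; rewrite eq_le NW -{1}(k f) NW'.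
have eqRe f g : complex.Re (ip (W f) (W g)) = complex.Re (ip f g).
  have := inormD_sqr ip (W f) (W g); rewrite -linearD !eqN inormD_sqr.
  by move=> /addrI /mulfI h; rewrite h// pnatr_eq0.
exists W, W'; split=> //; split=> // f g.
apply/eqP; rewrite eq_complex eqRe eqxx /=; apply/eqP.
have h x : complex.Im x = complex.Re (- 'i%C * x) by case: x => a b /=; ring.
by rewrite !h -!ipZl -linearZ eqRe.
Qed.

(** Composition with U transposes to a conjugation of trace class operators by a
    unitary operator. *)
Lemma composition_weakstar : exists comp : {linear Mult H -> Mult H},
  (forall phi z, val (comp phi) z = val phi (bU z)) /\
  continuous (comp : weakstar H -> weakstar H).
Proof.
have [W [W' [WW hW]]] := composition_unitary; have [k k' _] := WW.
have mc (phi : Mult H) : multiplier H (val phi \o bU).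
  apply/asboolP => f; exists (W (mult_op phi (W' f))); rewrite hW mult_opE.
  by rewrite -{2}(k' f) hW.
pose c0 (phi : Mult H) : Mult H := exist _ (val phi \o bU) (mc phi).
have linc : linear c0 by move=> c phi psi; apply: val_inj; apply/funext => z.
pose c : {linear Mult H -> Mult H} := HB.pack c0 (GRing.isLinear.Build _ _ _ _ c0 linc).
have opc phi f : mult_op (c phi) f = W (mult_op phi (W' f)).
  apply: mult_op_unique; rewrite hW mult_opE.
  by rewrite -{2}(k' f) hW.
exists c; split=> //.
apply: continuous_comp_initial => phi.
have FF : Filter (nbhs (phi : weakstar H)) := @nbhs_filter (weakstar H) phi.
have FF' := @fmap_filter _ _ (trace_pairing (H:=H) \o c) _ FF.
apply/cvg_sup => T V [_ [[D oD <-] D0] DV].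
pose T' : traceClass H := exist _ _ (trace_class_unitary (unitary_pairC WW) (svalP T)).
have tE psi : trace_pairing (c psi) T = trace_pairing psi T'.
  rewrite /trace_pairing -[RHS](trace_unitary _ WW); congr trace; apply/funext => u /=.
  by rewrite opc k'.
have oW : open ((fun f : {ptws traceClass H -> R[i]} => f T') @^-1` D).
  rewrite openE => f Df.
  have /cvg_sup /(_ T') h : nbhs (f : {ptws traceClass H -> R[i]}) -->
      (f : {ptws traceClass H -> R[i]}) by exact: cvg_id.
  by apply: h; exists ((fun f : {ptws traceClass H -> R[i]} => f T') @^-1` D); split=> //; exists D.
exists (trace_pairing (H:=H) @^-1` ((fun f : {ptws traceClass H -> R[i]} => f T') @^-1` D)).
split; first by eexists; [exact: oW|].
  by rewrite /preimage /= -tE.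
by move=> psi; rewrite /preimage /= -tE; exact: DV.
Qed.

End CompositionOperator.

Section Pushforward.
Context (R : realType) (dd : measure_display) (T : measurableType dd).
Variables (f g : T -> T).
Hypotheses (mf : measurable_fun setT f) (mg : measurable_fun setT g).
Hypotheses (fK : cancel f g) (gK : cancel g f).
Implicit Types (nu : {charge set T -> \bar R}) (mu : complex_measure R T).

Definition push_charge nu : {charge set T -> \bar R} :=
  measure_function_pushforward__canonical__charge_Charge nu mf.

Definition push_measure mu : complex_measure R T :=
  ComplexMeasure (push_charge (re_part mu)) (push_charge (im_part mu)).

Lemma push_chargeE nu A : push_charge nu A = nu (f @^-1` A). Proof. by []. Qed.

Lemma cmeas_push mu A : cmeas (push_measure mu) A = cmeas mu (f @^-1` A).
Proof. by []. Qed.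

Lemma preimage_measurable (h : T -> T) (A : set T) : measurable_fun setT h -> measurable A ->
  measurable (h @^-1` A : set T).
Proof. by move=> mh mA; rewrite -[_ @^-1` _]setTI; exact: mh. Qed.

Lemma preimageK (A : set T) : f @^-1` (g @^-1` A) = A.
Proof. by apply/seteqP; split=> z /=; rewrite /preimage /= fK. Qed.

Lemma preimageKV (A : set T) : g @^-1` (f @^-1` A) = A.
Proof. by apply/seteqP; split=> z /=; rewrite /preimage /= gK. Qed.

Lemma total_variation_push mu A :
  total_variation (push_measure mu) A = total_variation mu (f @^-1` A).
Proof.
congr ereal_sup; apply/seteqP; split=> _ [F [mF tF FA] <-].
  exists (fun k => f @^-1` F k) => //; split.
  - by move=> k; exact: preimage_measurable.
  - apply/trivIsetP => i j _ _ ij; rewrite -preimage_setI.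
    by move/trivIsetP : tF => /(_ _ _ Logic.I Logic.I ij) ->; rewrite preimage_set0.
  - by rewrite -FA preimage_bigcup.
exists (fun k => g @^-1` F k); last first.
  by under eq_eseriesr do rewrite cmeas_push preimageK.
split.
- by move=> k; exact: preimage_measurable.
- apply/trivIsetP => i j _ _ ij; rewrite -preimage_setI.
  by move/trivIsetP : tF => /(_ _ _ Logic.I Logic.I ij) ->; rewrite preimage_set0.
- by rewrite -preimage_bigcup FA preimageKV.
Qed.

(** The preimage of a Hahn decomposition is one, and Hahn decompositions are unique up
    to null sets. *)
Lemma jordan_part_push nu b A : measurable A ->
  jordan_part (push_charge nu) b A = jordan_part nu b (f @^-1` A).
Proof.
move=> mA; have mfA := preimage_measurable mf mA.
rewrite !jordan_partE// push_chargeE; congr (_ * _)%E.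
have [[mP hP] [mN hN] PN PN0] := hahn_set_decomposition (push_charge nu).
have hD : hahn_decomposition nu (f @^-1` hahn_set (push_charge nu) true)
    (f @^-1` hahn_set (push_charge nu) false).
  split.
  - split=> [|B mB BP]; first exact: preimage_measurable.
    rewrite -(preimageK B) -push_chargeE; apply: hP; first exact: preimage_measurable.
    by move=> z /= /BP; rewrite /preimage /= gK.
  - split=> [|B mB BP]; first exact: preimage_measurable.
    rewrite -(preimageK B) -push_chargeE; apply: hN; first exact: preimage_measurable.
    by move=> z /= /BP; rewrite /preimage /= gK.
  - by rewrite -preimage_setU PN.
  - by rewrite -preimage_setI PN0 preimage_set0.
have [h1 h2] := Hahn_decomposition_uniq hD (hahn_set_decomposition nu) mfA.
by rewrite preimage_setI; case: b.
Qed.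

Lemma parts_push mu i A : measurable A ->
  parts (push_measure mu) i A = parts mu i (f @^-1` A).
Proof. by move=> mA; rewrite /parts /cpart; case: i => -[] b; exact: jordan_part_push. Qed.

Lemma bounded_mfun_push (S : set T) (h : T -> R) : f @^-1` S = S -> bounded_mfun S h -> bounded_mfun S (h \o f).
Proof.
move=> fS [mh [M hM]]; split; first exact: measurableT_comp.
by exists M => z Sz; apply: hM; rewrite -fS in Sz.
Qed.

Lemma carried_integral_push mu S h : measurable S -> f @^-1` S = S -> bounded_cfun S h ->
  carried_integral S (push_measure mu) h = carried_integral S mu (h \o f).
Proof.
move=> mS fS [h1 h2]; apply: eq_bigr => i _; congr (_ * _).
have hR u : bounded_mfun S u ->
    Rintegral (parts (push_measure mu) i) S u = Rintegral (parts mu i) S (u \o f).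
  move=> bu; rewrite /Rintegral; congr fine.
  rewrite (eq_measure_integral
    (measure_function_pushforward__canonical__measure_function_Measure (parts mu i) mf)); last first.
    by move=> A mA _; exact: parts_push.
  rewrite (integral_pushforward mf) ?fS//.
    by apply/measurable_EFinP; case: bu.
  by apply: (bounded_mfun_integrable mS); exact: bounded_mfun_push.
by rewrite !hR.
Qed.

End Pushforward.

Section HenkinPushforward.
Context (R : realType) (d : nat) (H : rkhs R (unit_ball R d)).
Hypothesis regH : regular_unitarily_invariant H.
Local Notation C := (R[i]).
Local Notation Cd := 'rV[C]_d.
Local Notation T := (Borel R d).
Local Notation S := (unit_sphere R d : set T).

Lemma polynomial_map_continuous (U : Cd -> Cd) : polynomial_map U -> continuous U.
Proof.
move=> hU z; have FF : Filter (nbhs z) := @nbhs_filter Cd z.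
apply/cvg_ballP => e e0.
have h (ij : 'I_1 * 'I_d) : \forall x \near z, ball (U z ij.1 ij.2) e (U x ij.1 ij.2).
  case: ij => i j /=; rewrite (ord1 i); have [q hq] := hU j.
  have /cvg_ballP /(_ e e0) := @continuous_poly R d q z.
  by apply: filterS => x; rewrite !hq.
by have := filter_forall FF h; apply: filterS => x hx; split=> // i j; exact: (hx (i, j)).
Qed.

Lemma polynomial_map_measurable (U : Cd -> Cd) : polynomial_map U ->
  measurable_fun setT (U : T -> T).
Proof.
move=> /polynomial_map_continuous /continuousP cU.
apply: (@measurability _ _ T T _ _ (@open Cd)) => //.
move=> _ [B oB <-]; rewrite setTI; apply: open_measurable_Borel; exact: cU.
Qed.

Lemma sphere_unitary U U' : ball_unitary U U' -> U @^-1` S = S.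
Proof.
move=> UU; apply/seteqP; split=> z /=; rewrite /preimage /= => /unit_sphereE h; apply/unit_sphereE.
  by rewrite -(nsq_unitary z UU).
by rewrite (nsq_unitary z UU).
Qed.

(** The functional of the image measure is phi |-> L (phi o U), and the homeomorphism U
    transports regularity. *)
Lemma henkin_push U U' (mU : measurable_fun setT (U : T -> T)) mu : ball_unitary U U' ->
  henkin H mu -> henkin H (push_measure mU mu).
Proof.
move=> UU [[reg1 reg2 reg3] [L [Lc Lp]]].
have [k k' _ pU pU'] := UU.
have mU' := polynomial_map_measurable pU'.
have cU := polynomial_map_continuous pU; have cU' := polynomial_map_continuous pU'.
have oU := proj1 (continuousP _) cU; have oU' := proj1 (continuousP _) cU'.
have tv := total_variation_push mU mU' k k' mu.
have cmp (V V' : Cd -> Cd) (K : set Cd) : cancel V V' -> cancel V' V -> continuous V' ->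
    compact K -> compact (V @^-1` K).
  move=> kV kV' cV' cK; rewrite (_ : V @^-1` K = V' @` K).
    apply: (@continuous_compact Cd Cd V' K _ cK).
    exact: (@continuous_subspaceT Cd Cd K V' cV').
  apply/seteqP; split=> z; first by move=> Kz; exists (V z) => //; exact: kV.
  by move=> [x Kx <-]; rewrite /preimage /= kV'.
have reg1' : total_variation (push_measure mU mu) (~` S) = 0%E.
  by rewrite tv -preimage_setC (sphere_unitary UU).
split; first (split; first exact: reg1').
- move=> A mA; rewrite tv reg2; last exact: preimage_measurable.
  congr ereal_inf; apply/seteqP; split=> _ [W [oW AW] <-].
    exists (U' @^-1` W); last by rewrite tv (preimageK (T := T) k).
    by split; [exact: oU'|move=> z Az; apply: AW; rewrite /preimage /= k'].
  exists (U @^-1` W); last by rewrite tv.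
  by split; [exact: oU|move=> z Az; exact: AW].
- move=> A mA; rewrite tv reg3; last exact: preimage_measurable.
  congr ereal_sup; apply/seteqP; split=> _ [W [cW AW] <-].
    exists (U' @^-1` W); last by rewrite tv (preimageK (T := T) k).
    by split; [exact: (cmp U' U)|move=> z /AW; rewrite /preimage /= k'].
  exists (U @^-1` W); last by rewrite tv.
  by split; [exact: (cmp U U')|move=> z Wz; exact: AW].
have [comp [compE compc]] := composition_weakstar regH UU.
exists [the {scalar Mult H} of (L \o comp : Mult H -> C^o)]; split.
  by move=> phi; exact: (@continuous_comp (weakstar H) (weakstar H) C _ _ phi (compc phi) (Lc _)).
move=> p phi hp; have [q hq] := poly_comp p pU.
have hq' : is_poly q (comp phi) by move=> z; rewrite compE hq hp ball_mapE.
rewrite /= (Lp _ _ hq') (cintegral_carried (@sphere_measurable R d) reg1 (poly_bounded_cfun q)).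
rewrite (cintegral_carried (@sphere_measurable R d) reg1' (poly_bounded_cfun p)).
rewrite (carried_integral_push mU mU' k k' _ (@sphere_measurable R d) (sphere_unitary UU) (poly_bounded_cfun p)).
by congr carried_integral; apply/funext => z; exact: hq.
Qed.

End HenkinPushforward.

Section Householder.
Context (R : realType) (d : nat).
Local Notation C := (R[i]).
Local Notation Cd := 'rV[C]_d.

Lemma cdotDl (x y w : Cd) : cdot (x + y) w = cdot x w + cdot y w.
Proof. by rewrite /cdot -big_split; apply: eq_bigr => i _; rewrite mxE mulrDl. Qed.

Lemma cdotBl (x y w : Cd) : cdot (x - y) w = cdot x w - cdot y w.
Proof. by rewrite cdotDl -scaleN1r cdotZl mulN1r. Qed.

Lemma nsq_eq0 (v : Cd) : nsq v = 0 -> v = 0.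
Proof.
move=> v0; apply/rowP => i; rewrite mxE; apply: eq0_normc; apply/eqP.
by have := coord_le_nsq v i; rewrite v0 => h; rewrite -sqrf_eq0 eq_le h sqr_ge0.
Qed.

Lemma ball_unitary_comp (F F' G G' : Cd -> Cd) : ball_unitary F F' -> ball_unitary G G' ->
  ball_unitary (F \o G) (G' \o F').
Proof.
move=> [k k' h p p'] [l l' m q q']; split.
- exact: can_comp.
- exact: can_comp.
- by move=> z w /=; rewrite h m.
- by move=> i; have [r hr] := p i; have [s hs] := poly_comp r q; exists s => z; rewrite hs hr.
- by move=> i; have [r hr] := q' i; have [s hs] := poly_comp r p'; exists s => z; rewrite hs hr.
Qed.

Lemma ball_unitary_scale (c : C) : normc c = 1 ->
  ball_unitary (fun z : Cd => c *: z) (fun z => Num.conj c *: z).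
Proof.
move=> c1; have cc : c * Num.conj c = 1 by rewrite mul_conjc c1 expr1n.
have pm (b : C) : polynomial_map (fun z : Cd => b *: z).
  by move=> i; exists (b *: mpoly.mpolyX C (mpoly.mnm1 i)) => z; rewrite poly_funZ poly_funX mxE.
split=> //.
- by move=> z; rewrite scalerA mulrC cc scale1r.
- by move=> z; rewrite scalerA cc scale1r.
- by move=> z w; rewrite cdotZl cdotZr mulrA cc mul1r.
Qed.

(** For [v = 0] the quotient is 0 and the reflection is the identity. *)
Definition reflection (v w : Cd) : Cd := w - ((2 / nsq v)%:C%C * cdot w v) *: v.

Lemma cdot_poly (v : Cd) : exists q, forall z, poly_fun q z = cdot z v.
Proof.
suff h (s : seq 'I_d) : exists q, forall z : Cd, poly_fun q z = \sum_(i <- s) z 0 i * Num.conj (v 0 i).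
  exact: h.
elim: s => [|i s [q hq]].
  by exists (mpoly.mpolyC d 0) => z; rewrite poly_funC big_nil.
exists (Num.conj (v 0 i) *: mpoly.mpolyX C (mpoly.mnm1 i) + q) => z.
by rewrite poly_funD poly_funZ poly_funX big_cons hq mulrC.
Qed.

Lemma ball_unitary_reflection v : ball_unitary (reflection v) (reflection v).
Proof.
set b : C := (2 / nsq v)%:C%C.
have bv : b * b * cdot v v = 2 * b.
  rewrite cdotzz /b -!rmorphM /= -[2 in RHS](rmorph_nat (real_complex R)) -rmorphM /=; congr (_%:C%C).
  have [->|n0] := eqVneq (nsq v) 0; first by rewrite invr0; ring.
  by field.
have bc : Num.conj b = b by rewrite /b cnjR.
have rr : cancel (reflection v) (reflection v).
  move=> w; rewrite /reflection -/b cdotBl cdotZl -[X in _ = X]subr0 -addrA; congr (_ + _).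
  rewrite -opprD -scalerDl; apply/eqP; rewrite eqr_opp scaler_eq0; apply/orP; left; apply/eqP.
  rewrite (_ : _ + _ = 2 * b * cdot w v - b * b * cdot v v * cdot w v); last by ring.
  by rewrite bv subrr.
have pr : polynomial_map (reflection v).
  move=> i; have [q hq] := cdot_poly v.
  exists (mpoly.mpolyX C (mpoly.mnm1 i) - (b * v 0 i) *: q) => z.
  by rewrite poly_funB poly_funZ poly_funX hq /reflection !mxE; ring.
split=> // z w; rewrite /reflection -/b cdotBl !cdotBr !cdotZl !cdotZr rmorphM /= bc -(cdotC v w).
rewrite -[RHS]addr0 -addrA; congr (_ + _).
rewrite (_ : _ + _ = (b * b * cdot v v - 2 * b) * cdot z v * cdot v w); last by ring.
by rewrite bv subrr !mul0r.
Qed.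

(** Rotate y by a scalar to make its inner product with x real, and then reflect. *)
Lemma unitary_transitive (y x : Cd) : nsq y = 1 -> nsq x = 1 ->
  exists U U', ball_unitary U U' /\ U y = x.
Proof.
move=> y1 x1.
have [c [c1 [r hr]]] : exists c : C, normc c = 1 /\ exists r : R, c * cdot y x = r%:C%C.
  have [->|s0] := eqVneq (cdot y x) 0.
    by exists 1; rewrite normc1; split=> //; exists 0; rewrite mulr0.
  set s := cdot y x in s0 *; have n0 : normc s != 0.
    by apply: contra s0 => /eqP /eq0_normc ->.
  exists ((normc s)^-1%:C%C * Num.conj s); split.
    by rewrite normcM normc_real normc_conj ger0_norm ?invr_ge0 ?normc_ge0// mulVf.
  exists (normc s); rewrite -mulrA [Num.conj s * s]mulrC mul_conjc -rmorphM /=.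
  by congr (_%:C%C); rewrite expr2 mulrA mulVf// mul1r.
set w := c *: y; set v := w - x.
exists (reflection v \o (fun z => c *: z)), ((fun z => Num.conj c *: z) \o reflection v).
split.
  exact: (ball_unitary_comp (ball_unitary_reflection v) (ball_unitary_scale c1)).
have wx : cdot w x = r%:C%C by rewrite /w cdotZl.
have xw : cdot x w = r%:C%C by rewrite cdotC wx cnjR.
have ww : cdot w w = 1 by rewrite cdotzz /w nsqZ c1 y1 expr1n mulr1.
have xx : cdot x x = 1 by rewrite cdotzz x1.
have wv : cdot w v = (1 - r)%:C%C by rewrite /v cdotBr ww wx rmorphB.
have nv : nsq v = 2 * (1 - r).
  apply: (@complexI R); rewrite -cdotzz {1}/v cdotBl wv /v cdotBr xw xx.
  by rewrite -(rmorph1 (real_complex R)) -!rmorphB /=; congr (_%:C%C); ring.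
rewrite /= /reflection -/w wv -rmorphM /=.
have [r1|r1] := eqVneq (1 - r) 0.
  have v0 : v = 0 by apply: nsq_eq0; rewrite nv r1 mulr0.
  by rewrite v0 scaler0 subr0; apply/eqP; rewrite -subr_eq0 -/v v0.
rewrite nv (_ : _ * _ = 1); last by field.
by rewrite scale1r /v subKr.
Qed.

End Householder.

Section NoPointMass.
Context (R : realType) (d : nat) (H : rkhs R (unit_ball R d)).
Hypothesis regH : regular_unitarily_invariant H.
Hypothesis exnull : exists E0 : set 'rV[R[i]]_d, E0 !=set0 /\ totally_null H E0.

Lemma singleton_measurable (y : 'rV[R[i]]_d) : measurable ([set y] : set (Borel R d)).
Proof.
rewrite (_ : [set y] = (fun z : Borel R d => nsq (z - y)) @^-1` [set 0]).
  have := continuous_measurable_Borel (@continuous_nsq R d y) measurableT (@measurable_set1 _ (0 : R)).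
  by rewrite setTI.
apply/seteqP; split=> z /=; rewrite /preimage /=.
  move=> ->; rewrite subrr; apply: (@complexI R); rewrite -cdotzz.
  by rewrite /cdot big1// => i _; rewrite mxE mul0r.
by move=> /nsq_eq0 /subr0_eq.
Qed.

(** A nonempty totally null set contains a point, to which unitary maps move every other
    point of the sphere. *)
Lemma henkin_no_point_mass mu y i : henkin H mu -> nsq y = 1 -> parts mu i [set y] = 0%E.
Proof.
move=> hmu y1; have [E0 [[x E0x] [mE0 sE0 nE0]]] := exnull.
have /unit_sphereE x1 := sE0 _ E0x.
have [U [U' [UU Uy]]] := unitary_transitive y1 x1.
have [k k' _ pU pU'] := UU.
have mU := polynomial_map_measurable pU; have mU' := polynomial_map_measurable pU'.
have := nE0 _ (henkin_push regH mU UU hmu).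
rewrite (total_variation_push mU mU' k k'); have mUE := preimage_measurable mU mE0.
move=> /(total_variation_eq0 _ mUE) /(_ i) h.
apply/eqP; rewrite eq_le measure_ge0 andbT -h le_measure ?inE//.
  exact: singleton_measurable.
by move=> z ->; rewrite /preimage /= Uy.
Qed.

End NoPointMass.

(** * Normal families of polynomials *)

Section LocalCompactness.
Context (R : realType) (d : nat).
Local Notation C := (R[i]).
Local Notation Cd := 'rV[C]_d.
Implicit Types (p : mpoly.mpoly d C) (z v : Cd).

Lemma nsq_perturb z v (eta : R) : nsq z <= 1 -> 0 <= eta <= 1 ->
  (forall i, normc (v 0 i) <= eta) -> nsq (z + v) <= nsq z + 3 * d%:R * eta.
Proof.
move=> z1 /andP[e0 e1] hv.
have -> : nsq z + 3 * d%:R * eta = \sum_(i < d) (normc (z 0 i) ^+ 2 + 3 * eta).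
  by rewrite big_split /= sumr_const card_ord -[_ *+ d]mulr_natl; congr (_ + _); ring.
apply: ler_sum => i _; rewrite mxE.
have zi : normc (z 0 i) <= 1.
  rewrite -(ler_pXn2r (n:=2))// ?nnegrE ?normc_ge0// expr1n.
  exact: le_trans (coord_le_nsq z i) z1.
have := le_normcD (z 0 i) (v 0 i); have := hv i.
move: (normc_ge0 (z 0 i + v 0 i)) (normc_ge0 (z 0 i)) (normc_ge0 (v 0 i)) zi.
move: (normc _) (normc _) (normc _) => a b c a0 b0 c0 b1 ce abc; nra.
Qed.

(** Cauchy's estimate on discs of radius rho - 1 about the points of the segment
    from z to z + v. *)
Lemma poly_perturb p z v (K s eta rho : R) : bounded_by p K 1 -> 0 <= K -> nsq z <= s ->
  0 <= eta -> (forall i, normc (v 0 i) <= eta) -> 1 < rho -> rho * eta <= 1 ->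
  s + 3 * d%:R * (rho * eta) <= 1 ->
  nsq (z + v) <= 1 /\ normc (poly_fun p (z + v) - poly_fun p z) <= K / (rho - 1).
Proof.
move=> hp K0 zs e0 hv rho1 re1 hs; have rho0 : 0 < rho by lra.
have dre : 0 <= 3 * d%:R * (rho * eta) by rewrite !mulr_ge0// ltW.
have z1 : nsq z <= 1 by lra.
have inball (x : C) : normc x <= rho -> nsq (z + x *: v) <= 1.
  move=> xr; have h i : normc ((x *: v) 0 i) <= rho * eta.
    by rewrite mxE normcM ler_pM ?normc_ge0.
  apply: le_trans (nsq_perturb z1 _ h) _; first by rewrite re1 mulr_ge0// ltW.
  by apply: le_trans hs; rewrite lerD2r.
split; first by rewrite -[v]scale1r; apply: inball; rewrite normc1 ltW.
have hd (t : R) : 0 <= t <= 1 ->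
    normc ((line p z v)^`()).[t%:C%C] <= K / (rho - 1).
  move=> /andP[t0 t1]; rewrite horner_deriv_line.
  apply: (dirder_cauchy (s := 1)) => //; first by rewrite subr_gt0.
  move=> x xr; rewrite -addrA -scalerDl; apply: inball.
  apply: le_trans (le_normcD _ _) _; rewrite normc_real ger0_norm// xr; lra.
have := poly_mean_value ler01 hd; rewrite subr0 mulr1 !horner_line.
by rewrite rmorph1 rmorph0 scale1r scale0r addr0.
Qed.

(** Round real and imaginary parts to a grid of mesh at most eta / 2. *)
Lemma ball_net (eta : R) : 0 < eta -> exists (G : finType) (g : G -> Cd),
  forall z, nsq z <= 1 -> exists q, forall i, normc (g q 0 i - z 0 i) <= eta.
Proof.
move=> e0; pose M := (Num.truncn (2 / eta)).+1.
have M0 : 0 < M%:R :> R by rewrite ltr0n.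
have Me : M%:R^-1 + M%:R^-1 <= eta.
  have : 2 / eta < M%:R by exact: truncnS_gt.
  rewrite ltr_pdivrMr// => h; rewrite -mulr2n -[_ *+ 2]mulr_natl ler_pdivrMr//.
  by rewrite mulrC ltW.
pose rnd (x : R) : 'I_(2 * M).+1 := inord (Num.truncn (M%:R * (x + 1))).
pose unrnd (a : 'I_(2 * M).+1) : R := a%:R / M%:R - 1.
have hr (x : R) : `|x| <= 1 -> `|unrnd (rnd x) - x| <= M%:R^-1.
  rewrite ler_norml => /andP[x0 x1].
  have y0 : 0 <= M%:R * (x + 1) by rewrite mulr_ge0//; lra.
  have y1 : (Num.truncn (M%:R * (x + 1)) < (2 * M).+1)%N.
    have := ler_wpM2l (ltW M0) x1; rewrite mulr1 => h.
    by rewrite ltnS truncn_le_nat -natr1 natrM mulrDr mulr1; lra.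
  have /andP[t0 t1] := truncn_itv y0.
  rewrite /unrnd /rnd inordK// -[M%:R^-1]mul1r.
  set k := Num.truncn _ in t0 t1 *.
  rewrite (_ : _ - x = (k%:R - M%:R * (x + 1)) / M%:R); last by field; rewrite gt_eqF.
  rewrite normrM [`|_^-1|]gtr0_norm ?invr_gt0// ler_pM2r ?invr_gt0//.
  by rewrite ler_norml; move: t1; rewrite -natr1 => t1; apply/andP; split; lra.
exists {ffun 'I_d -> 'I_(2 * M).+1 * 'I_(2 * M).+1}.
exists (fun q : {ffun 'I_d -> 'I_(2 * M).+1 * 'I_(2 * M).+1} => \row_i (unrnd (q i).1 +i* unrnd (q i).2)%C) => z z1.
exists [ffun i => (rnd (complex.Re (z 0 i)), rnd (complex.Im (z 0 i)))] => i.
rewrite mxE ffunE /=; apply: le_trans (normc_ReIm _) _; rewrite ReD ReN ImD ImN /=.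
have zi : normc (z 0 i) <= 1.
  rewrite -(ler_pXn2r (n:=2))// ?nnegrE ?normc_ge0// expr1n.
  exact: le_trans (coord_le_nsq z i) z1.
apply: le_trans Me; apply: lerD; apply: hr; apply: le_trans zi.
  exact: normc_Re.
exact: normc_Im.
Qed.

Lemma pigeonhole (F : finType) (c : nat -> F) : exists n m, n != m /\ c n = c m.
Proof.
have [/injectiveP inj|/injectivePn [n [m nm cnm]]] :=
    boolP (injectiveb (fun i : 'I_#|F|.+1 => c i)); last by exists (val n), (val m).
by have := leq_card _ inj; rewrite card_ord ltnn.
Qed.

(** Montel's theorem in the form that is needed. The values at the points of a fine net,
    rounded, take finitely many positions, so two terms of the sequence share them; by
    Cauchy's estimate they are then close in between. *)
Lemma poly_montel (p : nat -> mpoly.mpoly d C) (K s e : R) : 0 <= K ->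
  (forall n, bounded_by (p n) K 1) -> s < 1 -> 0 < e ->
  exists n m, n != m /\ bounded_by (p n - p m) e s.
Proof.
move=> K0 hp s1 e0.
wlog s0 : s s1 / 0 <= s => [h|].
  have [s0|s0] := leP 0 s; first exact: h.
  have [n [m [nm hnm]]] := h 0 ltr01 (lexx 0); exists n, m; split=> // z zs.
  by apply: hnm; rewrite (le_trans zs)// ltW.
(* rho makes Cauchy's bound at most e / 4, and eta keeps the discs in the unit ball *)
pose rho := 1 + 4 * (K + 1) / e.
have rp : 0 < rho - 1 by rewrite /rho addrC addKr divr_gt0// mulr_gt0//; lra.
have rho1 : 1 < rho by rewrite -subr_gt0.
have Kr : K / (rho - 1) <= e / 4.
  rewrite /rho addrC addKr invf_div mulrA ler_pdivrMr; last by lra.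
  rewrite (_ : e / 4 * (4 * (K + 1)) = (K + 1) * e); last by field.
  by rewrite ler_pM2r//; lra.
have D0 : 0 < 3 * d%:R + 1 :> R by rewrite ltr_wpDl// mulr_ge0.
pose eta := (1 - s) / (3 * d%:R + 1) / rho.
have re : rho * eta = (1 - s) / (3 * d%:R + 1) by rewrite /eta mulrC divfK// gt_eqF//; lra.
have eta0 : 0 < eta by rewrite /eta !divr_gt0// ?subr_gt0//; lra.
have d0 : 0 <= d%:R :> R by [].
have re1 : rho * eta <= 1 by rewrite re ler_pdivrMr// mul1r; lra.
have hs : s + 3 * d%:R * (rho * eta) <= 1.
  have : rho * eta * (3 * d%:R + 1) = 1 - s by rewrite re divfK// gt_eqF.
  have : 0 <= rho * eta by rewrite mulr_ge0 ?ltW//; lra.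
  by move: (rho * eta) => x x0 h; nra.
have [G [g hg]] := ball_net eta0.
pose M := (Num.truncn (4 / e)).+1.
have M0 : 0 < M%:R :> R by rewrite ltr0n.
have Me : M%:R^-1 + M%:R^-1 <= e / 2.
  have : 4 / e < M%:R by exact: truncnS_gt.
  rewrite ltr_pdivrMr// => h; rewrite -mulr2n -[_ *+ 2]mulr_natl ler_pdivrMr//.
  by rewrite mulrAC ler_pdivlMr//; lra.
pose L := (Num.truncn (2 * K * M%:R)).+1.
pose rnd (x : R) : 'I_L := inord (Num.truncn (M%:R * (x + K))).
have hr (x y : R) : `|x| <= K -> `|y| <= K -> rnd x = rnd y -> `|x - y| <= M%:R^-1.
  have aux (x' : R) : `|x'| <= K -> 0 <= M%:R * (x' + K) /\ (Num.truncn (M%:R * (x' + K)) < L)%N.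
    rewrite ler_norml => /andP[x0 x1].
    split; first by rewrite mulr_ge0//; lra.
    have h1 : 0 <= 2 * K * M%:R by rewrite !mulr_ge0.
    rewrite ltnS; apply: le_truncn.
    by rewrite [leRHS]mulrC ler_pM2l//; lra.
  move=> /aux [x0 x1] /aux [y0 y1] /(congr1 val); rewrite /= !inordK// => xy.
  have /andP[a1 a2] := truncn_itv x0; have := truncn_itv y0; rewrite -xy => /andP[b1 b2].
  rewrite -[M%:R^-1]mul1r ler_pdivlMr// -{1}(gtr0_norm M0) -normrM ler_norml.
  move: a1 a2 b1 b2; set k := Num.truncn _; rewrite -natr1 !mulrDr => a1 a2 b1 b2.
  by apply/andP; split; rewrite mulrBl ![_ * M%:R]mulrC; lra.
have [n [m [nm cnm]]] := pigeonhole (fun n => [ffun q : G =>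
  (rnd (complex.Re (poly_fun (p n) (g q))), rnd (complex.Im (poly_fun (p n) (g q))))]).
exists n, m; split=> // z zs.
have [q hq] := hg z (le_trans zs (ltW s1)).
have hv i : normc ((g q - z) 0 i) <= eta by rewrite !mxE; exact: hq.
have pert k := poly_perturb (hp k) K0 zs (ltW eta0) hv rho1 re1 hs.
have gz : z + (g q - z) = g q by rewrite addrC subrK.
rewrite gz in pert.
have [g1 hn] := pert n; have [_ hm] := pert m.
have := congr1 (fun f : {ffun _ -> _} => f q) cnm; rewrite !ffunE => -[cR cI].
have hR : `|complex.Re (poly_fun (p n) (g q)) - complex.Re (poly_fun (p m) (g q))| <= M%:R^-1.
  by apply: hr => //; apply: le_trans (normc_Re _) _; apply: hp.
have hI : `|complex.Im (poly_fun (p n) (g q)) - complex.Im (poly_fun (p m) (g q))| <= M%:R^-1.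
  by apply: hr => //; apply: le_trans (normc_Im _) _; apply: hp.
have hg2 : normc (poly_fun (p n) (g q) - poly_fun (p m) (g q)) <= e / 2.
  by apply: le_trans (normc_ReIm _) _; rewrite ReD ReN ImD ImN (le_trans (lerD hR hI)).
rewrite poly_funB.
have -> : poly_fun (p n) z - poly_fun (p m) z =
   (poly_fun (p n) (g q) - poly_fun (p m) (g q)) - (poly_fun (p n) (g q) - poly_fun (p n) z) +
   (poly_fun (p m) (g q) - poly_fun (p m) z) by ring.
apply: le_trans (le_normcD _ _) _.
apply: le_trans (lerD (le_normcD _ _) hm) _; rewrite normcN.
apply: le_trans (lerD (lerD hg2 hn) (lexx _)) _.
by move: Kr; move: (K / _) => x; lra.
Qed.

End LocalCompactness.

(** * Separated sequences for measures without atoms *)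

Section Splitting.
Context (R : realType) (d : nat).
Local Notation C := (R[i]).
Local Notation Cd := 'rV[C]_d.
Local Notation T := (Borel R d).
Local Notation S := (unit_sphere R d : set T).
Variable lambda : {finite_measure set T -> \bar R}.
Local Notation K := (total_integral S (fun _ : unit => lambda)).
Let mS := @sphere_measurable R d.

Lemma total_integral_indic (A : set T) : measurable A -> A `<=` S -> K \1_A = fine (lambda A).
Proof.
move=> mA AS; rewrite /total_integral big_const card_unit /= addr0 /Rintegral.
by rewrite integral_indic// setIidl.
Qed.

(** Balls that shrink to a point of measure zero. *)
Lemma small_ball (E : set T) x (eta : R) : measurable E -> lambda [set x] = 0%E -> 0 < eta ->
  exists2 r : R, 0 < r & (lambda (E `&` [set z : Cd | (nsq (z - x) < r)%R]) <= eta%:E)%E.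
Proof.
move=> mE x0 e0.
pose B n : set T := [set z : Cd | nsq (z - x) < n.+1%:R^-1].
have mB n : measurable (B n).
  rewrite (_ : B n = (fun z : T => nsq (z - x)) @^-1` `]-oo, n.+1%:R^-1[).
    rewrite -[_ @^-1` _]setTI.
    exact: (continuous_measurable_Borel (@continuous_nsq R d x)).
  by apply/seteqP; split=> z; rewrite /B /preimage /= in_itv.
have mEB n : measurable (E `&` B n) by exact: measurableI.
have mI : measurable (\bigcap_n (E `&` B n)) by exact: bigcapT_measurable.
have h := @nonincreasing_cvg_mu _ _ _ lambda (fun n => E `&` B n) _ mEB mI _.
have I0 : lambda (\bigcap_n (E `&` B n)) = 0%E.
  apply/eqP; rewrite eq_le measure_ge0 andbT -x0 le_measure ?inE//.
    exact: singleton_measurable.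
  move=> z hz; apply/eqP; rewrite -subr_eq0; apply/eqP; apply: nsq_eq0.
  apply/eqP; rewrite eq_le nsq_ge0 andbT leNgt; apply/negP => z0.
  have [n hn] := invS_lt z0; have [_] := hz n Logic.I.
  by rewrite /B /= => /lt_trans /(_ (hn n (leqnn n))); rewrite ltxx.
have {}h : lambda (E `&` B n) @[n --> \oo] --> 0%E.
  rewrite -I0; apply: h; first by rewrite ltey_eq fin_num_measure.
  move=> m n mn; apply/subsetPset; apply: setIS => z; rewrite /B /= => /lt_le_trans; apply.
  by rewrite lef_pV2 ?posrE ?ltr0n// ler_nat ltnS.
have /fine_cvgP [_ /cvgrPdist_lt /(_ _ e0) [n _ /(_ n (leqnn n))]] := h.
rewrite sub0r normrN => hn; exists n.+1%:R^-1; first by rewrite invr_gt0 ltr0n.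
rewrite -[X in (X <= _)%E](fineK (fin_num_measure lambda _ (mEB n))) lee_fin.
exact: le_trans (ler_norm _) (ltW hn).
Qed.

(** By compactness, finitely many of the balls of [small_ball] cover E. *)
Lemma small_cover (E : set T) (eta : R) : compact (E : set Cd) -> measurable E ->
  (forall x, E x -> lambda [set x] = 0%E) -> 0 < eta ->
  exists (l : seq Cd) (B : Cd -> set T), [/\ forall x, measurable (B x), forall x, B x `<=` E,
    forall x, x \in l -> (lambda (B x) <= eta%:E)%E &
    E `<=` [set z | exists2 x, x \in l & B x z]].
Proof.
move=> cE mE na e0.
have [|r hr] := @choice Cd R (fun x r => 0 < r /\ (E x ->
    (lambda (E `&` [set z : Cd | (nsq (z - x) < r)%R]) <= eta%:E)%E)).
  move=> x; have [Ex|nEx] := pselect (E x); last by exists 1.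
  by have [r r0 hr] := small_ball mE (na x Ex) e0; exists r.
pose B x : set Cd := [set z : Cd | nsq (z - x) < r x].
have oB x : open (B x).
  rewrite (_ : B x = (fun z : Cd => nsq (z - x)) @^-1` `]-oo, r x[).
    have /continuousP := @continuous_nsq R d x; apply; exact: interval_open.
  by apply/seteqP; split=> z; rewrite /B /preimage /= in_itv.
have nsq0 x : nsq (x - x : Cd) = 0.
  by rewrite subrr; apply: (@complexI R); rewrite -cdotzz /cdot big1// => i _; rewrite mxE mul0r.
have : cover_compact (E : set Cd) by rewrite -compact_cover.
move=> /(_ Cd E B (fun x _ => oB x)) [|D DE cD].
  by move=> x Ex; exists x => //; rewrite /B /= nsq0; have [] := hr x.
exists (finmap.enum_fset D), (fun x => E `&` B x); split.
- by move=> x; apply: measurableI => //; exact: open_measurable_Borel.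
- by move=> x z [].
- by move=> x xD; have [_] := hr x; apply; have := DE x xD; rewrite inE.
- by move=> z Ez; have [x xD Bz] := cD z Ez; exists x.
Qed.

(** Pieces of measure at most eta get signs one after the other, +1 off A and -1 on A. Each
    sign is chosen so that the cross terms in the sum of squares of the scalar
    products with the f k are nonpositive in total; only the squares of the new
    contributions accumulate. *)
Lemma greedy_signs (eta : R) (l : seq Cd) (B : Cd -> set T) N (f : 'I_N -> T -> R) :
  0 <= eta -> (forall x, measurable (B x)) -> (forall x, B x `<=` S) ->
  (forall x, x \in l -> (lambda (B x) <= eta%:E)%E) ->
  (forall k, bounded_mfun S (f k)) -> (forall k z, S z -> `|f k z| <= 1) ->
  exists A : set T, [/\ measurable A, A `<=` [set z | exists2 x, x \in l & B x z],
    measurable ([set z | exists2 x, x \in l & B x z] : set T) &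
    \sum_k K (fun z => (\1_[set z | exists2 x, x \in l & B x z] z - 2 * \1_A z) * f k z) ^+ 2
      <= N%:R * eta * K \1_[set z | exists2 x, x \in l & B x z]].
Proof.
move=> eta0 mB BS; elim: l => [|x l IH] small bf f1.
  have -> : [set z | exists2 x, x \in [::] & B x z] = set0.
    by apply/seteqP; split=> z // [x]; rewrite in_nil.
  exists set0; split=> //.
  rewrite big1 => [|k _].
    by rewrite !mulr_ge0// total_integral_ge0// => z _; rewrite indicE in_set0.
  rewrite (_ : (fun z => _) = fun=> 0); first by rewrite (total_integral_cst mS) mul0r expr0n.
  by apply/funext => z; rewrite indic0 mulr0 subrr mul0r.
have [|//|//|A [mA AX mX hA]] := IH; first by move=> y yl; apply: small; rewrite inE yl orbT.
set X := [set z | exists2 x, x \in l & B x z] in AX mX hA.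
pose D := B x `\` X.
have mD : measurable D by exact: measurableD.
have X'E : [set z | exists2 y, y \in x :: l & B y z] = X `|` D.
  apply/seteqP; split=> z /=.
    move=> [y]; rewrite inE => /predU1P[->|yl] Bz; last by left; exists y.
    by have [Xz|nXz] := pselect (X z); [left|right].
  by move=> [[y yl Bz]|[Bz _]]; [exists y => //; rewrite inE yl orbT|exists x => //; rewrite inE eqxx].
have iX z : \1_(X `|` D) z = \1_X z + \1_D z :> R.
  rewrite !indicE in_setU /D in_setD; case: (z \in X) => /=; first by rewrite andbF addr0.
  by rewrite andbT add0r.
have iA z : \1_(A `|` D) z = \1_A z + \1_D z :> R.
  rewrite !indicE in_setU /D in_setD; have := AX z; case: (asboolP (A z)) => Az Xz.
    by rewrite (mem_set Az) (mem_set (Xz Az)) /= andbF addr0.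
  by rewrite (memNset Az) add0r.
have b1 (Y : set T) : measurable Y -> bounded_mfun S (\1_Y : T -> R) by exact: bounded_mfun_indic.
have bw : bounded_mfun S (fun z : T => \1_X z - 2 * \1_A z : R).
  exact: (bounded_mfunB (b1 X mX) (bounded_mfunM (bounded_mfun_cst S 2) (b1 A mA))).
pose a k := K (fun z => (\1_X z - 2 * \1_A z) * f k z).
pose b k := K (fun z => \1_D z * f k z).
pose t := K \1_D.
have t0 : 0 <= t by apply: total_integral_ge0 => z _; rewrite indicE.
have te : t <= eta.
  rewrite /t total_integral_indic//; last by move=> z [/BS].
  rewrite -lee_fin fineK ?fin_num_measure//; apply: le_trans (small x _).
    by rewrite le_measure ?inE//; exact: subDsetl.
  by rewrite inE eqxx.
have bt k : b k ^+ 2 <= eta * t.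
  have h : `|b k| <= t.
    rewrite ler_norml -mulN1r /t -(total_integralZ mS); last exact: b1.
    have bD : bounded_mfun S (fun z => \1_D z * f k z) by apply: bounded_mfunM => //; exact: b1.
    have sD z : S z -> - \1_D z <= \1_D z * f k z <= \1_D z.
      move=> /(f1 k z); rewrite ler_norml indicE; case: (z \in D) => /=;
        by rewrite ?mul1r ?mul0r ?oppr0 ?lexx.
    apply/andP; split; apply: (total_integral_le mS) => //.
    - by apply: bounded_mfunM; [exact: bounded_mfun_cst|exact: b1].
    - by move=> z /sD /andP[]; rewrite mulN1r.
    - exact: b1.
    - by move=> z /sD /andP[].
  rewrite -real_normK ?num_real// expr2; apply: le_trans (ler_pM _ _ h h) _ => //.
  by rewrite ler_wpM2r.
have KX : K \1_(X `|` D) = K \1_X + t.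
  rewrite /t -(total_integralD mS); [|exact: b1|exact: b1].
  by congr total_integral; apply/funext => z; exact: iX.
pose s := \sum_k a k * b k.
have step (c : R) (A' : set T) : c ^+ 2 = 1 -> c * s <= 0 -> measurable A' -> A' `<=` X `|` D ->
    (forall z, \1_(X `|` D) z - 2 * \1_A' z = (\1_X z - 2 * \1_A z) + c * \1_D z) ->
    \sum_k K (fun z => (\1_(X `|` D) z - 2 * \1_A' z) * f k z) ^+ 2 <=
      N%:R * eta * K \1_(X `|` D).
  move=> c2 cs mA' A'X hw.
  have -> : \sum_k K (fun z => (\1_(X `|` D) z - 2 * \1_A' z) * f k z) ^+ 2 =
      \sum_k (a k ^+ 2 + b k ^+ 2) + 2 * (c * s).
    rewrite /s !mulr_sumr -big_split; apply: eq_bigr => k _ /=.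
    have -> : K (fun z => (\1_(X `|` D) z - 2 * \1_A' z) * f k z) = a k + c * b k.
      rewrite /b -(total_integralZ mS); last by apply: bounded_mfunM => //; exact: b1.
      rewrite /a -(total_integralD mS); last 2 first.
      - exact: bounded_mfunM.
      - by apply: bounded_mfunM; [exact: bounded_mfun_cst|apply: bounded_mfunM => //; exact: b1].
      by congr total_integral; apply/funext => z; rewrite hw; ring.
    rewrite sqrrD exprMn c2 mul1r; ring.
  rewrite big_split /= KX.
  have h1 : \sum_k b k ^+ 2 <= N%:R * eta * t.
    apply: le_trans (ler_sum _ (fun k _ => bt k)) _.
    by rewrite sumr_const card_ord -[_ *+ N]mulr_natl mulrA.
  by have := hA; rewrite -/(a _); move: (N%:R * eta) (K \1_X) h1 => u v; rewrite mulrDr; lra.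
rewrite X'E; have [s0|s0] := leP s 0.
  exists A; split=> //; [by move=> z /AX Xz; left|exact: measurableU|].
  apply: (step 1) => //; rewrite ?expr1n ?mul1r//; first by move=> z /AX Xz; left.
  by move=> z; rewrite iX; ring.
exists (A `|` D); split=> //.
- exact: measurableU.
- by move=> z [/AX Xz|Dz]; [left|right].
- exact: measurableU.
- apply: (step (-1)) => //; rewrite ?sqrrN ?expr1n ?mulN1r ?oppr_le0 ?ltW//.
  + exact: measurableU.
  + by move=> z [/AX Xz|Dz]; [left|right].
  + by move=> z; rewrite iX iA; ring.
Qed.

End Splitting.

Section Separated.
Context (R : realType) (d : nat).
Local Notation C := (R[i]).
Local Notation Cd := 'rV[C]_d.
Local Notation T := (Borel R d).
Local Notation S := (unit_sphere R d : set T).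
Variable lambda : {finite_measure set T -> \bar R}.
Local Notation K := (total_integral S (fun _ : unit => lambda)).
Let mS := @sphere_measurable R d.
Variable E : set T.
Hypotheses (cE : compact (E : set Cd)) (mE : measurable E) (ES : E `<=` S).
Hypothesis noatom : forall x, E x -> lambda [set x] = 0%E.
Local Notation a := (K \1_E).
Hypothesis a0 : 0 < a.

(** Competitors for an infinite L2-separated sequence: bounded by 1, with mean square
    almost as large as that of a function of modulus 1. *)
Definition spread (u : T -> R) := [/\ real_shiftable u, forall z, S z -> `|u z| <= 1 &
  3 / 4 * a <= K (fun z => \1_E z * u z ^+ 2)].

(** The balanced signs 1 - 2 1_A of [greedy_signs], with 1_A replaced by a shiftable
    approximant psi, are almost orthogonal to the given functions. *)
Lemma spread_extend N (f : 'I_N -> T -> R) : (forall k, spread (f k)) ->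
  exists2 u, spread u & forall k, a <= K (fun z => \1_E z * (u z - f k z) ^+ 2).
Proof.
move=> hf.
have N0 : 0 < N%:R + 1 :> R by rewrite ltr_wpDl.
(* makes N eta a at most (a / 8)^2 *)
pose eta := a / (64 * (N%:R + 1)).
have eta0 : 0 < eta by rewrite divr_gt0// mulr_gt0.
have [l [B [mB BE small EX]]] := small_cover cE mE noatom eta0.
have bf k : bounded_mfun S (f k) by have [[]] := hf k.
have f1 k z : S z -> `|f k z| <= 1 by have [_ h _] := hf k; exact: h.
have [A] := greedy_signs (ltW eta0) mB (fun x => subset_trans (BE x) ES) small bf f1.
have XE : [set z | exists2 x, x \in l & B x z] = E.
  by apply/seteqP; split=> z; [move=> [x _ /BE]|exact: EX].
rewrite XE => -[mA AE _ hA].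
have a16 : 0 < a / 16 by rewrite divr_gt0.
have [_ /(_ _ a16) [psi [p1 p2 p3]]] := approximable_measurable (fun _ : unit => lambda) mA.
pose u z := 1 - 2 * psi z.
have su : real_shiftable u.
  apply: real_shiftableB; first exact: real_shiftable_cst.
  by apply: real_shiftableM => //; exact: real_shiftable_cst.
have u1 z : S z -> `|u z| <= 1.
  by move=> /p2 /andP[x0 x1]; rewrite ler_norml /u; apply/andP; split; lra.
have bE : bounded_mfun S (\1_E : T -> R) by exact: bounded_mfun_indic.
have bA : bounded_mfun S (\1_A : T -> R) by exact: bounded_mfun_indic.
have bu : bounded_mfun S u by exact: su.2.
have bu2 : bounded_mfun S (fun z => \1_E z * u z ^+ 2).
  by under eq_fun do rewrite expr2; apply: bounded_mfunM => //; exact: bounded_mfunM.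
have bd : bounded_mfun S (fun z => `|\1_A z - psi z|).
  by apply: bounded_mfun_norm; apply: bounded_mfunB => //; exact: p1.2.
have bcd (c : R) : bounded_mfun S (fun z => c * `|\1_A z - psi z|).
  by apply: bounded_mfunM => //; exact: bounded_mfun_cst.
have AEz z : (z \in A) -> (z \in E) by rewrite !inE => /AE.
have ku : 3 / 4 * a <= K (fun z => \1_E z * u z ^+ 2).
  have : a <= K (fun z => \1_E z * u z ^+ 2 + 4 * `|\1_A z - psi z|).
    apply: (total_integral_le mS) => //; first exact: bounded_mfunD.
    move=> z /p2 /andP[x0 x1]; rewrite !indicE /u.
    have := AEz z; case: (z \in A); case: (z \in E) => //= h; last 3 first.
    - by have := h isT.
    - rewrite sub0r normrN ger0_norm//; nra.
    - by rewrite mul0r add0r mulr_ge0.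
    - rewrite ger0_norm; nra.
  rewrite (total_integralD mS)// (total_integralZ mS)//.
  by move: p3; move: (K _) (K (fun z => `| _ |)) (K (fun z => _ * _)) => x y w; lra.
exists u => // k.
have bfk2 : bounded_mfun S (fun z => \1_E z * f k z ^+ 2).
  by under eq_fun do rewrite expr2; apply: bounded_mfunM => //; exact: bounded_mfunM.
have bufk : bounded_mfun S (fun z => \1_E z * (u z * f k z)).
  by apply: bounded_mfunM => //; exact: bounded_mfunM.
pose x := K (fun z => (\1_E z - 2 * \1_A z) * f k z).
have x8 : x <= a / 8.
  have hx : x ^+ 2 <= (a / 8) ^+ 2.
    apply: le_trans (_ : N%:R * eta * a <= _).
      by apply: le_trans hA; rewrite (bigD1 k)//= lerDl sumr_ge0// => j _; exact: sqr_ge0.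
    have -> : N%:R * eta * a = (N%:R / (N%:R + 1)) * (a / 8) ^+ 2.
      by rewrite /eta; field; rewrite gt_eqF.
    by rewrite ler_piMl ?sqr_ge0// ler_pdivrMr// mul1r lerDl.
  have h8 : 0 <= a / 8 by rewrite divr_ge0// ltW.
  have := ler_norm x; move/le_trans; apply.
  by rewrite -(ler_pXn2r (n:=2))// ?nnegrE// real_normK ?num_real.
have kuf : K (fun z => \1_E z * (u z * f k z)) <= a / 4.
  have bw : bounded_mfun S (fun z => (\1_E z - 2 * \1_A z) * f k z).
    apply: bounded_mfunM => //; apply: bounded_mfunB => //.
    by apply: bounded_mfunM => //; exact: bounded_mfun_cst.
  apply: le_trans (_ : K (fun z => (\1_E z - 2 * \1_A z) * f k z + 2 * `|\1_A z - psi z|) <= _).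
    apply: (total_integral_le mS) => //; first exact: bounded_mfunD.
    move=> z Sz; have /andP[x0 x1] := p2 z Sz.
    have := f1 k z Sz; rewrite ler_norml => /andP[g0 g1].
    rewrite !indicE /u; have := AEz z; case: (z \in A); case: (z \in E) => //= h; last 3 first.
    - by have := h isT.
    - rewrite sub0r normrN ger0_norm//; nra.
    - by rewrite !mulr0 subrr mul0r mul0r add0r mulr_ge0.
    - rewrite ger0_norm; nra.
  rewrite (total_integralD mS)// -/x (total_integralZ mS)//.
  by move: p3; move: x8; move: x (K (fun z => `| _ |)) => x y; lra.
have -> : (fun z => \1_E z * (u z - f k z) ^+ 2) = fun z => (\1_E z * u z ^+ 2 + \1_E z * f k z ^+ 2)
    + (-2) * (\1_E z * (u z * f k z)) by apply/funext => z; ring.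
rewrite (total_integralD mS); [|exact: bounded_mfunD|]; last first.
  by apply: bounded_mfunM => //; exact: bounded_mfun_cst.
rewrite (total_integralD mS)// (total_integralZ mS)//.
have [_ _ hk] := hf k.
have aux (w1 w2 w3 w4 : R) : 3 / 4 * w1 <= w2 -> 3 / 4 * w1 <= w3 -> w4 <= w1 / 4 ->
  w1 <= w2 + w3 + -2 * w4 by lra.
exact: aux ku hk kuf.
Qed.

Lemma spread_sequence : exists u : nat -> T -> R, (forall n, spread (u n)) /\
  forall n m, n != m -> a <= K (fun z => \1_E z * (u n z - u m z) ^+ 2).
Proof.
have [ext hext] := @choice (nat * (nat -> T -> R)) (T -> R) (fun x u =>
    (forall k, (k < x.1)%N -> spread (x.2 k)) ->
    spread u /\ forall k, (k < x.1)%N -> a <= K (fun z => \1_E z * (u z - x.2 k z) ^+ 2))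
  (fun x => match pselect (forall k, (k < x.1)%N -> spread (x.2 k)) with
    | left h => let: ex_intro2 u su hu := @spread_extend x.1 (fun k => x.2 k) (fun k => h k (ltn_ord k)) in
        ex_intro _ u (fun _ => conj su (fun k kx => hu (Ordinal kx)))
    | right h => ex_intro _ (fun=> 0) (fun h' => False_ind _ (h h')) end).
(* hist n lists the first n functions, followed by zeros *)
pose hist := fix hist n := if n is m.+1 then
  (fun k => if k == m then ext (m, hist m) else hist m k) else (fun _ _ => 0 : R).
pose u n := ext (n, hist n).
have hE n k : (k < n)%N -> hist n k = u k.
  elim: n => // n IH; rewrite ltnS leq_eqVlt => /predU1P[->|kn] /=; first by rewrite eqxx.
  by rewrite ltn_eqF// IH.
have su n : spread (u n).
  have [m] := ubnP n; elim: m n => // m IH n; rewrite ltnS => nm.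
  apply: (hext (n, hist n) _).1 => k /= kn; rewrite hE//.
  by apply: IH; exact: leq_trans nm.
have lt n k : (k < n)%N -> a <= K (fun z => \1_E z * (u n z - u k z) ^+ 2).
  move=> kn; have [_ h] := hext (n, hist n) (fun k kn => eq_ind_r spread (su k) (hE n k kn)).
  by have := h k kn; rewrite /= hE.
exists u; split=> // n m; rewrite neq_ltn => /orP[nm|]; last exact: lt.
have := lt _ _ nm; congr (_ <= K _); apply/funext => z; ring.
Qed.

End Separated.

(** * Conclusion *)

Section NullSquares.
Context (R : realType) (d : nat) (H : rkhs R (unit_ball R d)).
Hypothesis regH : regular_unitarily_invariant H.
Local Notation C := (R[i]).
Local Notation Cd := 'rV[C]_d.
Local Notation T := (Borel R d).
Local Notation S := (unit_sphere R d : set T).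
Variable E : set Cd.
Hypotheses (ES : E `<=` unit_sphere R d) (cE : compact E) (mE : measurable (E : set T)).
Hypothesis surjE : restriction_surjective H E.
Variable lambda : {finite_measure set T -> \bar R}.
Hypothesis noatom : forall x, E x -> lambda [set x] = 0%E.
Local Notation K := (total_integral S (fun _ : unit => lambda)).
Local Notation a := (K \1_(E : set T)).
Hypothesis a0 : 0 < a.
Let mS := @sphere_measurable R d.

Lemma pmult_bounded_by p c : pmult H p c -> bounded_by p c 1.
Proof.
move=> hp; apply: closed_ball_limit; last exact: (pmult_sup regH).
exact: (@continuous_subspaceT Cd C _ _ (@continuous_poly R d p)).
Qed.

(** Lift an L2-separated sequence u_n to polynomials of bounded multiplier norm. Two of
    them are close on a large ball by [poly_montel], while their difference stays
    large on E. Squaring makes the limits on E nonnegative. *)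
Lemma null_squares : exists c f (h : nat -> T -> R), [/\ nullseq f, forall j, pmult H (f j) c,
  (forall j, bounded_mfun S (h j)) /\ (forall j z, S z -> 0 <= h j z <= 4),
  forall j, a <= K (fun z => \1_(E : set T) z * h j z) &
  forall e : R, 0 < e -> exists j0, forall j, (j0 <= j)%N -> forall z, E z ->
    normc (poly_fun (f j) z - (h j z)%:C%C) <= e].
Proof.
have [u [su sep]] := spread_sequence cE mE ES noatom a0.
have [c c0 hc] := uniform_lifting regH ES surjE.
have u1 n z : S z -> `|u n z| <= 1 by have [_ h _] := su n; exact: h.
have lift n : liftable H E c (u n).
  apply: hc => [|z Ez]; last exact/u1/ES.
  apply: (@continuous_subspaceT Cd R); have [[[_ cu] _] _ _] := su n; exact: cu.
pose e j : R := j.+1%:R^-1.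
have ej j : 0 < e j by exact: invS_gt0.
have e1 j : e j <= 1 by rewrite /e invf_le1 ?ler1n ?ltr0n.
have step j : exists x : mpoly.mpoly d C * (nat * nat), [/\ x.2.1 != x.2.2, pmult H x.1 (c + c),
    bounded_by x.1 (e j) (1 - e j) &
    forall z, E z -> normc (poly_fun x.1 z - (u x.2.1 z - u x.2.2 z)%:C%C) <= 2 * e j].
  have [p hp] := @choice nat (mpoly.mpoly d C) (fun n p => pmult H p c /\
     forall z, E z -> normc (poly_fun p z - (u n z)%:C%C) <= e j)
     (fun n => let: ex_intro2 p p1 p2 := lift n (e j) (ej j) in ex_intro _ p (conj p1 p2)).
  have s1 : 1 - e j < 1 by have := ej j; lra.
  have [n [m [nm hnm]]] := poly_montel c0 (fun n => pmult_bounded_by (hp n).1) s1 (ej j).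
  exists (p n - p m, (n, m)); split=> //=; first exact: pmultB (hp n).1 (hp m).1.
  move=> z Ez; rewrite poly_funB.
  have -> : poly_fun (p n) z - poly_fun (p m) z - (u n z - u m z)%:C%C =
     (poly_fun (p n) z - (u n z)%:C%C) - (poly_fun (p m) z - (u m z)%:C%C).
    by rewrite rmorphB /=; ring.
  apply: le_trans (le_normcD _ _) _; rewrite normcN.
  by have := (hp n).2 z Ez; have := (hp m).2 z Ez; lra.
have [x hx] := choice step.
pose q j := (x j).1; pose v j z := u (x j).2.1 z - u (x j).2.2 z.
exists ((c + c) * (c + c)), (fun j => q j * q j), (fun j z => v j z ^+ 2).
have bq j : bounded_by (q j) (c + c) 1 by have [_ h _ _] := hx j; exact: pmult_bounded_by.
have bv j z : S z -> `|v j z| <= 2.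
  by move=> Sz; rewrite (le_trans (ler_normB _ _))// -[2]/(1 + 1) lerD// u1.
split.
- split.
    exists ((c + c) * (c + c)); first by rewrite mulr_ge0// addr_ge0.
    by move=> j z z1; rewrite poly_funM normcM ler_pM ?normc_ge0//; exact: bq.
  move=> s s1 r r0.
  have m0 : 0 < Num.min (1 - s) r by rewrite lt_min subr_gt0 s1 r0.
  have [j0 hj] := invS_lt m0; exists j0 => j /hj; rewrite -/(e j) lt_min => /andP[h1 h2] z zs.
  have [_ _ hq _] := hx j.
  have h3 : normc (poly_fun (q j) z) <= e j by apply: hq; lra.
  rewrite poly_funM normcM; apply: le_trans (ltW h2); rewrite -[e j]mulr1.
  by rewrite ler_pM ?normc_ge0//; exact: le_trans h3 (e1 j).
- by move=> j; have [_ h _ _] := hx j; exact: pmultM.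
- split=> [j|j z Sz].
    have bu n : bounded_mfun S (u n) by have [[]] := su n.
    under eq_fun do rewrite expr2.
    by apply: bounded_mfunM; exact: bounded_mfunB.
  rewrite sqr_ge0 /= -real_normK ?num_real// -[4](_ : 2 ^+ 2 = _ :> R); last by ring.
  by rewrite lerXn2r ?nnegrE// bv.
- by move=> j; have [h _ _ _] := hx j; exact: sep.
move=> r r0; have D0 : 0 < 2 * (c + c + 2) by rewrite mulr_gt0// ltr_wpDl// addr_ge0.
have [j0 hj] := invS_lt (divr_gt0 r0 D0); exists j0 => j /hj; rewrite -/(e j) => h z Ez.
have -> : poly_fun (q j * q j) z - (v j z ^+ 2)%:C%C =
    (poly_fun (q j) z - (v j z)%:C%C) * (poly_fun (q j) z + (v j z)%:C%C).
  by rewrite poly_funM rmorphXn /=; ring.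
have [_ _ _ hq] := hx j; rewrite normcM.
have Sz := ES Ez; have /unit_sphereE z1 := Sz.
apply: le_trans (_ : 2 * e j * (c + c + 2) <= _).
  rewrite ler_pM ?normc_ge0//; first exact: hq.
  apply: le_trans (le_normcD _ _) _; rewrite normc_real lerD// ?bv//.
  by apply: bq; rewrite z1.
by move: h; rewrite ltr_pdivlMr// => /ltW; apply: le_trans; rewrite mulrCA mulrA.
Qed.

(** The mean of k nonnegative functions that are almost orthogonal and have mean at least
    that of 1 would have negative variance. *)
Lemma not_asymptotically_orthogonal (h : nat -> T -> R) :
  (forall j, bounded_mfun S (h j)) -> (forall j z, S z -> 0 <= h j z <= 4) ->
  (forall j, a <= K (fun z => \1_(E : set T) z * h j z)) ->
  ~ (forall e : R, 0 < e -> exists m0, forall m, (m0 <= m)%N -> exists n0, forall n, (n0 <= n)%N ->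
       K (fun z => \1_(E : set T) z * (h n z * h m z)) <= e).
Proof.
move=> bh h4 ha orth.
have a4 : 0 < a / 4 by rewrite divr_gt0.
have [m0 hm0] := orth _ a4.
have bE : bounded_mfun S (\1_(E : set T) : T -> R) by exact: bounded_mfun_indic.
have bEM (g : T -> R) : bounded_mfun S g -> bounded_mfun S (fun z => \1_(E : set T) z * g z).
  by move=> bg; exact: bounded_mfunM bE bg.
have sum k : exists G : T -> R, [/\ bounded_mfun S G,
    k%:R * a <= K (fun z => \1_(E : set T) z * G z),
    K (fun z => \1_(E : set T) z * (G z * G z)) <= 16 * k%:R * a + k%:R ^+ 2 * (a / 4) &
    exists n0, forall n, (n0 <= n)%N ->
      K (fun z => \1_(E : set T) z * (h n z * G z)) <= k%:R * (a / 4)].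
  elim: k => [|k [G [bG G1 G2 [n0 hn0]]]].
    exists (fun=> 0); split.
    - exact: bounded_mfun_cst.
    - by rewrite mul0r total_integral_ge0// => z _; rewrite mulr0.
    - rewrite (_ : (fun z => _) = fun=> 0); last by apply/funext => z; rewrite !mulr0.
      by rewrite (total_integral_cst mS) expr0n !mul0r mulr0 mul0r addr0.
    - exists 0%N => n _; rewrite (_ : (fun z => _) = fun=> 0); last by apply/funext => z; rewrite !mulr0.
      by rewrite (total_integral_cst mS) !mul0r.
  pose m := maxn n0 m0.
  have [n1 hn1] := hm0 m (leq_maxr _ _).
  have bhh n : bounded_mfun S (fun z => h n z * h m z) by exact: bounded_mfunM.
  have bhG n : bounded_mfun S (fun z => h n z * G z) by exact: bounded_mfunM.
  have bGG : bounded_mfun S (fun z => G z * G z) by exact: bounded_mfunM.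
  exists (fun z => G z + h m z); split.
  - exact: bounded_mfunD.
  - rewrite (_ : (fun z => _) = fun z => \1_(E : set T) z * G z + \1_(E : set T) z * h m z).
      rewrite (total_integralD mS); [|exact: bEM|exact: bEM].
      by rewrite -natr1 mulrDl mul1r lerD.
    by apply/funext => z; rewrite mulrDr.
  - rewrite (_ : (fun z => _) = fun z => (\1_(E : set T) z * (G z * G z) +
        2 * (\1_(E : set T) z * (h m z * G z))) + \1_(E : set T) z * (h m z * h m z)); last first.
      by apply/funext => z; ring.
    have b2 : bounded_mfun S (fun z => 2 * (\1_(E : set T) z * (h m z * G z))).
      by apply: bounded_mfunM; [exact: bounded_mfun_cst|exact: bEM].
    rewrite (total_integralD mS); [|apply: bounded_mfunD => //; exact: bEM|exact: bEM].
    rewrite (total_integralD mS); [|exact: bEM|by []].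
    rewrite (total_integralZ mS); last exact: bEM.
    have h16 : K (fun z => \1_(E : set T) z * (h m z * h m z)) <= 16 * a.
      rewrite -(total_integralZ mS)//; apply: (total_integral_le mS).
      - exact: bEM.
      - by apply: bounded_mfunM => //; exact: bounded_mfun_cst.
      - move=> z /(h4 m z) /andP[z0 z4]; rewrite mulrC ler_wpM2r ?indicE//; nra.
    have hG := hn0 m (leq_maxl _ _).
    have aux (w1 w2 w3 b k' : R) : w1 <= 16 * k' * b + k' ^+ 2 * (b / 4) -> w2 <= k' * (b / 4) ->
      w3 <= 16 * b -> 0 < b -> w1 + 2 * w2 + w3 <= 16 * (k' + 1) * b + (k' + 1) ^+ 2 * (b / 4).
      by rewrite !expr2; nra.
    by rewrite -[k.+1%:R]natr1; exact: aux.
  - exists (maxn n0 n1) => n; rewrite geq_max => /andP[nn0 nn1].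
    rewrite (_ : (fun z => _) = fun z => \1_(E : set T) z * (h n z * G z) +
        \1_(E : set T) z * (h n z * h m z)); last by apply/funext => z; ring.
    rewrite (total_integralD mS); [|exact: bEM|exact: bEM].
    by rewrite -natr1 mulrDl mul1r lerD// ?hn0// hn1.
(* for k functions the variance gives a <= 16 a / k + a / 4, which fails for k = 64 *)
have [G [bG G1 G2 _]] := sum 64%N.
have bGG : bounded_mfun S (fun z => G z * G z) by exact: bounded_mfunM.
have : 0 <= K (fun z => \1_(E : set T) z * (G z * G z) + (-128) * (\1_(E : set T) z * G z) + 4096 * \1_(E : set T) z).
  apply: total_integral_ge0 => z _.
  rewrite (_ : _ + _ = \1_(E : set T) z * (G z - 64) ^+ 2); last by ring.
  by rewrite mulr_ge0 ?sqr_ge0// indicE.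
have b1 (c : R) g : bounded_mfun S g -> bounded_mfun S (fun z => c * g z).
  by move=> bg; apply: bounded_mfunM => //; exact: bounded_mfun_cst.
rewrite (total_integralD mS); [|by apply: bounded_mfunD; [exact: bEM|apply: b1; exact: bEM]|exact: b1].
rewrite (total_integralD mS); [|exact: bEM|by apply: b1; exact: bEM].
rewrite (total_integralZ mS); last exact: bEM.
rewrite (total_integralZ mS)//.
have aux (w1 w2 b : R) : 64 * b <= w1 -> w2 <= 16 * 64 * b + 64 ^+ 2 * (b / 4) -> 0 < b ->
  0 <= w2 + -128 * w1 + 4096 * b -> False by lra.
exact: aux.
Qed.

End NullSquares.

Section PartIntegrals.
Context (R : realType) (dd : measure_display) (T : measurableType dd).
Variables (S : set T) (mS : measurable S).
Implicit Types (mu : complex_measure R T) (g : T -> R).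

Lemma Rintegral_null (m : {finite_measure set T -> \bar R}) (B : set T) g :
  measurable B -> m B = 0%E -> bounded_mfun S g -> Rintegral m S (fun z => \1_B z * g z) = 0.
Proof.
move=> mB B0 bg; have [_ [M hM]] := bg.
have bB : bounded_mfun S (\1_B : T -> R) by exact: bounded_mfun_indic.
have bM : bounded_mfun S (fun z => M * \1_B z : R).
  by apply: bounded_mfunM => //; exact: bounded_mfun_cst.
have bBg : bounded_mfun S (fun z => \1_B z * g z) by exact: bounded_mfunM.
have I0 : Rintegral m S (\1_B) = 0.
  rewrite /Rintegral integral_indic// -[RHS]/(fine (0%E : \bar R)); congr fine.
  apply/eqP; rewrite eq_le measure_ge0 andbT -B0 le_measure ?inE//.
  exact: measurableI.
apply/eqP; rewrite -normr_le0.
apply: le_trans (le_normr_Rintegral mS (bounded_mfun_integrable mS m bBg)) _.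
apply: le_trans (le_Rintegral mS (bounded_mfun_integrable mS m (bounded_mfun_norm bBg))
  (bounded_mfun_integrable mS m bM) _) _.
  move=> z Sz; rewrite normrM [`|\1_B z|]ger0_norm ?indicE// mulrC.
  by rewrite ler_wpM2r// hM.
by rewrite RintegralZl ?I0 ?mulr0//; exact: bounded_mfun_integrable.
Qed.

(** Restricting to the Hahn set that carries one of the four parts kills the part of
    opposite sign, while the other two contribute in an orthogonal direction of the
    complex plane. *)
Lemma part_integral_le mu i (E : set T) g : measurable E -> bounded_mfun S g ->
  Rintegral (parts mu i) S (fun z => \1_E z * g z) <=
  normc (carried_integral S mu (fun z => (\1_(E `&` part_set mu i) z * g z)%:C%C)).
Proof.
move=> mE bg; set A := E `&` part_set mu i.
have mP j : measurable (part_set mu j) by exact: hahn_set_measurable.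
have mA : measurable A by exact: measurableI.
pose m j := Rintegral (parts mu j) S (fun z => \1_A z * g z).
have bA : bounded_mfun S (\1_A : T -> R) by exact: bounded_mfun_indic.
have other : parts mu (i.1, ~~ i.2) A = 0%E.
  have := jordan_part_other (cpart mu i) (~~ i.2) mE; rewrite negbK.
  by rewrite /parts /A /part_set /cpart.
have m0 : m (i.1, ~~ i.2) = 0 by exact: Rintegral_null.
have -> : Rintegral (parts mu i) S (fun z => \1_E z * g z) = m i.
  have mD : measurable (E `\` A) by exact: measurableD.
  have D0 : parts mu i (E `\` A) = 0%E.
    have h := jordan_part_other (cpart mu i) i.2 mE.
    apply/eqP; rewrite eq_le measure_ge0 andbT -h le_measure ?inE//.
      by apply: measurableI => //; exact: hahn_set_measurable.
    move=> z [Ez nA]; split=> //.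
    have [_ _ PN _] := hahn_set_decomposition (cpart mu i).
    have : (hahn_set (cpart mu i) true `|` hahn_set (cpart mu i) false) z by rewrite PN.
    have nP : ~ hahn_set (cpart mu i) i.2 z by move=> Pz; apply: nA.
    by move: nP; case: i.2 => /= nP [].
  have -> : (fun z => \1_E z * g z) = fun z => \1_A z * g z + \1_(E `\` A) z * g z.
    apply/funext => z; rewrite -mulrDl; congr (_ * _).
    rewrite !indicE in_setD /A in_setI; case: (z \in E) => /=; last by rewrite addr0.
    by case: (z \in _); rewrite ?addr0 ?add0r.
  rewrite RintegralD//.
  - by rewrite (Rintegral_null mD D0 bg) addr0.
  - by apply: bounded_mfun_integrable => //; exact: bounded_mfunM.
  - apply: bounded_mfun_integrable => //; apply: bounded_mfunM => //.
    exact: bounded_mfun_indic.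
have -> : carried_integral S mu (fun z => (\1_A z * g z)%:C%C) =
   \sum_(x : bool) \sum_(y : bool) part_coef R (x, y) * (m (x, y))%:C%C.
  rewrite pair_bigA; apply: eq_bigr => -[x y] _; congr (_ * _).
  by rewrite /m /=; apply/eqP; rewrite eq_complex /= eqxx /= (Rintegral_cst _ mS) mul0r.
rewrite !big_bool /part_coef /jordan_sign.
set X := (X in normc X).
have ReX : complex.Re X = m (true, true) - m (true, false) by rewrite /X /=; ring.
have ImX : complex.Im X = m (false, true) - m (false, false) by rewrite /X /=; ring.
have hR := normc_Re X; have hI := normc_Im X; rewrite ReX in hR; rewrite ImX in hI.
suff aux (j : bool * bool) (w : bool * bool -> R) (x : R) : w (j.1, ~~ j.2) = 0 ->
    `|w (true, true) - w (true, false)| <= x -> `|w (false, true) - w (false, false)| <= x ->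
    w j <= x by exact: aux m0 hR hI.
case: j => -[] [] /= ->; rewrite ?subr0 ?sub0r ?normrN => h1 h2.
- exact: le_trans (ler_norm _) h1.
- exact: le_trans (ler_norm _) h1.
- exact: le_trans (ler_norm _) h2.
- exact: le_trans (ler_norm _) h2.
Qed.

End PartIntegrals.

Section Main.
Context (R : realType) (d : nat) (H : rkhs R (unit_ball R d)).
Hypothesis regH : regular_unitarily_invariant H.
Local Notation C := (R[i]).
Local Notation Cd := 'rV[C]_d.
Local Notation T := (Borel R d).
Local Notation S := (unit_sphere R d : set T).

(** The topology is the entrywise one, so points are separated by coordinates. *)
Lemma row_hausdorff : hausdorff_space Cd.
Proof.
move=> p q pq; apply/rowP => i; apply: (@norm_hausdorff C C^o) => A B pA qB.
have := pq ((fun z : Cd => z 0 i) @^-1` A) ((fun z : Cd => z 0 i) @^-1` B)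
  (@continuous_coord R d i p _ pA) (@continuous_coord R d i q _ qB).
by move=> [z [Az Bz]]; exists (z 0 i).
Qed.

Lemma compact_measurable (E : set Cd) : compact E -> measurable (E : set T).
Proof. by move=> cE; apply: closed_measurable_Borel; apply: compact_closed => //; exact: row_hausdorff. Qed.

(** On E, replace h by f up to a small error and restrict to the Hahn set of the part, so
    that [henkin_null_pair] applies. *)
Lemma henkin_asymptotically_orthogonal mu i c f (h : nat -> T -> R) (E : set T) :
  henkin H mu -> nullseq f -> (forall j, pmult H (f j) c) -> measurable E -> E `<=` S ->
  (forall j, bounded_mfun S (h j)) -> (forall j z, S z -> 0 <= h j z <= 4) ->
  (forall e : R, 0 < e -> exists j0, forall j, (j0 <= j)%N -> forall z, E z ->
    normc (poly_fun (f j) z - (h j z)%:C%C) <= e) ->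
  forall e : R, 0 < e -> exists m0, forall m, (m0 <= m)%N -> exists n0, forall n, (n0 <= n)%N ->
  total_integral S (fun _ : unit => parts mu i) (fun z => \1_E z * (h n z * h m z)) <= e.
Proof.
move=> hmu nf fc mE ES bh h4 hf e e0; have mS := @sphere_measurable R d.
pose A := E `&` part_set mu i.
have mA : measurable A by apply: measurableI => //; exact: hahn_set_measurable.
have bA : bounded_mfun S (\1_A : T -> R) by exact: bounded_mfun_indic.
pose K1 := total_integral S (parts mu) (fun=> 1).
have K10 : 0 <= K1 by apply: total_integral_ge0.
have D0 : 0 < 36 * K1 + 1 by lra.
(* the integrands will differ by at most 9 t on A, the integrals by 18 t K1 *)
pose t := Num.min 1 (e / (36 * K1 + 1)).
have t0 : 0 < t by rewrite lt_min ltr01 divr_gt0.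
have t1 : t <= 1 by rewrite ge_min lexx.
have te : 18 * t * K1 <= e / 2.
  have : t <= e / (36 * K1 + 1) by rewrite ge_min lexx orbT.
  by rewrite ler_pdivlMr//; nra.
have [j0 hj] := hf t t0.
have e2 : 0 < e / 2 by rewrite divr_gt0.
have [m0 hm0] := henkin_null_pair regH hmu nf fc mA e2.
exists (maxn j0 m0) => m; rewrite geq_max => /andP[jm /hm0 [n0 hn0]].
exists (maxn j0 n0) => n; rewrite geq_max => /andP[jn /hn0 hI].
have bhh : bounded_mfun S (fun z => h n z * h m z) by exact: bounded_mfunM.
have := part_integral_le mS mu i mE bhh; rewrite -/A => hP.
rewrite /total_integral big_const card_unit /= addr0.
apply: le_trans hP _.
pose u z := poly_fun (f n) z * poly_fun (f m) z.
have bu : bounded_cfun S u by apply: bounded_cfunM; exact: poly_bounded_cfun.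
have bAu : bounded_cfun S (fun z => (\1_A z)%:C%C * u z).
  by apply: bounded_cfunM => //; exact: bounded_cfun_real.
have bAv : bounded_cfun S (fun z => (\1_A z)%:C%C * ((h n z * h m z)%:C%C - u z)).
  apply: bounded_cfunM; first exact: bounded_cfun_real.
  by apply: bounded_cfunB => //; exact: bounded_cfun_real.
rewrite (_ : (fun z => _) = fun z => (\1_A z)%:C%C * u z + (\1_A z)%:C%C * ((h n z * h m z)%:C%C - u z)).
  rewrite carried_integralD//; apply: le_trans (le_normcD _ _) _; rewrite [e]splitr lerD//.
  apply: le_trans (carried_integral_le (h := fun=> 9 * t) mu mS bAv (bounded_mfun_cst _ _) _) _; last first.
    by rewrite (total_integral_cst mS) -/K1; apply: le_trans te; rewrite le_eqVlt; apply/orP; left; apply/eqP; ring.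
  move=> z Sz; rewrite normcM normc_real indicE.
  have [zA|zA] := boolP (z \in A); last by rewrite normr0 mul0r mulr_ge0 ?ltW.
  rewrite normr1 mul1r; have Ez : E z by move: zA; rewrite inE => -[].
  have := hj n jn z Ez; have := hj m jm z Ez; have := h4 n z Sz; have := h4 m z Sz.
  move=> /andP[a0 a4] /andP[b0 b4] hm hn.
  have -> : (h n z * h m z)%:C%C - u z =
     - ((poly_fun (f n) z - (h n z)%:C%C) * (poly_fun (f m) z - (h m z)%:C%C) +
        (h m z)%:C%C * (poly_fun (f n) z - (h n z)%:C%C) +
        (h n z)%:C%C * (poly_fun (f m) z - (h m z)%:C%C)) by rewrite /u rmorphM /=; ring.
  rewrite normcN; apply: le_trans (le_normcD _ _) _.
  apply: le_trans (lerD (le_normcD _ _) (lexx _)) _; rewrite !normcM !normc_real !ger0_norm//.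
  have x0 := normc_ge0 (poly_fun (f n) z - (h n z)%:C%C).
  have y0 := normc_ge0 (poly_fun (f m) z - (h m z)%:C%C).
  move: (normc _) (normc _) hm hn x0 y0 => x y hm hn x0 y0; nra.
by apply/funext => z; rewrite [in LHS]rmorphM /=; ring.
Qed.

End Main.

Theorem theorem1p7 (R : realType) (d : nat) (H : rkhs R (unit_ball R d))
    (regH : regular_unitarily_invariant H)
    (exnull : exists E0 : set 'rV[R[i]]_d, E0 !=set0 /\ totally_null H E0)
    (E : set 'rV[R[i]]_d) (subE : E `<=` unit_sphere R d) (cptE : compact E)
    (surjE : restriction_surjective H E) :
  totally_null H E.
Proof.
have mE := compact_measurable cptE.
split=> // mu hmu; apply/(total_variation_eq0 _ mE) => i.
apply: contrapT => /eqP lE.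
have noatom x : E x -> parts mu i [set x] = 0%E.
  by move=> /subE /unit_sphereE x1; exact: (henkin_no_point_mass regH exnull i hmu x1).
have a0 : 0 < total_integral (unit_sphere R d : set (Borel R d)) (fun _ : unit => parts mu i) \1_E.
  rewrite total_integral_indic// fine_gt0// lt_neqAle eq_sym lE measure_ge0 /=.
  by rewrite ltey_eq fin_num_measure.
have [c [f [h [nf fc [bh h4] ha hf]]]] := null_squares regH subE cptE mE surjE noatom a0.
apply: (not_asymptotically_orthogonal mE a0 bh h4 ha).
exact: (henkin_asymptotically_orthogonal regH i hmu nf fc mE subE bh h4 hf).
Qed.
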